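(* Let $g(z)=\sum_{n=0}^\infty \eta_n z^n$ be analytic in the unit disc $\mathbb D$, let $\mathcal R_\eta$ be the associated Rhaly operator, and let $1<p<q<\infty$ be such that $\frac2p-\frac1q<1$. Then: (i) $\mathcal R_{\eta}\in\mathcal B(A^p,A^q)$ if and only if $g\in\Lambda^q_{\frac2p-\frac1q}$. (ii) $\mathcal R_{\eta}\in\mathcal K(A^p,A^q)$ if and only if $g\in\lambda^q_{\frac2p-\frac1q}$.
   Context: $\mathbb D=\{z\in\mathbb C:|z|<1\}$, $\mathrm{Hol}(\mathbb D)$ is the space of analytic functions in $\mathbb D$, and $dA$ is area Lebesgue measure on $\mathbb D$. For $0<p<\infty$ the Bergman space $A^p$ consists of those $f\in\mathrm{Hol}(\mathbb D)$ with $\|f\|_{A^p}^p=\int_{\mathbb D}|f(z)|^p\,dA(z)<\infty$. For $0<r<1$, $M_p(r,f)=\left(\frac1{2\pi}\int_0^{2\pi}|f(re^{it})|^p\,dt\right)^{1/p}$. Rhaly operator: for $f(z)=\sum_{k=0}^\infty a_kz^k\in\mathrm{Hol}(\mathbb D)$, $\mathcal R_{\eta}(f)(z)=\sum_{n=0}^\infty\eta_n\left(\sum_{k=0}^n a_k\right)z^n$, $z\in\mathbb D$. (When $g(z)=\sum\eta_nz^n$ is analytic in $\mathbb D$, this defines an analytic function in $\mathbb D$.) Mean Lipschitz spaces: for $1\le p<\infty$ and $0<\alpha\le1$, $\Lambda^p_\alpha$ is the space of $f\in\mathrm{Hol}(\mathbb D)$ with $M_p(r,f')=O\left((1-r)^{\alpha-1}\right)$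 as $r\to1^-$; $\lambda^p_\alpha$ is the corresponding space with $O$ replaced by $o$. For Banach spaces $X,Y$ of analytic functions in $\mathbb D$, $\mathcal B(X,Y)$ denotes the continuous linear operators from $X$ into $Y$, and $\mathcal K(X,Y)$ the compact linear operators from $X$ into $Y$; $\mathcal R_\eta\in\mathcal B(X,Y)$ (resp. $\mathcal K(X,Y)$) means that $\mathcal R_\eta$ maps $X$ into $Y$ and is bounded (resp. compact). *)

(* Defs.v *)
From HB Require Import structures.
From mathcomp Require Import all_boot all_order all_algebra.
From mathcomp Require Import all_classical all_reals all_analysis.
From mathcomp Require Import complex.

Set Implicit Arguments.
Unset Strict Implicit.
Unset Printing Implicit Defensive.

Import Order.TTheory GRing.Theory Num.Theory.
Import numFieldNormedType.Exports.

Local Open Scope classical_set_scope.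
Local Open Scope ring_scope.
Local Open Scope complex_scope.

(* The topology of R[i] is that of the numFieldType R[i], seen as a normed
   module over itself; derivatives of maps R[i] -> R[i] are thus complex. *)
HB.instance Definition _ (R : rcfType) := GRing.ComAlgebra.copy R[i] R[i]^o.
HB.instance Definition _ (R : rcfType) := Vector.copy R[i] R[i]^o.
HB.instance Definition _ (R : rcfType) := NormedModule.copy R[i] R[i]^o.

(* `|z| : R[i] takes values in R[i]; this is the same modulus as an
   element of R. *)
Definition modulus (R : realType) (z : R[i]) : R := ComplexField.Normc.normc z.

Definition unit_disc (R : realType) : set R[i] := [set z | modulus z < 1].

Definition power_sum_at (R : realType) (a : nat -> R[i]) (z s : R[i]) : Prop :=
  series (fun n => a n * z ^+ n) @ \oo --> s.

(* Elements of Hol(D) are represented by total functions on R[i]; nothing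
   below depends on their values off the unit disc. *)
Definition Hol (R : realType) : set (R[i] -> R[i]) :=
  [set f | forall z0, unit_disc z0 ->
     exists a : nat -> R[i], \forall z \near z0, power_sum_at a (z - z0) (f z)].

(* The coefficient a_k in f(z) = \sum_k a_k z^k *)
Definition taylor_coef (R : realType) (f : R[i] -> R[i]) (k : nat) : R[i] :=
  derive1n k f 0 / k`!%:R.

Definition rhaly (R : realType) (eta : nat -> R[i]) (f : R[i] -> R[i]) :
    R[i] -> R[i] :=
  fun z => lim (series (fun n =>
    eta n * (\sum_(k < n.+1) taylor_coef f k) * z ^+ n) @ \oo).

Definition bergman_integral (R : realType) (p : R) (f : R[i] -> R[i]) : \bar R :=
  (\int[(lebesgue_measure \x lebesgue_measure)%E]_(w in
      [set w : R * R | unit_disc (w.1 +i* w.2)])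
    (modulus (f (w.1 +i* w.2)) `^ p)%:E)%E.

Definition bergman (R : realType) (p : R) : set (R[i] -> R[i]) :=
  [set f | Hol f /\ (bergman_integral p f < +oo)%E].

Definition bergman_norm (R : realType) (p : R) (f : R[i] -> R[i]) : R :=
  fine (bergman_integral p f) `^ p^-1.

Definition integral_mean (R : realType) (p r : R) (f : R[i] -> R[i]) : R :=
  ((2 * pi)^-1 *
   \int[lebesgue_measure]_(t in `[0, 2 * pi])
     (modulus (f (r%:C * (cos t +i* sin t))) `^ p)) `^ p^-1.

Definition mean_lipschitz (R : realType) (p alpha : R) : set (R[i] -> R[i]) :=
  [set f | Hol f /\
     (fun r : R => integral_mean p r (derive1 f))
       =O_ (1^'-) (fun r : R => (1 - r) `^ (alpha - 1))].

Definition little_mean_lipschitz (R : realType) (p alpha : R) :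
    set (R[i] -> R[i]) :=
  [set f | Hol f /\
     (fun r : R => integral_mean p r (derive1 f))
       =o_ (1^'-) (fun r : R => (1 - r) `^ (alpha - 1))].

(* X and Y are spaces of functions with norms nX and nY, given as total
   functions that are only meaningful on X and Y. Linearity of T is not part of
   these predicates: they are meant for operators linear by construction. *)
Definition bounded_operator (R : realType) (X : set (R[i] -> R[i]))
    (nX : (R[i] -> R[i]) -> R) (Y : set (R[i] -> R[i]))
    (nY : (R[i] -> R[i]) -> R) (T : (R[i] -> R[i]) -> (R[i] -> R[i])) : Prop :=
  (forall f, X f -> Y (T f)) /\
  exists M : R, forall f, X f -> nY (T f) <= M * nX f.

Definition compact_operator (R : realType) (X : set (R[i] -> R[i]))
    (nX : (R[i] -> R[i]) -> R) (Y : set (R[i] -> R[i]))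
    (nY : (R[i] -> R[i]) -> R) (T : (R[i] -> R[i]) -> (R[i] -> R[i])) : Prop :=
  (forall f, X f -> Y (T f)) /\
  forall f : nat -> R[i] -> R[i],
    (forall n, X (f n)) -> (exists M : R, forall n, nX (f n) <= M) ->
    exists (s : nat -> nat) (h : R[i] -> R[i]),
      [/\ {homo s : m n / (m < n)%N}, Y h
        & nY (T (f (s n)) \- h) @[n --> \oo] --> (0 : R)].

(* Main.v *)
Require Import Defs.
From mathcomp Require Import all_boot all_order all_algebra.
From mathcomp Require Import all_classical all_reals all_analysis.
From mathcomp Require Import measurable_realfun complex ring lra.
Import Order.TTheory GRing.Theory Num.Theory.
Import numFieldNormedType.Exports.
Local Open Scope ring_scope.

(** Everything is read on Taylor coefficients. A function holomorphic in the disc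
    is the sum [psum a] of one power series ([Hol_global]), the operator sends the
    coefficients [a] to [eta_n * (a_0 + ... + a_n)] ([rhalyE]), and polar coordinates
    turn the Bergman integral into [berg], the integral over the radius of the
    circle integrals [circ] of [|psum a|^p] ([bergman_integralE]). The partial sums
    are the coefficients of [f / (1 - z)], so that the operator takes the
    coefficientwise product of [g] with [f / (1 - z)]. Write [theta = z d/dz] and
    [alpha = 2/p - 1/q]; the mean Lipschitz conditions say that
    [circ q (theta eta) r] is [O] or [o] of [(1 - r)^((alpha - 1) q)].

    Sufficiency. [theta (R_eta f)] is the coefficientwise product of [theta g] and
    [f / (1 - z)], hence a convolution on circles, and Young's inequality
    ([young_circ]) bounds its [L^q] mean on [|z| = r s] by that of [theta g] on
    [|z| = r] times the [L^1] mean of [f / (1 - z)] on [|z| = s]. The latter is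
    controlled by [(1 - s)^(-1) circ p f s] through Hoelder's inequality and the
    kernel estimate for [|1 - z|^(-k)] ([circ1_partial_sum]). Given [u], choosing [s]
    with [1 - s] comparable to [1 - u] and [circ p f s] at most twice its average
    there, and using [p < q], gives [local_estimate]:
    [circ q (theta (R_eta f)) u] is at most
    [C kap |f|^(q - p) (1 - u)^(-q - 1)] times the integral of [circ p f] near [u],
    where [kap] is the Lipschitz constant of [g] on the radii at least [r0].
    Hardy's inequality ([hardy]) passes from [theta h] to [h], and Tonelli's theorem
    gives [main_estimate]:
    [|R_eta f|_q^q <= C (sup_(|z| <= r0) |R_eta f|^q + kap |f|_p^q)].
    The supremum is itself at most a multiple of [|f|_p], which proves boundedness.
    Under the little-o condition [kap] is as small as one likes for [r0] near 1. A
    bounded sequence has a subsequence with convergent coefficients, whose limit is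
    in [A^p] by Fatou's lemma; in the main estimate applied to the differences the
    supremum tends to 0, so that the images converge in [A^q].

    Necessity. Take the function [f_b] for which the partial sums of the coefficients
    are [n^2 b^n]. Then [R_eta f_b (z) = (theta (theta g)) (b z)], while
    [|f_b| <= 4 |1 - b z|^(-2)] gives [|f_b|_p^p <= C (1 - b)^(2 - 2 p)]. If the operator
    is bounded, the integral of [circ q (theta (theta g))] up to the radius [b] is
    therefore at most [C (1 - b)^(-sigma)] with [sigma = (2 - 2/p) q], and Hardy's
    inequality, with a weight averaged over [b] ([hardy_converse]), turns this into the
    Lipschitz condition. If the operator is compact, the normalized [f_b] tend to 0
    pointwise, as do their images; by Fatou's lemma every limit in [A^q] of these
    images is 0, so that [C] can be taken arbitrarily small for [b] near 1, which is
    the little-o condition. *)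

Set Implicit Arguments.
Unset Strict Implicit.
Unset Printing Implicit Defensive.
Local Open Scope classical_set_scope.
Local Open Scope ring_scope.
#[local] Arguments modulus : simpl never.

(** * The modulus as a real-valued norm *)

Section Modulus.
Context {R : realType}.
Implicit Types (x y z w : R[i]) (a b : nat -> R[i]).

Lemma normcE_modulus z : `|z| = (modulus z)%:C%C :> R[i].
Proof. by case: z. Qed.

Lemma modulus_ge0 z : 0 <= modulus z.
Proof. by case: z => u v; apply: sqrtr_ge0. Qed.

Lemma modulus0 : modulus (0 : R[i]) = 0.
Proof. exact: ComplexField.Normc.normc0. Qed.

Lemma modulus1 : modulus (1 : R[i]) = 1.
Proof. exact: ComplexField.Normc.normc1. Qed.

Lemma modulusM z w : modulus (z * w) = modulus z * modulus w.
Proof. exact: ComplexField.Normc.normcM. Qed.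

Lemma modulusV z : modulus z^-1 = (modulus z)^-1.
Proof. exact: ComplexField.Normc.normcV. Qed.

Lemma modulusN z : modulus (- z) = modulus z.
Proof. exact: normcN. Qed.

Lemma ler_modulusD z w : modulus (z + w) <= modulus z + modulus w.
Proof. exact: le_normcD. Qed.

Lemma modulusBC z w : modulus (z - w) = modulus (w - z).
Proof. by rewrite -modulusN opprB. Qed.

Lemma modulus_eq0 z : modulus z = 0 -> z = 0.
Proof. exact: ComplexField.Normc.eq0_normc. Qed.

Lemma ler_modulusB z w : modulus (z - w) <= modulus z + modulus w.
Proof. by rewrite (le_trans (ler_modulusD _ _))// modulusN. Qed.

Lemma ler_modulus_dist z w v : modulus (z - v) <= modulus (z - w) + modulus (w - v).
Proof. by rewrite (le_trans _ (ler_modulusD _ _))// addrA subrK. Qed.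

Lemma lerB_modulus z w : modulus z - modulus w <= modulus (z - w).
Proof. by rewrite lerBlDr (le_trans _ (ler_modulusD _ _))// subrK. Qed.

Lemma modulusX z n : modulus (z ^+ n) = modulus z ^+ n.
Proof. by elim: n => [|n IH]; rewrite ?expr0 ?modulus1// !exprS modulusM IH. Qed.

Lemma modulusR (r : R) : modulus (r%:C%C) = `|r|.
Proof. by rewrite /modulus /= expr0n addr0 sqrtr_sqr. Qed.

Lemma modulus_nat n : modulus (n%:R : R[i]) = n%:R.
Proof.
have -> : (n%:R : R[i]) = (n%:R : R)%:C%C by rewrite rmorph_nat.
by rewrite modulusR ger0_norm.
Qed.

Lemma ler_modulus_sum (I : Type) (r : seq I) (P : pred I) (F : I -> R[i]) :
  modulus (\sum_(i <- r | P i) F i) <= \sum_(i <- r | P i) modulus (F i).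
Proof.
elim/big_ind2: _ => [|z u w v zu wv|//]; first by rewrite modulus0.
by rewrite (le_trans (ler_modulusD _ _))// lerD.
Qed.

Lemma Re_le_modulus z : `|complex.Re z| <= modulus z.
Proof.
case: z => u v; rewrite /modulus /= -sqrtr_sqr ler_wsqrtr// lerDl sqr_ge0 //.
Qed.

Lemma Im_le_modulus z : `|complex.Im z| <= modulus z.
Proof.
case: z => u v; rewrite /modulus /= -sqrtr_sqr ler_wsqrtr// lerDr sqr_ge0 //.
Qed.

Lemma modulus_le_ReIm z : modulus z <= `|complex.Re z| + `|complex.Im z|.
Proof.
case: z => u v; rewrite /modulus /= -[leRHS]ger0_norm ?addr_ge0//.
rewrite -sqrtr_sqr ler_wsqrtr// sqrrD !real_normK ?num_real//.
by rewrite -addrA lerD2l lerDr mulrn_wge0// mulr_ge0.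
Qed.

Lemma cvg_modulusP {T : Type} {F : set_system T} {FF : Filter F}
    (u : T -> R[i]) (l : R[i]) :
  u @ F --> l <-> modulus (u t - l) @[t --> F] --> (0 : R).
Proof.
split=> [/cvgrPdist_lt ul|/cvgrPdist_lt ul]; apply/cvgrPdist_lt => e e0.
  have e0' : 0 < e%:C%C :> R[i] by rewrite ltcR.
  near=> t; rewrite sub0r normrN ger0_norm ?modulus_ge0// modulusBC.
  by rewrite -ltcR -normcE_modulus; near: t; exact: ul.
case: e e0 => e e'; rewrite ltcE/= => /andP[/eqP-> e0].
near=> t; rewrite normcE_modulus.
have -> : (e +i* 0)%C = e%:C%C by [].
rewrite ltcR modulusBC -[ltLHS]ger0_norm ?modulus_ge0// -normrN -sub0r.
by near: t; exact: ul.
Unshelve. all: by end_near. Qed.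

Lemma near_modulusP (z0 : R[i]) (P : R[i] -> Prop) :
  (\forall z \near z0, P z) <->
  exists2 e : R, 0 < e & forall z, modulus (z - z0) < e -> P z.
Proof.
split=> [/nbhs_normP[]|[e e0 eP]].
  case=> e e'/=; rewrite ltcE/= => /andP[/eqP-> e0] eP; exists e => // z ze.
  apply: eP; rewrite /= normcE_modulus modulusBC.
  have -> : (e +i* 0)%C = e%:C%C by [].
  by rewrite ltcR.
apply/nbhs_normP; exists e%:C%C => /=; first by rewrite ltcR.
by move=> z /=; rewrite normcE_modulus ltcR modulusBC; exact: eP.
Qed.

End Modulus.

Section Csum.
Context {R : realType}.
Implicit Types (z w : R[i]) (c d : nat -> R[i]) (b : nat -> R).

(** Real and imaginary parts are summed separately so that the sum of a complex
    series is a total function; it is only meaningful for convergent series. *)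
Definition csum c : R[i] :=
  (limn (series (fun n => complex.Re (c n)))
   +i* limn (series (fun n => complex.Im (c n))))%C.

Definition tail b (N : nat) : R := limn (series b) - series b N.

Lemma Re_sum c N : complex.Re (series c N) = series (fun n => complex.Re (c n)) N.
Proof.
rewrite /series /=; elim: N => [|N IH]; first by rewrite !big_geq.
by rewrite !big_nat_recr//= -IH; case: (\sum_(_ <= _ < _) _) => ? ?; case: (c N).
Qed.

Lemma Im_sum c N : complex.Im (series c N) = series (fun n => complex.Im (c n)) N.
Proof.
rewrite /series /=; elim: N => [|N IH]; first by rewrite !big_geq.
by rewrite !big_nat_recr//= -IH; case: (\sum_(_ <= _ < _) _) => ? ?; case: (c N).
Qed.

Lemma csum_eq c l : series c @ \oo --> l -> csum c = l.
Proof.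
move=> /cvg_modulusP cl; case: l cl => u v cl; rewrite /csum.
have sub0 (f : nat -> R) (k : R) :
    (forall n, `|f n - k| <= modulus (series c n - (u +i* v)%C)) ->
    f @ \oo --> k.
  move=> fk; apply/cvgrPdist_le => e e0; near=> n.
  rewrite distrC (le_trans (fk n))//.
  rewrite -[leLHS]ger0_norm ?modulus_ge0// -normrN -sub0r.
  by near: n; move/cvgrPdist_le : cl; apply.
congr (_ +i* _)%C; apply/cvg_lim => //; apply: sub0 => n.
- rewrite -Re_sum (le_trans _ (Re_le_modulus _))//.
  by case: (series c n).
- rewrite -Im_sum (le_trans _ (Im_le_modulus _))//.
  by case: (series c n).
Unshelve. all: by end_near. Qed.

Lemma series_dominated_cvg (u b : nat -> R) : (forall n, `|u n| <= b n) ->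
  cvgn (series b) -> cvgn (series u).
Proof.
move=> ub cb; apply: normed_cvg; apply: (series_le_cvg _ _ _ cb) => n /=.
- exact: normr_ge0.
- by rewrite (le_trans _ (ub n)).
- exact: ub.
Qed.

Lemma csum_cvg c b : (forall n, modulus (c n) <= b n) -> cvgn (series b) ->
  series c @ \oo --> csum c.
Proof.
move=> cb sb.
have cRe : cvgn (series (fun n => complex.Re (c n))).
  by apply: series_dominated_cvg sb => n; exact: le_trans (Re_le_modulus _) (cb n).
have cIm : cvgn (series (fun n => complex.Im (c n))).
  by apply: series_dominated_cvg sb => n; exact: le_trans (Im_le_modulus _) (cb n).
apply/cvg_modulusP.
pose f N := `|series (fun n => complex.Re (c n)) N - complex.Re (csum c)| +
            `|series (fun n => complex.Im (c n)) N - complex.Im (csum c)|.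
apply: (@squeeze_cvgr _ _ _ _ (cst 0) f) => //.
- near=> n; rewrite modulus_ge0/= (le_trans (modulus_le_ReIm _))// /f.
  by rewrite -Re_sum -Im_sum; case: (series c n) => ? ?.
- exact: cvg_cst.
- have dist0 (u : nat -> R) : cvgn u -> `|u n - limn u| @[n --> \oo] --> 0.
    move=> cu; rewrite -[X in _ --> X](normr0 R); apply: cvg_norm.
    by rewrite -(subrr (limn u)); apply: cvgB => //; exact: cvg_cst.
  by have := cvgD (dist0 _ cRe) (dist0 _ cIm); rewrite addr0; apply.
Unshelve. all: by end_near. Qed.

Lemma cvg_seriesZ (k : R) b : cvgn (series b) -> cvgn (series (fun n => k * b n)).
Proof.
move=> cb; rewrite (_ : (fun n => k * b n) = k *: b)//.
exact: is_cvg_seriesZ.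
Qed.

Lemma limn_seriesZ (k : R) b : cvgn (series b) ->
  limn (series (fun n => k * b n)) = k * limn (series b).
Proof.
move=> cb; rewrite (_ : (fun n => k * b n) = k *: b)//.
exact: lim_seriesZ.
Qed.

Lemma tail_cvg0 b : cvgn (series b) -> tail b @ \oo --> (0 : R).
Proof.
by move=> cb; rewrite -(subrr (limn (series b))); apply: cvgB => //; exact: cvg_cst.
Qed.

Lemma series_nat (V : zmodType) (f : nat -> V) n : series f n = \sum_(k < n) f k.
Proof. by rewrite /series /= big_mkord. Qed.

Lemma series_mono b (m n : nat) : (forall k, 0 <= b k) -> (m <= n)%N ->
  series b m <= series b n.
Proof.
move=> b0 mn; rewrite -subr_ge0 sub_series_geq// sumr_ge0//.
Qed.

Lemma series_le_lim b n : (forall k, 0 <= b k) -> cvgn (series b) ->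
  series b n <= limn (series b).
Proof.
move=> b0 cb; apply: limr_ge => //; near=> k; apply: series_mono => //.
by near: k; exists n.
Unshelve. all: by end_near. Qed.

Lemma tail0 b : tail b 0 = limn (series b).
Proof. by rewrite /tail series_nat big_ord0 subr0. Qed.

(** The bound by a real tail is what makes all later convergences uniform in the
    variable of the power series. *)
Lemma csum_tail c b N : (forall n, modulus (c n) <= b n) -> cvgn (series b) ->
  modulus (csum c - series c N) <= tail b N.
Proof.
move=> cb sb; apply/ler_addgt0Pr => e e0.
have b0 k : 0 <= b k by exact: le_trans (modulus_ge0 _) (cb k).
have /cvg_modulusP/cvgrPdist_le/(_ _ e0)[K _ HK] := csum_cvg cb sb.
have := HK (maxn K N) (leq_maxl _ _); rewrite /= sub0r normrN.
rewrite ger0_norm ?modulus_ge0// modulusBC => H1.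
apply: (le_trans (ler_modulus_dist _ (series c (maxn K N)) _)).
rewrite addrC lerD// sub_series_geq ?leq_maxr//.
apply: (le_trans (ler_modulus_sum _ _ _)).
apply: (@le_trans _ _ (\sum_(N <= k < maxn K N) b k)); first exact: ler_sum.
by rewrite -sub_series_geq ?leq_maxr// lerB// series_le_lim.
Qed.

Lemma csum_le c b : (forall n, modulus (c n) <= b n) -> cvgn (series b) ->
  modulus (csum c) <= limn (series b).
Proof.
move=> cb sb; have := csum_tail 0 cb sb.
by rewrite tail0 series_nat big_ord0 subr0.
Qed.

End Csum.

(** * Power series with complex coefficients *)

Section PowerSeries.
Context {R : realType}.
Implicit Types (z w : R[i]) (a : nat -> R[i]) (r s : R).

Definition psum a z := csum (fun n => a n * z ^+ n).

(** By Abel's lemma this makes the power series converge absolutely in the open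
    disc of radius [r]. *)
Definition rad_coef a r := exists M : R, forall n, modulus (a n) * r ^+ n <= M.

Definition rad_ball a r := forall s, 0 < s < r -> rad_coef a s.

(** Equivalently, the power series with coefficients [a] converges in the unit disc. *)
Definition disc_coef a := rad_ball a 1.

(** Comparison with a geometric series of ratio [s / r]. *)
Lemma rad_summable a r s : rad_coef a r -> 0 <= s < r ->
  cvgn (series (fun n => modulus (a n) * s ^+ n)).
Proof.
move=> [M aM] /andP[s0 sr].
have r0 : 0 < r by exact: le_lt_trans sr.
apply: (@series_le_cvg _ _ (geometric M (s / r))).
- by move=> n; rewrite mulr_ge0 ?modulus_ge0 ?exprn_ge0.
- move=> n; rewrite /= mulr_ge0 ?exprn_ge0 ?divr_ge0 ?(ltW r0)//.
  by rewrite (le_trans _ (aM 0)) ?expr0 ?mulr1 ?modulus_ge0.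
- move=> n; rewrite /= expr_div_n mulrA ler_pdivlMr ?exprn_gt0//.
  by rewrite mulrAC ler_wpM2r ?exprn_ge0.
- apply: is_cvg_geometric_series; rewrite ger0_norm ?divr_ge0 ?(ltW r0)//.
  by rewrite ltr_pdivrMr// mul1r.
Qed.

Lemma rad_coef_le a r s : 0 <= s <= r -> rad_coef a r -> rad_coef a s.
Proof.
move=> /andP[s0 sr] [M aM]; exists M => n; apply: le_trans (aM n).
by rewrite ler_wpM2l ?modulus_ge0// lerXn2r// nnegrE (le_trans s0).
Qed.

Lemma term_le a z s : modulus z <= s ->
  forall n, modulus (a n * z ^+ n) <= modulus (a n) * s ^+ n.
Proof.
move=> zs n; rewrite modulusM modulusX ler_wpM2l ?modulus_ge0//.
by rewrite lerXn2r// nnegrE ?modulus_ge0// (le_trans (modulus_ge0 z)).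
Qed.

Lemma psum_cvg a r z : rad_coef a r -> modulus z < r ->
  power_sum_at a z (psum a z).
Proof.
move=> ar zr; apply: csum_cvg; first exact: (term_le a (lexx _)).
by apply: rad_summable ar _; rewrite modulus_ge0.
Qed.

Lemma psum_eq a z l : power_sum_at a z l -> psum a z = l.
Proof. exact: csum_eq. Qed.

(** The right-hand side does not depend on [z], only on the bound [s] for [|z|]. *)
Lemma psum_trunc a s z N : cvgn (series (fun n => modulus (a n) * s ^+ n)) ->
  modulus z <= s ->
  modulus (psum a z - \sum_(n < N) a n * z ^+ n) <=
    tail (fun n => modulus (a n) * s ^+ n) N.
Proof.
move=> cs zs; rewrite -(series_nat (fun n => a n * z ^+ n)).
by apply: csum_tail => //; exact: term_le.
Qed.

Lemma psum_le a s z : cvgn (series (fun n => modulus (a n) * s ^+ n)) ->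
  modulus z <= s ->
  modulus (psum a z) <= limn (series (fun n => modulus (a n) * s ^+ n)).
Proof. by move=> cs zs; apply: csum_le => //; exact: term_le. Qed.

Lemma psum0 a : psum a 0 = a 0.
Proof.
apply: psum_eq; apply/cvg_modulusP; apply: cvg_near_cst; near=> n.
have n0 : (0 < n)%N by near: n; exists 1%N.
rewrite series_nat -(prednK n0) big_ord_recl expr0 mulr1 big1 ?addr0 ?subrr ?modulus0//.
by move=> k _; rewrite expr0n mulr0.
Unshelve. all: by end_near. Qed.

(** The terms of a convergent series are differences of its bounded partial sums. *)
Lemma power_sum_rad a z l : power_sum_at a z l -> rad_coef a (modulus z).
Proof.
move=> /cvg_modulusP cl.
have /cvg_seq_bounded[K [_ HK]] : cvgn (fun n =>
  modulus (series (fun n => a n * z ^+ n) n - l)) by apply/cvg_ex; exists 0.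
have {}HK n : modulus (series (fun n => a n * z ^+ n) n - l) <= `|K| + 1.
  have := HK (`|K| + 1); rewrite (le_lt_trans (ler_norm K)) ?ltrDl//.
  by move=> /(_ isT n Logic.I); exact: le_trans (ler_norm _).
exists ((`|K| + 1) + (`|K| + 1)) => n.
rewrite -modulusX -modulusM.
have -> : a n * z ^+ n = (series (fun n => a n * z ^+ n) n.+1 - l) -
   (series (fun n => a n * z ^+ n) n - l).
  by rewrite opprB addrA subrK !series_nat big_ord_recr/= addrAC subrr add0r.
by rewrite (le_trans (ler_modulusB _ _))// lerD.
Qed.

Lemma disc_rad a z : disc_coef a -> modulus z < 1 ->
  exists2 r, rad_coef a r & modulus z < r < 1.
Proof.
move=> da z1; exists ((modulus z + 1) / 2); last by rewrite midf_lt// midf_lt.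
by apply: da; rewrite midf_lt// andbT divr_gt0// ltr_wpDl// modulus_ge0.
Qed.

Lemma disc_summable a s : disc_coef a -> 0 <= s < 1 ->
  cvgn (series (fun n => modulus (a n) * s ^+ n)).
Proof.
move=> da /andP[s0 s1]; apply: (@rad_summable a ((s + 1) / 2)).
  by apply: da; rewrite midf_lt// andbT divr_gt0// ltr_wpDl.
by rewrite s0 midf_lt.
Qed.

Lemma disc_psum_cvg a z : disc_coef a -> modulus z < 1 ->
  power_sum_at a z (psum a z).
Proof. by move=> da z1; have [r ar /andP[zr _]] := disc_rad da z1; exact: psum_cvg ar zr. Qed.

End PowerSeries.

(** * Averages over roots of unity *)

Section RootsOfUnity.
Context {R : realType}.
Implicit Types (t x y : R).

Definition cis t : R[i] := (cos t +i* sin t)%C.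

Lemma cis0 : cis 0 = 1.
Proof. by rewrite /cis cos0 sin0. Qed.

Lemma cisD x y : cis (x + y) = cis x * cis y.
Proof.
rewrite /cis sinD cosD; apply/eqP; rewrite eq_complex/= eqxx/=.
by rewrite addrC.
Qed.

Lemma cisX x n : cis x ^+ n = cis (n%:R * x).
Proof.
elim: n => [|n IH]; first by rewrite mul0r cis0.
by rewrite exprS IH -cisD -nat1r mulrDl mul1r.
Qed.

Lemma modulus_cis t : modulus (cis t) = 1.
Proof. by rewrite /modulus /= cos2Dsin2 sqrtr1. Qed.

Lemma cis_neq0 t : cis t != 0.
Proof.
by apply/eqP => t0; have := modulus_cis t; rewrite t0 modulus0 => /eqP; rewrite eq_sym oner_eq0.
Qed.

Lemma cisN t : cis (- t) = (cis t)^-1.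
Proof. by apply: (mulIf (cis_neq0 t)); rewrite -cisD addNr cis0 mulVf ?cis_neq0. Qed.

Lemma cisD2pi t : cis (t + pi *+ 2) = cis t.
Proof. by rewrite /cis cosD2pi sinD2pi. Qed.

Lemma cis_eq1 t : 0 < t < pi *+ 2 -> cis t != 1.
Proof.
move=> /andP[t0 t2]; apply/negP; rewrite eq_complex/= => /andP[/eqP ct _].
have h : t = (t / 2) *+ 2 by rewrite mulr2n -splitr.
have s0 : 0 < sin (t / 2).
  by rewrite sin_gt0_pi// divr_gt0//= ltr_pdivrMr// mulr_natr.
have := cos2Dsin2 (t / 2); move: ct; rewrite {1}h cos_mulr2n => ct.
have := exprn_gt0 2 s0; lra.
Qed.

Definition node (N j : nat) : R := j%:R * (2 * pi / N%:R).

Lemma node_bound N j : (j < N)%N -> 0 <= node N j <= 2 * pi.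
Proof.
move=> jN; have N0 : (0 < N)%N by exact: leq_ltn_trans jN.
rewrite /node mulr_ge0 ?divr_ge0 ?mulr_ge0 ?pi_ge0//=.
rewrite mulrA ler_pdivrMr ?ltr0n// mulrC ler_wpM2l ?mulr_ge0 ?pi_ge0//.
by rewrite ler_nat ltnW.
Qed.

Lemma sum_root_unity (z : R[i]) N : z ^+ N = 1 -> z != 1 -> \sum_(j < N) z ^+ j = 0.
Proof.
move=> zN z1; have := subrX1 z N; rewrite zN subrr => /esym/eqP.
by rewrite mulf_eq0 subr_eq0 (negbTE z1)/= => /eqP.
Qed.

Lemma sum_nodes N (m n : nat) : (m < N)%N -> (n < N)%N ->
  \sum_(j < N) cis (- node N j) ^+ m * cis (node N j) ^+ n =
  if m == n then N%:R else 0.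
Proof.
move=> mN nN; have N0 : (0 < N)%N by exact: leq_ltn_trans mN.
have Nr0 : N%:R != 0 :> R by rewrite pnatr_eq0 -lt0n.
pose w := cis (2 * pi / N%:R).
have wN : w ^+ N = 1.
  rewrite cisX mulrCA mulfV// mulr1 -[LHS]mul1r -cis0 -cisD.
  by rewrite mulrC mulr_natr cisD2pi cis0.
have w1 k : (0 < k < N)%N -> w ^+ k != 1.
  move=> /andP[k0 kN]; rewrite cisX; apply: cis_eq1.
  rewrite mulr_gt0 ?divr_gt0 ?mulr_gt0 ?pi_gt0 ?ltr0n//= mulrA ltr_pdivrMr ?ltr0n//.
  have -> : pi *+ 2 * N%:R = N%:R * (2 * pi) :> R by ring.
  by rewrite ltr_pM2r ?mulr_gt0 ?pi_gt0// ltr_nat.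
have w0 : w != 0 by exact: cis_neq0.
have E (j : 'I_N) : cis (- node N j) ^+ m * cis (node N j) ^+ n = (w ^- m * w ^+ n) ^+ j.
  rewrite cisN /node -cisX exprMn !exprVn -!exprM [(m * j)%N]mulnC.
  by rewrite [(n * j)%N]mulnC.
rewrite (eq_bigr _ (fun j _ => E j)); case: eqVneq => [->|mn].
  by rewrite mulVf ?expf_neq0// (eq_bigr (fun=> 1)) ?sumr_const ?card_ord// => i _; rewrite expr1n.
apply: sum_root_unity.
  by rewrite exprMn -exprVn -!exprM [(m * _)%N]mulnC [(n * _)%N]mulnC !exprM wN exprVn wN invr1 !expr1n mulr1.
apply/negP => /eqP E1.
have {}E1 : w ^+ n = w ^+ m.
  by rewrite -[RHS]mulr1 -E1 mulrA mulfV ?mul1r// expf_neq0.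
wlog mn' : m n mN nN mn E1 {E} / (m < n)%N.
  move=> H; have [/H|] := ltnP m n; first exact.
  rewrite leq_eqVlt eq_sym (negbTE mn)/=.
  by apply: H => //; rewrite eq_sym.
have := w1 (n - m)%N; rewrite subn_gt0 mn' (leq_ltn_trans (leq_subr _ _) nN) => /(_ isT)/negP; apply.
by rewrite -(inj_eq (mulfI (expf_neq0 m w0))) -exprD subnKC ?(ltnW mn')// E1 mulr1.
Qed.

(** Orthogonality of the characters of the cyclic group of order [N]: for
    polynomials of degree less than [N] the discrete convolution over the [N]-th roots
    of unity is exact. *)
Lemma node_average_trunc N (g a : nat -> R[i]) (x y : R[i]) : (0 < N)%N ->
  N%:R^-1 * \sum_(j < N)
     ((\sum_(m < N) g m * (x * cis (- node N j)) ^+ m) *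
      (\sum_(n < N) a n * (y * cis (node N j)) ^+ n)) =
  \sum_(n < N) g n * a n * (x * y) ^+ n.
Proof.
move=> N0.
have Nr0 : N%:R != 0 :> R[i] by rewrite pnatr_eq0 -lt0n.
transitivity (N%:R^-1 * \sum_(m < N) \sum_(n < N) g m * x ^+ m * (a n * y ^+ n) *
   \sum_(j < N) cis (- node N j) ^+ m * cis (node N j) ^+ n).
  congr (_ * _); under eq_bigr do rewrite big_distrlr/=.
  rewrite exchange_big; apply: eq_bigr => m _ /=.
  rewrite exchange_big; apply: eq_bigr => n _ /=.
  rewrite mulr_sumr; apply: eq_bigr => j _.
  by rewrite !exprMn; ring.
rewrite mulr_sumr; apply: eq_bigr => m _.
rewrite (bigD1 m)//= sum_nodes// big1 => [|n nm]; last first.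
  by rewrite sum_nodes// eq_sym; rewrite -val_eqE/= in nm; rewrite (negbTE nm) mulr0.
by rewrite eqxx addr0 exprMn; field.
Qed.

(** Discrete form of [1/(2 pi) int G(x e^(-it)) F(y e^(it)) dt = sum g_n a_n (x y)^n].
    Averages over roots of unity replace the integral, so that convexity inequalities
    can be applied to finite sums and no complex-valued integral is needed; the error is
    uniform on the closed discs of radii [r] and [s]. *)
Lemma node_average (g a : nat -> R[i]) (r s : R) : 0 <= r -> 0 <= s ->
  cvgn (series (fun n => modulus (g n) * r ^+ n)) ->
  cvgn (series (fun n => modulus (a n) * s ^+ n)) ->
  exists2 err : nat -> R, err @ \oo --> (0 : R) &
  forall N (x y : R[i]), (0 < N)%N -> modulus x <= r -> modulus y <= s ->
  modulus (N%:R^-1 * \sum_(j < N)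
     (psum g (x * cis (- node N j)) * psum a (y * cis (node N j)))
   - psum (fun n => g n * a n) (x * y)) <= err N.
Proof.
move=> r0 s0 cg ca.
set bg := fun n => modulus (g n) * r ^+ n.
set ba := fun n => modulus (a n) * s ^+ n.
pose bp n := modulus (g n * a n) * (r * s) ^+ n.
have bg0 n : 0 <= bg n by rewrite mulr_ge0 ?modulus_ge0 ?exprn_ge0.
have ba0 n : 0 <= ba n by rewrite mulr_ge0 ?modulus_ge0 ?exprn_ge0.
have bgB n : bg n <= limn (series bg).
  apply: (le_trans _ (series_le_lim n.+1 bg0 cg)).
  by rewrite series_nat big_ord_recr/= lerDr sumr_ge0.
have cp : cvgn (series bp).
  apply: (@series_le_cvg _ _ (fun n => limn (series bg) * ba n)).
  - by move=> n; rewrite mulr_ge0 ?modulus_ge0 ?exprn_ge0 ?mulr_ge0.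
  - by move=> n; rewrite mulr_ge0// (le_trans (bg0 0) (bgB 0)).
  - move=> n; rewrite /bp modulusM exprMn mulrACA ler_wpM2r ?bgB//; exact: ba0.
  - exact: cvg_seriesZ.
pose G := limn (series bg); pose A := limn (series ba).
exists (fun N => tail bg N * A + G * tail ba N + tail bp N).
  rewrite -[X in _ --> X](_ : 0 * A + G * 0 + 0 = 0); last by rewrite mulr0 mul0r !addr0.
  apply: cvgD; last exact: tail_cvg0.
  apply: cvgD; [apply: cvgM; [exact: tail_cvg0|exact: cvg_cst] |
    apply: cvgM; [exact: cvg_cst|exact: tail_cvg0]].
move=> N x y N0 xr ys.
have Nr0 : N%:R != 0 :> R[i] by rewrite pnatr_eq0 -lt0n.
have xyrs : modulus (x * y) <= r * s by rewrite modulusM ler_pM// modulus_ge0.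
apply: (le_trans (ler_modulus_dist _ (\sum_(n < N) g n * a n * (x * y) ^+ n) _)).
apply: lerD; last by rewrite modulusBC; apply: psum_trunc.
rewrite -node_average_trunc// -mulrBr -sumrB modulusM modulusV modulus_nat.
rewrite ler_pdivrMl ?ltr0n//.
apply: (le_trans (ler_modulus_sum _ _ _)).
apply: (@le_trans _ _ (\sum_(j < N) (tail bg N * A + G * tail ba N))); last first.
  by rewrite sumr_const card_ord mulr_natl.
apply: ler_sum => j _.
have xr' : modulus (x * cis (- node N j)) <= r by rewrite modulusM modulus_cis mulr1.
have ys' : modulus (y * cis (node N j)) <= s by rewrite modulusM modulus_cis mulr1.
set X := x * _ in xr' *; set Y := y * _ in ys' *.
have -> : psum g X * psum a Y - (\sum_(m < N) g m * X ^+ m) * (\sum_(n < N) a n * Y ^+ n) =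
  (psum g X - \sum_(m < N) g m * X ^+ m) * psum a Y +
  (\sum_(m < N) g m * X ^+ m) * (psum a Y - \sum_(n < N) a n * Y ^+ n).
  by rewrite mulrBl mulrBr addrA subrK.
rewrite (le_trans (ler_modulusD _ _))// !modulusM lerD//.
  by rewrite ler_pM ?modulus_ge0 ?psum_trunc ?psum_le.
rewrite ler_pM ?modulus_ge0 ?psum_trunc//.
rewrite (le_trans (ler_modulus_sum _ _ _))//.
rewrite (le_trans _ (series_le_lim N bg0 cg))// series_nat ler_sum// => n _.
exact: term_le.
Qed.

(** The average of [node_average] with [G(z) = z^k] extracts the coefficient of
    index [k] from the values on the circle. *)
Lemma cauchy_estimate (a : nat -> R[i]) (s M : R) k : 0 <= s ->
  cvgn (series (fun n => modulus (a n) * s ^+ n)) ->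
  (forall y : R[i], modulus y = s -> modulus (psum a y) <= M) ->
  modulus (a k) * s ^+ k <= M.
Proof.
move=> s0 ca HM.
pose g n : R[i] := if n == k then 1 else 0.
have gs z : power_sum_at g z (z ^+ k).
  apply/cvg_modulusP; apply: cvg_near_cst; near=> n.
  have nk : (k < n)%N by near: n; exists k.+1.
  rewrite series_nat (bigD1 (Ordinal nk))//= /g eqxx mul1r big1 ?addr0 ?subrr ?modulus0//.
  by move=> j; rewrite -val_eqE/= => /negbTE ->; rewrite mul0r.
have gE z : psum g z = z ^+ k by exact: psum_eq.
have cg : cvgn (series (fun n => modulus (g n) * 1 ^+ n)).
  apply/cvg_ex; exists 1; apply: cvg_near_cst; near=> n.
  have nk : (k < n)%N by near: n; exists k.+1.
  rewrite series_nat (bigD1 (Ordinal nk))//= /g eqxx modulus1 mul1r expr1n big1 ?addr0//.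
  by move=> j; rewrite -val_eqE/= => /negbTE ->; rewrite modulus0 mul0r.
have [err err0 Herr] := node_average ler01 s0 cg ca.
apply/ler_addgt0Pr => e e0.
move/cvgrPdist_le : err0 => /(_ _ e0)[N _ HN].
have := HN N.+1 (leqnSn _); rewrite /= sub0r normrN => HN'.
have := Herr N.+1 1 s%:C%C isT; rewrite modulus1 modulusR ger0_norm// => /(_ (lexx _) (lexx _)).
set S := _ * \sum_(_ < _) _ => H1.
have gaE : psum (fun n => g n * a n) (1 * s%:C%C) = a k * s%:C%C ^+ k.
  rewrite mul1r; apply: psum_eq; apply/cvg_modulusP; apply: cvg_near_cst; near=> n.
  have nk : (k < n)%N by near: n; exists k.+1.
  rewrite series_nat (bigD1 (Ordinal nk))//= /g eqxx mul1r big1 ?addr0 ?subrr ?modulus0//.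
  by move=> j; rewrite -val_eqE/= => /negbTE ->; rewrite !mul0r.
rewrite gaE in H1.
have -> : modulus (a k) * s ^+ k = modulus (a k * s%:C%C ^+ k).
  by rewrite modulusM modulusX modulusR ger0_norm.
have SM : modulus S <= M.
  rewrite /S modulusM modulusV modulus_nat ler_pdivrMl ?ltr0n//.
  apply: (le_trans (ler_modulus_sum _ _ _)).
  apply: (@le_trans _ _ (\sum_(j < N.+1) M)); last by rewrite sumr_const card_ord mulr_natl.
  apply: ler_sum => j _.
  rewrite mul1r modulusM gE modulusX modulus_cis expr1n mul1r.
  by apply: HM; rewrite modulusM modulusR modulus_cis mulr1 ger0_norm.
have := lerB_modulus (a k * s%:C%C ^+ k) S; rewrite modulusBC => H2.
have := ler_norm (err N.+1).
move: H1 H2 SM HN'; lra.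
Unshelve. all: by end_near. Qed.

End RootsOfUnity.

(** * Recentering, derivatives and Taylor coefficients *)

Section Reexpansion.
Context {R : realType}.
Implicit Types (z w h : R[i]) (a b : nat -> R[i]).

Definition recenter a w (k : nat) : R[i] :=
  csum (fun n => a n * 'C(n, k)%:R * w ^+ (n - k)).

Let majo a (s r : R) k n := modulus (a n) * 'C(n, k)%:R * s ^+ (n - k) * r ^+ k.

Let majo_le a (s r : R) k n : 0 <= s -> 0 <= r ->
  majo a s r k n <= modulus (a n) * (s + r) ^+ n.
Proof.
move=> s0 r0; rewrite /majo -!mulrA ler_wpM2l ?modulus_ge0// exprDn.
have [nk|nk] := ltnP n k.
  by rewrite bin_small// mul0r sumr_ge0// => i _; rewrite mulrn_wge0// mulr_ge0 ?exprn_ge0.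
rewrite (bigD1 (Ordinal (nk : (k < n.+1)%N)))//= mulr_natl lerDl sumr_ge0// => i _.
by rewrite mulrn_wge0// mulr_ge0 ?exprn_ge0.
Qed.

Lemma recenter_term_le a (s t : R) w k n : 0 < t -> modulus w <= s ->
  modulus (a n * 'C(n, k)%:R * w ^+ (n - k)) <=
    t ^- k * (modulus (a n) * (s + t) ^+ n).
Proof.
move=> t0 ws; have s0 : 0 <= s := le_trans (modulus_ge0 _) ws.
rewrite ler_pdivlMl ?exprn_gt0// mulrC (le_trans _ (majo_le a k n s0 (ltW t0)))//.
rewrite /majo ler_wpM2r ?exprn_ge0 ?(ltW t0)// !modulusM modulus_nat modulusX.
by rewrite ler_wpM2l ?mulr_ge0 ?modulus_ge0// lerXn2r// nnegrE ?modulus_ge0.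
Qed.

Lemma recenter_rad a (s r : R) w : 0 < r ->
  cvgn (series (fun n => modulus (a n) * (s + r) ^+ n)) -> modulus w <= s ->
  rad_coef (recenter a w) r.
Proof.
move=> r0 ca ws; exists (limn (series (fun n => modulus (a n) * (s + r) ^+ n))) => k.
have s0 : 0 <= s := le_trans (modulus_ge0 _) ws.
have H n := recenter_term_le a k n r0 ws.
rewrite -ler_pdivlMr ?exprn_gt0// mulrC.
have cr : cvgn (series (fun n => r ^- k * (modulus (a n) * (s + r) ^+ n))).
  exact: cvg_seriesZ.
apply: (le_trans (csum_le H cr)).
by rewrite limn_seriesZ.
Qed.

Lemma cvg_sumC (F : nat -> nat -> R[i]) (l : nat -> R[i]) N :
  (forall k, F k @ \oo --> l k) ->
  (fun M => \sum_(k < N) F k M) @ \oo --> \sum_(k < N) l k.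
Proof.
move=> Fl; elim: N => [|N IH].
  by rewrite big_ord0; under eq_fun do rewrite big_ord0; exact: cvg_cst.
rewrite big_ord_recr (_ : (fun M => _) = (fun M => \sum_(k < N) F k M + F N M)).
  exact: (cvgD IH (Fl N)).
by apply/funext => M; rewrite big_ord_recr.
Qed.

(** The binomial theorem on partial sums, where all exchanges of summations are
    finite; the error is a tail of [sum |a_n| (s + r)^n]. *)
Lemma psum_recenter a (s r : R) w h : 0 < r ->
  cvgn (series (fun n => modulus (a n) * (s + r) ^+ n)) -> modulus w <= s ->
  modulus h <= r ->
  power_sum_at (recenter a w) h (psum a (w + h)).
Proof.
move=> r0 ca ws hr.
have s0 : 0 <= s := le_trans (modulus_ge0 _) ws.
set b := fun n => modulus (a n) * (s + r) ^+ n.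
have b0 n : 0 <= b n by rewrite mulr_ge0 ?modulus_ge0 ?exprn_ge0 ?addr_ge0// ltW.
have whs : modulus (w + h) <= s + r.
  by rewrite (le_trans (ler_modulusD _ _))// lerD.
pose c k n := a n * 'C(n, k)%:R * w ^+ (n - k).
have cH k n : modulus (c k n) <= r ^- k * b n by exact: recenter_term_le.
have cr k : cvgn (series (fun n => r ^- k * b n)) by exact: cvg_seriesZ.
have ccvg k : series (c k) @ \oo --> recenter a w k by exact: csum_cvg (cH k) (cr k).
have binE n : a n * (w + h) ^+ n = \sum_(k < n.+1) c k n * h ^+ k.
  rewrite exprDn mulr_sumr; apply: eq_bigr => k _.
  by rewrite /c -mulr_natr; ring.
(* for k > n the binomial coefficient vanishes, so both sums are over n, k < N *)
have truncE N : \sum_(n < N) a n * (w + h) ^+ n = \sum_(k < N) series (c k) N * h ^+ k.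
  under [RHS]eq_bigr do rewrite series_nat mulr_suml.
  rewrite exchange_big/=; apply: eq_bigr => n _; rewrite binE.
  rewrite -!(big_mkord xpredT (fun k => c k n * h ^+ k)).
  rewrite [RHS](@big_cat_nat _ _ _ n.+1)//= [X in _ = _ + X]big_nat_cond [X in _ = _ + X]big1 ?addr0// => k.
  by rewrite andbT => /andP[nk _]; rewrite /c bin_small// mulr0 !mul0r.
have blk N M : (N <= M)%N -> modulus (\sum_(k < N) (series (c k) M - series (c k) N) * h ^+ k)
     <= tail b N.
  move=> NM; under eq_bigr do rewrite sub_series_geq// mulr_suml.
  rewrite exchange_big/=; apply: (@le_trans _ _ (\sum_(N <= n < M) b n)); last first.
    by rewrite -sub_series_geq// lerB// series_le_lim.
  rewrite (le_trans (ler_modulus_sum _ _ _))// big_nat_cond [leRHS]big_nat_cond.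
  apply: ler_sum => n; rewrite andbT => /andP[Nn _].
  rewrite (le_trans (ler_modulus_sum _ _ _))// /b exprDn mulr_sumr.
  rewrite -(big_mkord xpredT (fun k => modulus (c k n * h ^+ k))).
  rewrite -(big_mkord xpredT (fun k => modulus (a n) * (s ^+ (n - k) * r ^+ k *+ 'C(n, k)))).
  rewrite [leRHS](@big_cat_nat _ _ _ N)//=; last by rewrite ltnW// ltnS.
  rewrite -[leLHS]addr0 lerD//; last first.
    by rewrite sumr_ge0// => k _; rewrite mulr_ge0 ?modulus_ge0 ?mulrn_wge0 ?mulr_ge0 ?exprn_ge0// ltW.
  apply: ler_sum => k _; rewrite !modulusM modulus_nat !modulusX.
  rewrite [leRHS](_ : _ = modulus (a n) * 'C(n, k)%:R * s ^+ (n - k) * r ^+ k); last first.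
    by rewrite -mulr_natl; ring.
  rewrite ler_pM ?mulr_ge0 ?exprn_ge0 ?modulus_ge0//; last first.
    by rewrite lerXn2r// nnegrE ?modulus_ge0 ?ltW.
  by rewrite ler_wpM2l ?mulr_ge0 ?modulus_ge0// lerXn2r// nnegrE ?modulus_ge0.
have lim N : modulus (\sum_(k < N) (recenter a w k - series (c k) N) * h ^+ k) <= tail b N.
  have /cvg_modulusP cc : (fun M => \sum_(k < N) (series (c k) M - series (c k) N) * h ^+ k) @ \oo -->
      \sum_(k < N) (recenter a w k - series (c k) N) * h ^+ k.
    apply: (@cvg_sumC (fun k M => (series (c k) M - series (c k) N) * h ^+ k)
      (fun k => (recenter a w k - series (c k) N) * h ^+ k)) => k.
    by apply: cvgM; [apply: cvgB; [exact: ccvg|exact: cvg_cst] | exact: cvg_cst].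
  apply/ler_addgt0Pr => e e0.
  move/cvgrPdist_le : cc => /(_ _ e0)[K _ HK].
  have := HK (maxn K N) (leq_maxl _ _); rewrite /= sub0r normrN ger0_norm ?modulus_ge0// => H1.
  have H2 := blk N (maxn K N) (leq_maxr _ _).
  rewrite modulusBC in H1; have := lerB_modulus (\sum_(k < N) (recenter a w k - series (c k) N) * h ^+ k)
    (\sum_(k < N) (series (c k) (maxn K N) - series (c k) N) * h ^+ k).
  by lra.
apply/cvg_modulusP; apply: (@squeeze_cvgr _ _ _ _ (cst 0) (fun N => tail b N + tail b N)).
- near=> N; rewrite modulus_ge0/=.
  apply: (le_trans (ler_modulus_dist _ (\sum_(n < N) a n * (w + h) ^+ n) _)).
  rewrite lerD//; last by rewrite modulusBC; apply: psum_trunc.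
  rewrite series_nat truncE -sumrB; under eq_bigr do rewrite -mulrBl.
  exact: lim.
- exact: cvg_cst.
- by rewrite -[X in _ --> X]addr0; apply: cvgD; apply: tail_cvg0.
Unshelve. all: by end_near. Qed.

End Reexpansion.

Section Derivative.
Context {R : realType}.
Implicit Types (z w h : R[i]) (a b : nat -> R[i]) (f : R[i] -> R[i]).

Lemma rad_summable_half a r : 0 < r -> rad_coef a r ->
  cvgn (series (fun n => modulus (a n) * (r / 2) ^+ n)).
Proof.
move=> r0 ar; apply: rad_summable ar _.
by rewrite divr_ge0 ?(ltW r0)//= ltr_pdivrMr// ltr_pMr// ltr1n.
Qed.

(** Second-order Taylor bound at the centre, which yields all the derivatives
    used below without any difference quotient. *)
Lemma psum_quadratic a r : 0 < r -> rad_coef a r ->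
  exists K : R, forall h, modulus h <= r / 2 ->
   modulus (psum a h - a 0 - a 1 * h) <= K * modulus h ^+ 2.
Proof.
move=> r0 ar; pose t := r / 2.
have t0 : 0 < t by rewrite divr_gt0.
have ca : cvgn (series (fun n => modulus (a n) * t ^+ n)) by exact: rad_summable_half.
pose b n := modulus (a n) * t ^+ n.
exists (t ^- 2 * limn (series b)) => h hr.
have b0 n : 0 <= b n by rewrite mulr_ge0 ?modulus_ge0 ?exprn_ge0// ltW.
have ht : modulus h < r by rewrite (le_lt_trans hr)// ltr_pdivrMr// ltr_pMr// ltr1n.
have /cvg_modulusP cc := psum_cvg ar ht.
apply/ler_addgt0Pr => e e0.
move/cvgrPdist_le : cc => /(_ _ e0)[K _ HK].
have := HK (K + 2)%N (leq_addr _ _); rewrite /= sub0r normrN ger0_norm ?modulus_ge0// => H1.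
have -> : psum a h - a 0 - a 1 * h = (psum a h - series (fun n => a n * h ^+ n) (K + 2)%N)
  + (series (fun n => a n * h ^+ n) (K + 2)%N - a 0 - a 1 * h).
  by rewrite !addrA subrK.
rewrite (le_trans (ler_modulusD _ _))// addrC lerD//; last by rewrite modulusBC.
rewrite series_nat addn2.
have -> : \sum_(k < K.+2) a k * h ^+ k - a 0 - a 1 * h = \sum_(i < K) a i.+2 * h ^+ i.+2.
  have cancel (x y T : R[i]) : x + (y + T) - x - y = T.
    by rewrite [x + _]addrC addrK addrC addKr.
  by rewrite !big_ord_recl/= expr0 mulr1 expr1 cancel.
rewrite (le_trans (ler_modulus_sum _ _ _))//.
apply: (@le_trans _ _ (\sum_(i < K) modulus h ^+ 2 * (t ^- 2 * b i.+2))).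
  apply: ler_sum => i _; rewrite modulusM modulusX /b -[i.+2]add2n !exprD.
  rewrite [t ^- 2 * _](_ : _ = modulus (a (2 + i)%N) * t ^+ i); last first.
    by field; rewrite gt_eqF.
  rewrite mulrCA ler_wpM2l ?exprn_ge0 ?modulus_ge0// ler_wpM2l ?modulus_ge0//.
  by rewrite lerXn2r// nnegrE ?modulus_ge0// ltW.
rewrite -mulr_sumr mulrC -mulr_sumr ler_wpM2r ?exprn_ge0 ?modulus_ge0//.
rewrite ler_wpM2l ?invr_ge0 ?exprn_ge0 ?(ltW t0)//.
rewrite (le_trans _ (series_le_lim K.+2 b0 ca))// series_nat !big_ord_recl/=.
by rewrite -[leLHS]add0r lerD ?b0// -[leLHS]add0r lerD ?b0.
Qed.

Lemma derive1_center f a z0 r : 0 < r -> rad_coef a r ->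
  (\forall z \near z0, f z = psum a (z - z0)) ->
  derive1 f z0 = a 1.
Proof.
move=> r0 ar fa.
have f0 : f z0 = a 0 by have /near_modulusP[e e0 ->] := fa; rewrite ?subrr ?psum0 ?modulus0.
have [K HK] := psum_quadratic r0 ar.
have /near_modulusP[e e0 He] := fa.
rewrite /derive1; apply/cvg_lim => //.
apply/cvg_modulusP; apply: (@squeeze_cvgr _ _ _ _ (cst 0) (fun h : R[i] => K * modulus h)).
- apply/near_modulusP; exists (Num.min e (r / 2)); first by rewrite lt_min e0 divr_gt0.
  move=> h /=; rewrite subr0 lt_min => /andP[he hr] h0.
  rewrite modulus_ge0/= He ?addrK// f0.
  rewrite [X in modulus X](_ : _ = h^-1 * (psum a h - a 0 - a 1 * h)); last first.
    rewrite mulrBr [_ *: _](_ : _ = h^-1 * (psum a h - a 0))//.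
    by rewrite [a 1 * h]mulrC mulKf.
  rewrite modulusM modulusV ler_pdivrMl; last first.
    by rewrite lt_neqAle modulus_ge0 andbT eq_sym; apply: contra h0 => /eqP/modulus_eq0 ->.
  by rewrite (le_trans (HK _ (ltW hr)))// expr2 mulrCA mulrA.
- exact: cvg_cst.
- rewrite -[X in _ --> X](mulr0 K); apply: cvgM; first exact: cvg_cst.
  have /cvg_modulusP : (fun h : R[i] => h) @ (0 : R[i])^' --> (0 : R[i]).
    by apply: (@cvg_within_filter _ _ (fun h : R[i] => h)); exact: cvg_id.
  by apply: cvg_trans; apply: near_eq_cvg; near=> h; rewrite subr0.
Unshelve. all: by end_near. Qed.

End Derivative.

Section Holomorphy.
Context {R : realType}.
Implicit Types (z w h : R[i]) (a b : nat -> R[i]) (f : R[i] -> R[i]).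

Definition dcoef a (n : nat) : R[i] := n.+1%:R * a n.+1.

Lemma rad_ball_sub a r s : s <= r -> rad_ball a r -> rad_ball a s.
Proof. by move=> sr ar t /andP[t0 ts]; apply: ar; rewrite t0 (lt_le_trans ts). Qed.

Lemma rad_ball_mid a r z : rad_ball a r -> modulus z < r ->
  rad_coef a ((modulus z + r) / 2) /\ 0 < (modulus z + r) / 2.
Proof.
move=> ar zr; have r0 : 0 < r := le_lt_trans (modulus_ge0 _) zr.
have : 0 < (modulus z + r) / 2 by rewrite divr_gt0// ltr_wpDl ?modulus_ge0.
by move=> H; split => //; apply: ar; rewrite H midf_lt.
Qed.

Lemma rad_ball_summable a r s : rad_ball a r -> 0 <= s < r ->
  cvgn (series (fun n => modulus (a n) * s ^+ n)).
Proof.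
move=> ar /andP[s0 sr]; have r0 := le_lt_trans s0 sr.
apply: (@rad_summable _ a ((s + r) / 2)); last by rewrite s0 midf_lt.
by apply: ar; rewrite midf_lt// andbT divr_gt0// ltr_wpDl.
Qed.

Lemma rad_ball_dcoef a r : rad_ball a r -> rad_ball (dcoef a) r.
Proof.
move=> ar s /andP[s0 sr]; have r0 := lt_trans s0 sr.
have [sm mr] := (midf_lt sr); have m0 := lt_trans s0 sm.
have /(_ _)[|M aM] := ar ((s + r) / 2); first by rewrite m0.
pose d := (s + r) / 2 - s; have d0 : 0 < d by rewrite subr_gt0.
exists (M / d) => n; rewrite ler_pdivlMr// (le_trans _ (aM n.+1))//.
rewrite /dcoef modulusM modulus_nat mulrAC -mulrA -mulrA mulrCA ler_wpM2l ?modulus_ge0//.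
have -> : (s + r) / 2 = s + d by rewrite /d; ring.
rewrite exprDn (bigD1 (Ordinal (isT : (1 < n.+2)%N)))//= expr1 bin1 subn1/=.
rewrite -[leLHS]addr0 lerD//; last first.
  by apply: sumr_ge0 => i _; rewrite mulrn_wge0// mulr_ge0 ?exprn_ge0// ltW.
by rewrite mulr_natl [d * _]mulrC.
Qed.

Lemma recenter1 a r w : rad_ball a r -> modulus w < r ->
  recenter a w 1 = psum (dcoef a) w.
Proof.
move=> ar wr; have dr := rad_ball_dcoef ar.
have [H _] := rad_ball_mid dr wr.
have mw : modulus w < (modulus w + r) / 2 by have [] := midf_lt wr.
have := psum_cvg H mw => /cvg_modulusP cc.
have cr : series (fun n => a n * 'C(n, 1)%:R * w ^+ (n - 1)) @ \oo --> psum (dcoef a) w.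
  apply/cvg_modulusP; rewrite -cvg_shiftS; apply: cvg_trans cc.
  apply: near_eq_cvg; near=> n; congr modulus; congr (_ - _).
  rewrite !series_nat big_ord_recl bin0n mulr0 mul0r add0r; apply: eq_bigr => i _.
  by rewrite /dcoef /bump/= bin1 subn1/= [a _ * _]mulrC.
exact: csum_eq cr.
Unshelve. all: by end_near. Qed.

Lemma recenter_ball a r w : rad_ball a r -> modulus w < r ->
  rad_ball (recenter a w) (r - modulus w).
Proof.
move=> ar wr s /andP[s0 sr]; apply: (recenter_rad s0 _ (lexx _)).
apply: rad_ball_summable ar _.
by rewrite addr_ge0 ?modulus_ge0 ?(ltW s0)// addrC -ltrBrDr.
Qed.

Lemma psum_recenter_ball a r w z : rad_ball a r -> modulus w + modulus z < r ->
  psum a (w + z) = psum (recenter a w) z.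
Proof.
move=> ar wzr; apply/esym/psum_eq.
have [->|z0] := eqVneq z 0.
  have wr : modulus w < r by rewrite (le_lt_trans _ wzr)// lerDl modulus_ge0.
  have [wm mr] := midf_lt wr.
  have m0 : 0 < (modulus w + r) / 2 - modulus w by rewrite subr_gt0.
  apply: (psum_recenter m0 _ (lexx _)); last by rewrite modulus0 ltW.
  rewrite subrKC; apply: rad_ball_summable ar _.
  by rewrite mr andbT (le_trans (modulus_ge0 _) (ltW wm)).
have mz0 : 0 < modulus z.
  by rewrite lt_neqAle modulus_ge0 andbT eq_sym; apply: contra z0 => /eqP/modulus_eq0 ->.
apply: (psum_recenter mz0 _ (lexx _) (lexx _)).
by apply: rad_ball_summable ar _; rewrite wzr andbT addr_ge0 ?modulus_ge0.
Qed.

Lemma derive1_psum f a z0 r : rad_ball a r ->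
  (forall z, modulus (z - z0) < r -> f z = psum a (z - z0)) ->
  forall z, modulus (z - z0) < r -> derive1 f z = psum (dcoef a) (z - z0).
Proof.
move=> ar fa z zr; rewrite -(recenter1 ar zr).
have br := recenter_ball ar zr.
have d0 : 0 < r - modulus (z - z0) by rewrite subr_gt0.
have h0 : 0 < (r - modulus (z - z0)) / 2 by rewrite divr_gt0.
apply: (derive1_center h0); first by apply: br; rewrite h0/= ltr_pdivrMr// ltr_pMr// ltr1n.
apply/near_modulusP; exists (r - modulus (z - z0)) => // z' z'r.
rewrite -(psum_recenter_ball ar) -?ltrBrDl//.
rewrite addrC subrKA fa// -(subrKA z) (le_lt_trans (ler_modulusD _ _))//.
by rewrite -ltrBrDr.
Qed.

Lemma derive1n_psum f a z0 r : rad_ball a r ->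
  (forall z, modulus (z - z0) < r -> f z = psum a (z - z0)) ->
  forall k, rad_ball (iter k dcoef a) r /\
   forall z, modulus (z - z0) < r -> derive1n k f z = psum (iter k dcoef a) (z - z0).
Proof.
move=> ar fa; elim=> [//|k [IH1 IH2]]; split; first exact: rad_ball_dcoef.
by move=> z zr; rewrite derive1nS; exact: derive1_psum IH1 IH2 _ zr.
Qed.

Lemma iter_dcoef a k n : iter k dcoef a n * n`!%:R = (n + k)`!%:R * a (n + k)%N.
Proof.
elim: k n => [|k IH] n /=; first by rewrite addn0 mulrC.
rewrite /dcoef mulrAC -natrM -factS mulrC IH addSnnS//.
Qed.

(** Differentiation acts on coefficients by [dcoef], and the value at the centre is
    the coefficient of index 0. *)
Lemma derive1n_coef f a z0 r : 0 < r -> rad_ball a r ->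
  (forall z, modulus (z - z0) < r -> f z = psum a (z - z0)) ->
  forall k, derive1n k f z0 / k`!%:R = a k.
Proof.
move=> r0 ar fa k; have [_ ->] := derive1n_psum ar fa k; last by rewrite subrr modulus0.
rewrite subrr psum0; have := iter_dcoef a k 0; rewrite fact0 mulr1 => ->.
by rewrite mulrC mulKf// pnatr_eq0 -lt0n fact_gt0.
Qed.

Lemma coef_unique f a b z0 r s : 0 < r -> 0 < s -> rad_ball a r -> rad_ball b s ->
  (forall z, modulus (z - z0) < r -> f z = psum a (z - z0)) ->
  (forall z, modulus (z - z0) < s -> f z = psum b (z - z0)) -> a = b.
Proof.
move=> r0 s0 ar bs fa fb; apply/funext => k.
by rewrite -(derive1n_coef r0 ar fa) (derive1n_coef s0 bs fb).
Qed.

Lemma taylor_coefE f a : disc_coef a ->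
  (forall z, modulus z < 1 -> f z = psum a z) -> taylor_coef f = a.
Proof.
move=> da fa; apply/funext => k; rewrite /taylor_coef.
by apply: (derive1n_coef ltr01 da) => z; rewrite subr0; exact: fa.
Qed.

Lemma Hol_psum f a : disc_coef a ->
  (forall z, modulus z < 1 -> f z = psum a z) -> Hol f.
Proof.
move=> da fa z0 z01; exists (recenter a z0).
have r0 : 0 < 1 - modulus z0 by rewrite subr_gt0.
apply/near_modulusP; exists (1 - modulus z0) => // z zr.
have zr' : modulus z0 + modulus (z - z0) < 1 by rewrite -ltrBrDl.
have z1 : modulus z < 1.
  by rewrite (le_lt_trans _ zr')// -{1}(subrKC z0 z) ler_modulusD.
rewrite fa// -{2}(subrKC z0 z) (psum_recenter_ball da)//.
have [H _] := rad_ball_mid (recenter_ball da z01) zr.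
by apply: (psum_cvg H); have [] := midf_lt zr.
Qed.

(** The factor [d^(n+1)] bounds both the coefficients and, through the exponent, the
    radius of convergence by the single parameter [d]; this makes the property
    monotone in [d] and hence amenable to a compactness argument. *)
Definition expands f (d : R) w := exists a,
  (forall n, modulus (a n) * d ^+ n.+1 <= 1) /\
  forall z, modulus (z - w) < d -> f z = psum a (z - w).

Lemma expands_rad a (d : R) : 0 < d -> (forall n, modulus (a n) * d ^+ n.+1 <= 1) ->
  rad_ball a d.
Proof.
move=> d0 H s /andP[s0 sd]; apply: (@rad_coef_le _ _ d); first by rewrite !ltW.
by exists d^-1 => n; rewrite -[d^-1]mul1r ler_pdivlMr// -mulrA -exprSr.
Qed.

(** Recentering a local expansion at nearby points: the coefficients stay bounded
    because the original series converges on a larger disc. *)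
Lemma Hol_expands f w : Hol f -> unit_disc w -> exists2 e : R, 0 < e &
  forall d w', 0 < d <= e -> modulus (w' - w) < e -> expands f d w'.
Proof.
move=> fH w1; have [a /near_modulusP[e e0 He]] := fH _ w1.
pose q := e / 2; have q0 : 0 < q by rewrite divr_gt0.
have qe : q < e by rewrite ltr_pdivrMr// ltr_pMr// ltr1n.
have aq : rad_coef a q.
  have -> : q = modulus (q%:C%C : R[i]) by rewrite modulusR ger0_norm// ltW.
  apply: (@power_sum_rad _ _ _ (f (w + q%:C%C))).
  have := He (w + q%:C%C); rewrite addrAC subrr add0r; apply.
  by rewrite modulusR ger0_norm// ltW.
pose t := q / 4; have t0 : 0 < t by rewrite divr_gt0.
have ca : cvgn (series (fun n => modulus (a n) * (t + t) ^+ n)).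
  by apply: rad_summable aq _; rewrite addr_ge0 ?(ltW t0)//= /t; move: q0; lra.
pose B := limn (series (fun n => modulus (a n) * (t + t) ^+ n)).
have B0 : 0 <= B.
  apply: (le_trans _ (series_le_lim 0 _ ca)); rewrite ?series_nat ?big_ord0// => n.
  by rewrite mulr_ge0 ?modulus_ge0 ?exprn_ge0// addr_ge0// ltW.
have B1 : 0 < B + 1 by rewrite ltr_wpDl.
exists (Num.min t (B + 1)^-1); first by rewrite lt_min t0 invr_gt0.
move=> d w' /andP[d0]; rewrite le_min => /andP[dt dB]; rewrite lt_min => /andP[w't _].
exists (recenter a (w' - w)); split.
  move=> n; have r1 : modulus (recenter a (w' - w) n) * t ^+ n <= B.
    have H k := recenter_term_le a n k t0 (ltW w't).
    have cr := cvg_seriesZ (k := t ^- n) ca.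
    rewrite -ler_pdivlMr ?exprn_gt0// [leRHS]mulrC.
    by rewrite (le_trans (csum_le H cr))// limn_seriesZ.
  rewrite exprSr mulrA; apply: (@le_trans _ _ (B * d)).
    rewrite ler_wpM2r ?(ltW d0)// (le_trans _ r1)// ler_wpM2l ?modulus_ge0//.
    by rewrite lerXn2r// nnegrE ltW.
  apply: (@le_trans _ _ (B * (B + 1)^-1)); first by rewrite ler_wpM2l.
  by rewrite ler_pdivrMr// mul1r lerDl.
move=> z zd.
have zt : modulus (z - w') <= t by rewrite ltW// (lt_le_trans zd).
rewrite (psum_eq (psum_recenter t0 ca (ltW w't) zt)).
rewrite addrC subrKA; apply/esym/psum_eq/He.
rewrite -(subrKA w') (le_lt_trans (ler_modulusD _ _))// -addrC.
rewrite /t in zt w't; move: q0 qe; lra.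
Qed.

(** Compactness of the closed disc of radius [rho], expressed on its bounding
    square. *)
Lemma Hol_uniform f (rho : R) : Hol f -> 0 <= rho < 1 -> exists2 d : R, 0 < d &
  forall w, modulus w <= rho -> expands f d w.
Proof.
move=> fH /andP[rho0 rho1].
have cK : compact (`[(-1 : R), 1] `*` `[(-1 : R), 1]).
  by apply: compact_setX; exact: segment_compact.
move/compact_near_coveringP : cK => /(_ R (0 : R)^'+
  (fun d v => modulus (v.1 +i* v.2)%C <= rho -> expands f d (v.1 +i* v.2)%C) _) H.
have {H} : \forall d \near (0 : R)^'+, `[(-1 : R), 1] `*` `[(-1 : R), 1] `<=`
   (fun v => modulus (v.1 +i* v.2)%C <= rho -> expands f d (v.1 +i* v.2)%C).
  apply: H => -[x y] _ /=.
  have prodnear (e : R) (e0 : 0 < e) (P : R -> R * R -> Prop) :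
     (forall d (v : R * R), 0 < d <= e -> modulus ((v.1 +i* v.2)%C - (x +i* y)%C) < e -> P d v) ->
     \forall v \near (x, y) & d \near (0 : R)^'+, P d v.
    move=> HP; exists (ball (x, y) (e / 2), [set d | 0 < d <= e]).
      split=> /=; first by apply: nbhsx_ballx; rewrite divr_gt0.
      near=> d; apply/andP; split; near: d; first exact: nbhs_right_gt.
      exact: nbhs_right_le.
    move=> [v d] /= [[v1 v2] dd]; apply: HP => //.
    rewrite (le_lt_trans (modulus_le_ReIm _))//= [e]splitr.
    by rewrite ltrD// distrC.
  have [xy1|xy1] := ltP (modulus (x +i* y)%C) 1.
    have [e e0 He] := Hol_expands fH xy1.
    by apply: (prodnear _ e0) => d v de ve _; exact: He.
  apply: (prodnear (1 - rho)); first by rewrite subr_gt0.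
  move=> d v _ H1 H2; exfalso.
  have := lerB_modulus (x +i* y)%C (v.1 +i* v.2)%C.
  rewrite modulusBC; lra.
move=> H; near (0 : R)^'+ => d.
exists d; first by near: d; exact: nbhs_right_gt.
move=> -[x y] w; have Hd : `[(-1 : R), 1] `*` `[(-1 : R), 1] `<=`
   (fun v => modulus (v.1 +i* v.2)%C <= rho -> expands f d (v.1 +i* v.2)%C).
  by near: d.
apply: (Hd (x, y)) => //=; split => /=;
  rewrite in_itv/= -ler_norml (le_trans _ (le_trans w (ltW rho1)))//.
- exact: (Re_le_modulus (x +i* y)%C).
- exact: (Im_le_modulus (x +i* y)%C).
Unshelve. all: by end_near. Qed.

Lemma recenterE a r w k : rad_ball a r -> modulus w < r ->
  cvgn (series (fun m => modulus (a (m + k)%N * 'C(m + k, k)%:R) * modulus w ^+ m)) /\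
  recenter a w k = psum (fun m => a (m + k)%N * 'C(m + k, k)%:R) w.
Proof.
move=> ar wr; pose s := modulus w; pose t := ((s + r) / 2 - s).
have [sm mr] := midf_lt wr; have t0 : 0 < t by rewrite subr_gt0.
have ca : cvgn (series (fun n => modulus (a n) * (s + t) ^+ n)).
  apply: rad_ball_summable ar _; rewrite /t subrKC mr andbT.
  exact: le_trans (modulus_ge0 _) (ltW sm).
have s0 : 0 <= s by exact: modulus_ge0.
pose c n := a n * 'C(n, k)%:R * w ^+ (n - k).
have cH n := recenter_term_le a k n t0 (lexx s).
have cr := cvg_seriesZ (k := t ^- k) ca.
have shiftE (V : zmodType) (u : nat -> V) : (forall n, (n < k)%N -> u n = 0) ->
    forall N, series (fun m => u (m + k)%N) N = series u (N + k)%N.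
  move=> u0 N; rewrite !series_nat [(N + k)%N]addnC big_split_ord/= [X in _ = X + _]big1 ?add0r => [|i _]; last exact: u0.
  by apply: eq_bigr => i _; rewrite addnC.
split.
  have c1 : cvgn (series (fun n => modulus (c n))).
    by apply: series_le_cvg cr => // n; rewrite ?modulus_ge0// (le_trans _ (cH n))// modulus_ge0.
  rewrite (_ : series _ = fun N => series (fun n => modulus (c n)) (N + k)%N); last first.
    apply/funext => N; rewrite -shiftE => [|n nk]; last by rewrite /c bin_small// mulr0 mul0r modulus0.
    congr (series _ N); apply/funext => m; rewrite /c addnK.
    by rewrite !modulusM modulusX.
  by move/cvg_ex : c1 => [l c1]; apply/cvg_ex; exists l; rewrite (cvg_shiftn k (series (fun n => modulus (c n)))).
apply/esym/psum_eq.
have := csum_cvg cH cr; rewrite -(cvg_shiftn k) => /=.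
apply: cvg_trans; apply: near_eq_cvg; near=> N.
rewrite -shiftE => [|n nk]; last by rewrite /c bin_small// mulr0 mul0r.
by congr (series _ N); apply/funext => m; rewrite /c addnK.
Unshelve. all: by end_near. Qed.

(** Local expansions imply a global one. Let [rho] be the supremum of the radii in
    which the expansion at 0 converges to [f]. If [rho < 1], expansions with a uniform
    radius [d] exist at all points of [|z| <= rho]. Cauchy's estimate, applied to every
    derivative of [f], bounds the coefficients at 0 up to the radius [rho + d/2], and the
    uniqueness of expansions shows that the sum is still [f] beyond [rho]. *)
Lemma Hol_global f : Hol f -> exists a, disc_coef a /\
  forall z, modulus z < 1 -> f z = psum a z.
Proof.
move=> fH.
have D0 : unit_disc (0 : R[i]) by rewrite /unit_disc/= modulus0.
have [e e0 He] := Hol_expands fH D0.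
have [a [aH fa]] : expands f e 0 by apply: He; rewrite ?e0/= ?subrr ?modulus0.
have ae := expands_rad e0 aH.
pose good r := rad_ball a r /\ forall z, modulus z < r -> f z = psum a z.
have goode : good e by split => // z ze; rewrite fa subr0.
pose S := [set r | r <= 1 /\ good r].
pose m := Num.min e 1.
have m0 : 0 < m by rewrite lt_min e0 ltr01.
have Sm : S m.
  split; first by rewrite ge_min lexx orbT.
  split; first by apply: rad_ball_sub ae; rewrite ge_min lexx.
  by move=> z zm; apply: goode.2; rewrite (lt_le_trans zm)// ge_min lexx.
have hS : has_sup S by split; [exists m | exists 1 => r []].
pose rho := sup S.
have mrho : m <= rho by apply: ub_le_sup => //; case: hS.
have rho0 : 0 < rho := lt_le_trans m0 mrho.
have rho1 : rho <= 1 by apply: ge_sup; [exists m | move=> r []].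
have goodrho : good rho.
  split=> [s /andP[s0 srho]|z zrho].
  - have [r [_ [gr _]] sr] := sup_gt (ex_intro _ m Sm) srho.
    by apply: gr; rewrite s0.
  - have [r [_ [_ gr]] sr] := sup_gt (ex_intro _ m Sm) zrho.
    exact: gr.
exists a; move: rho1; rewrite le_eqVlt => /predU1P[rho1|rho1].
  by rewrite rho1 in goodrho; case: goodrho.
exfalso.
have [d d0 Hd] : exists2 d : R, 0 < d & forall w, modulus w <= rho -> expands f d w.
  by apply: Hol_uniform => //; rewrite rho1 ltW.
have unif w k : modulus w < rho -> modulus (recenter a w k) <= d ^- k.+1.
  move=> wr; have [b [bH fb]] := Hd _ (ltW wr).
  rewrite (_ : recenter a w = b); first by rewrite -[d ^- _]mul1r ler_pdivlMr ?exprn_gt0.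
  have rw : 0 < rho - modulus w by rewrite subr_gt0.
  apply: (coef_unique rw d0 (recenter_ball goodrho.1 wr) (expands_rad d0 bH) _ fb).
  move=> z zr; rewrite -(psum_recenter_ball goodrho.1) -?ltrBrDl// subrKC.
  apply: goodrho.2; rewrite -(subrK w z) (le_lt_trans (ler_modulusD _ _))//.
  by rewrite -ltrBrDr.
have est r k n : 0 <= r < rho -> modulus (a (n + k)%N) * 'C(n + k, k)%:R * r ^+ n <= d ^- k.+1.
  move=> /andP[r0 rr].
  have mr : modulus (r%:C%C : R[i]) = r by rewrite modulusR ger0_norm.
  have /= := @cauchy_estimate _ (fun m => a (m + k)%N * 'C(m + k, k)%:R) r (d ^- k.+1) n r0.
  rewrite modulusM modulus_nat; apply.
    have [] := @recenterE a rho r%:C%C k goodrho.1; rewrite ?mr//.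
  move=> y yr; have yrho : modulus y < rho by rewrite yr.
  by have [_ <-] := @recenterE a rho y k goodrho.1 yrho; exact: unif.
(* by the binomial theorem the Cauchy estimates recombine into (r + d/2)^n, at the
   price of the factors (1/2)^k, which are summable *)
have rad2 r : 0 <= r < rho -> rad_coef a (r + d / 2).
  move=> rr; exists (2 / d) => n; rewrite exprDn mulr_sumr.
  apply: (@le_trans _ _ (\sum_(k < n.+1) d^-1 * (2^-1) ^+ k)).
    apply: ler_sum => k _; have kn : (k <= n)%N by rewrite -ltnS.
    have := est r k (n - k)%N rr; rewrite subnK// => H.
    rewrite -mulr_natl [leLHS](_ : _ = modulus (a n) * 'C(n, k)%:R * r ^+ (n - k) * (d / 2) ^+ k); last by ring.
    apply: (@le_trans _ _ (d ^- k.+1 * (d / 2) ^+ k)).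
      by rewrite ler_wpM2r// exprn_ge0// divr_ge0// ltW.
    rewrite exprMn exprS invfM mulrA -[_ * d ^+ k]mulrA mulVf ?mulr1//.
    by rewrite expf_neq0// gt_eqF.
  rewrite -mulr_sumr mulrC ler_pM2r ?invr_gt0//.
  have := subrX1 (2^-1 : R) n.+1; set T := \sum_(_ < _) _ => HT.
  have : 0 <= (2^-1 : R) ^+ n.+1 by rewrite exprn_ge0// invr_ge0.
  by lra.
pose rho' := Num.min (rho + d / 4) 1.
have good' : good (rho + d / 4).
  have ab : rad_ball a (rho + d / 4).
    move=> s /andP[s0 sr].
    have [sd|ds] := ltP s (d / 2).
      apply: (@rad_coef_le _ _ (d / 2)); first by rewrite !ltW.
      by rewrite -[d / 2]add0r; apply: rad2; rewrite lexx.
    rewrite -(subrK (d / 2) s); apply: rad2; rewrite subr_ge0 ds/=.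
    by rewrite ltrBlDr (lt_le_trans sr)// lerD2l; move: d0; lra.
  split=> // z zr.
  have [zrho|zrho] := ltP (modulus z) rho; first exact: goodrho.2.
  have l0 : 0 < modulus z := lt_le_trans rho0 zrho.
  (* w is the point of the segment [0, z] at distance at most d/2 from z *)
  pose v := Num.max 0 (modulus z - d / 2).
  have v0 : 0 <= v by rewrite le_max lexx.
  have vrho : v < rho by rewrite gt_max rho0/=; move: d0 zr; lra.
  have vz : v <= modulus z by rewrite ge_max ltW//= lerBlDr lerDl divr_ge0// ltW.
  have zv : modulus z - v < d.
    rewrite ltrBlDr -ltrBlDl lt_max; apply/orP; right; move: d0; lra.
  pose w := (v / modulus z)%:C%C * z.
  have mw : modulus w = v.
    by rewrite modulusM modulusR ger0_norm ?divr_ge0 ?(ltW l0)// divfK// gt_eqF.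
  have mzw : modulus (z - w) = modulus z - v.
    rewrite (_ : z - w = (1 - v / modulus z)%:C%C * z); last first.
      by rewrite rmorphB/= mulrBl mul1r.
    rewrite modulusM modulusR ger0_norm ?subr_ge0 ?ler_pdivrMr ?mul1r//.
    by rewrite mulrBl mul1r divfK// gt_eqF.
  have wr : modulus w < rho by rewrite mw.
  have [b [bH fb]] := Hd _ (ltW wr).
  have bE : recenter a w = b.
    have rw : 0 < rho - modulus w by rewrite subr_gt0.
    apply: (coef_unique rw d0 (recenter_ball goodrho.1 wr) (expands_rad d0 bH) _ fb).
    move=> z' z'r; rewrite -(psum_recenter_ball goodrho.1) -?ltrBrDl// subrKC.
    apply: goodrho.2; rewrite -(subrK w z') (le_lt_trans (ler_modulusD _ _))//.
    by rewrite -ltrBrDr.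
  have wz : modulus w + modulus (z - w) < rho + d / 4 by rewrite mw mzw subrKC.
  have := psum_recenter_ball ab wz; rewrite subrKC => ->.
  by rewrite bE; apply: fb; rewrite mzw.
have : rho' <= rho.
  apply: ub_le_sup; first by case: hS.
  split; first by rewrite ge_min lexx orbT.
  split; first by apply: rad_ball_sub good'.1; rewrite ge_min lexx.
  by move=> z zr; apply: good'.2; rewrite (lt_le_trans zr)// ge_min lexx.
rewrite leNgt => /negP; apply; rewrite lt_min rho1 andbT ltrDl divr_gt0//.
Qed.

End Holomorphy.

(** * Changes of variables and polar coordinates *)

Section ChangeOfVariables.
Context {R : realType}.
Local Notation mu := (@lebesgue_measure R).
Local Open Scope ereal_scope.

(** The image of the Lebesgue measure by a translation has the same values on
    intervals. *)
Lemma integral_shift (D : set R) (f : R -> \bar R) (c : R) : measurable D ->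
  measurable_fun D f -> (forall x, D x -> 0 <= f x) ->
  \int[mu]_(y in D) f y = \int[mu]_(x in (fun x => (x + c)%R) @^-1` D) f (x + c)%R.
Proof.
move=> mD mf f0.
pose phi : measurableTypeR R -> measurableTypeR R := (fun x => (x + c)%R).
have ms : measurable_fun setT phi.
  exact: measurable_funD.
have fD : {in D, forall y, 0 <= f y} by move=> y /[!inE]; exact: f0.
have key : \int[pushforward mu phi]_(y in D) f y = \int[mu]_(x in phi @^-1` D) f (phi x).
  by rewrite ge0_integral_pushforward.
rewrite -[RHS]key.
apply: eq_measure_integral => A mA _; apply: lebesgue_measure_unique => // _ [[a b]] _ <-.
rewrite -[RHS]/(mu (phi @^-1` `]a, b]%classic)) /=.
rewrite (_ : phi @^-1` _ = `](a - c)%R, (b - c)%R]%classic); last first.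
  by apply/seteqP; split => x /=; rewrite !in_itv/= ltrBlDr lerBrDr.
rewrite !lebesgue_measure_itv/= !lte_fin ltrD2r.
by case: ifP => // _; rewrite -!EFinD; congr (_%:E); ring.
Qed.

Lemma integral_reflect (f : R -> \bar R) (D : set R) : measurable D ->
  measurable_fun D f -> (forall x, D x -> 0 <= f x) ->
  \int[mu]_(y in D) f y = \int[mu]_(x in (fun x => (- x)%R) @^-1` D) f (- x)%R.
Proof.
move=> mD mf f0.
pose phi : measurableTypeR R -> measurableTypeR R := -%R.
have ms : measurable_fun setT phi by exact: oppr_measurable.
have fD : {in D, forall y, 0 <= f y} by move=> y /[!inE]; exact: f0.
have key : \int[pushforward mu phi]_(y in D) f y = \int[mu]_(x in phi @^-1` D) f (phi x).
  by rewrite ge0_integral_pushforward.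
rewrite -[RHS]key.
by apply: eq_measure_integral => A mA _; exact/esym/lebesgue_measureN.
Qed.

Lemma integral_scale (D : set R) (f : R -> \bar R) (c : R) : (0 < c)%R -> measurable D ->
  measurable_fun D f -> (forall x, D x -> 0 <= f x) ->
  \int[mu]_(y in D) f y =
  c%:E * \int[mu]_(x in (fun x => (c * x)%R) @^-1` D) f (c * x)%R.
Proof.
move=> c0 mD mf f0.
pose phi : measurableTypeR R -> measurableTypeR R := (fun x => (c * x)%R).
have ms : measurable_fun setT phi.
  exact: mulrl_measurable.
have fD : {in D, forall y, 0 <= f y} by move=> y /[!inE]; exact: f0.
have key : \int[pushforward mu phi]_(y in D) f y = \int[mu]_(x in phi @^-1` D) f (phi x).
  by rewrite ge0_integral_pushforward.
rewrite -[X in _ * X]key.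
pose k : {nonneg R} := NngNum (ltW c0).
rewrite -[c]/(k%:num%R) -ge0_integral_mscale//.
apply: eq_measure_integral => A mA _; apply: lebesgue_measure_unique => // _ [[a b]] _ <-.
rewrite -[RHS]/(c%:E * mu (phi @^-1` `]a, b]%classic)) /=.
rewrite (_ : phi @^-1` _ = `](c^-1 * a)%R, (c^-1 * b)%R]%classic); last first.
  by apply/seteqP; split => x /=; rewrite !in_itv/= ltr_pdivrMl// ler_pdivlMl.
rewrite !lebesgue_measure_itv/= !lte_fin ltr_pM2l ?invr_gt0//.
case: ifP => // _; last by rewrite mule0.
rewrite -!EFinD -EFinM; congr (_%:E); rewrite mulrBr !mulrA divff ?mul1r//.
by rewrite gt_eqF.
Qed.

End ChangeOfVariables.

Section AtanSubstitution.
Context {R : realType}.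
Local Notation mu := (@lebesgue_measure R).
Local Open Scope ereal_scope.

(** The substitution [t = atan m] on [-n, n], followed by monotone convergence. *)
Lemma integral_atan (G : R -> R) : continuous G -> (forall t, 0 <= G t)%R ->
  \int[mu]_m (G (atan m) * (1 + m ^+ 2)^-1)%:E =
  \int[mu]_(t in `](- (pi / 2))%R, (pi / 2)%R[) (G t)%:E.
Proof.
move=> cG G0.
have cH : continuous (fun m : R => (1 + m ^+ 2)^-1)%R.
  by move=> x; have := @continuous_oneDsqrV R x.
have cK : continuous (fun m => G (atan m) * (1 + m ^+ 2)^-1)%R.
  move=> x; apply: cvgM; last exact: cH.
  by apply: continuous_comp; [exact: continuous_atan|exact: cG].
have H1 : \int[mu]_(m in `[(- n%:R)%R, n%:R]) (G (atan m) * (1 + m ^+ 2)^-1)%:E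
    @[n --> \oo] --> \int[mu]_m (G (atan m) * (1 + m ^+ 2)^-1)%:E.
  rewrite (_ : setT = \bigcup_n `[(- n%:R)%R, n%:R : R]%classic); last first.
    apply/seteqP; split => // x _; exists (Num.truncn `|x|).+1 => //=.
    by rewrite in_itv/= -ler_norml ltW// truncnS_gt.
  apply: ge0_nondecreasing_set_cvg_integral => //.
  - move=> m n mn; apply/subsetPset => x /=; rewrite !in_itv/= -!ler_norml => /le_trans; apply.
    by rewrite ler_nat.
  - move=> n; apply/measurable_EFinP; apply: measurable_funTS.
    exact: continuous_measurable_fun.
  - by move=> n x _; rewrite lee_fin mulr_ge0// invr_ge0 addr_ge0// sqr_ge0.
have H2 : \int[mu]_(t in `[atan (- n%:R)%R, atan n%:R]) (G t)%:E
    @[n --> \oo] --> \int[mu]_(t in `](- (pi / 2))%R, (pi / 2)%R[) (G t)%:E.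
  rewrite (_ : `](- (pi / 2))%R, (pi / 2)%R[%classic =
      \bigcup_n `[atan (- n%:R)%R, atan n%:R : R]%classic); last first.
    apply/seteqP; split => x /=.
      rewrite in_itv/= => /andP[x1 x2]; exists (Num.truncn `|tan x|).+1 => //=.
      have : (`|tan x| <= (Num.truncn `|tan x|).+1%:R)%R by rewrite ltW// truncnS_gt.
      rewrite ler_norml in_itv/= => /andP[h1 h2].
      have xE : x = atan (tan x) by rewrite tanK// in_itv/= x1.
      by rewrite {2 3}xE !le_atan.
    move=> [n _] /=; rewrite !in_itv/= => /andP[h1 h2].
    by rewrite (lt_le_trans (atan_gtNpi2 _) h1) (le_lt_trans h2 (atan_ltpi2 _)).
  apply: ge0_nondecreasing_set_cvg_integral => //.
  - move=> m n mn; apply/subsetPset => x /=; rewrite !in_itv/= => /andP[h1 h2].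
    rewrite (le_trans _ h1) ?(le_trans h2)// le_atan// ?lerN2 ler_nat//.
  - move=> n; apply/measurable_EFinP; apply: measurable_funTS.
    exact: continuous_measurable_fun.
  - by move=> n x _; rewrite lee_fin.
suff UV : (fun n => \int[mu]_(m in `[(- n%:R)%R, n%:R]) (G (atan m) * (1 + m ^+ 2)^-1)%:E) =
    (fun n : nat => \int[mu]_(t in `[atan (- n%:R)%R, atan n%:R]) (G t)%:E).
  by rewrite UV in H1; rewrite -(cvg_lim _ H1)// -(cvg_lim _ H2).
apply/funext => n; apply/esym.
have n0 : (- n%:R <= n%:R :> R)%R by rewrite ge0_cp.
have dE : (@atan R)^`()%classic = (fun x => (1 + x ^+ 2)^-1)%R.
  by apply/funext => x; exact: derive1_atan.
rewrite (@integration_by_substitution_increasing R atan G _ _ n0)//.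
- by apply: eq_integral => x _; rewrite dE.
- by move=> x y _ _; exact: lt_atan.
- by move=> x _; rewrite dE; exact: cH.
- by rewrite dE; apply/cvg_ex; eexists; apply: cvg_at_right_filter; exact: cH.
- by rewrite dE; apply/cvg_ex; eexists; apply: cvg_at_left_filter; exact: cH.
- split.
  + by move=> x _; exact: derivable_atan.
  + by apply: cvg_at_right_filter; exact: continuous_atan.
  + by apply: cvg_at_left_filter; exact: continuous_atan.
- exact: continuous_subspaceT.
Qed.

End AtanSubstitution.

Section Periodic.
Context {R : realType}.
Local Notation mu := (@lebesgue_measure R).
Local Open Scope ereal_scope.

Lemma integral_itv_split (f : R -> \bar R) (a b c : R) : (a <= b <= c)%R ->
  measurable_fun setT f -> (forall x, 0 <= f x) ->
  \int[mu]_(x in `[a, c]) f x =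
  \int[mu]_(x in `[a, b]) f x + \int[mu]_(x in `[b, c]) f x.
Proof.
move=> /andP[ab bc] mf f0.
have -> : \int[mu]_(x in `[b, c]) f x = \int[mu]_(x in `]b, c]) f x.
  by rewrite integral_itv_obnd_cbnd//; exact: measurable_funTS.
rewrite -ge0_integral_setU//.
- congr (integral _ _ _); apply/seteqP; split => x /=; rewrite !in_itv/=.
    by move=> /andP[ax xc]; have [xb|bx] := leP x b; [left; rewrite ax|right; rewrite xc].
  move=> [/andP[ax xb]|/andP[bx xc]]; first by rewrite ax (le_trans xb).
  by rewrite (le_trans ab (ltW bx)).
- exact: measurable_funTS.
- apply/disj_setPS => x /= []; rewrite !in_itv/= => /andP[_ xb] /andP[bx _].
  by move: (lt_le_trans bx xb); rewrite ltxx.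
Qed.

Lemma integral_periodic (f : R -> \bar R) (c : R) : (0 <= c <= 2 * pi)%R ->
  measurable_fun setT f -> (forall x, 0 <= f x) ->
  (forall x, f (x + 2 * pi)%R = f x) ->
  \int[mu]_(x in `[0%R, (2 * pi)%R]) f (x + c)%R =
  \int[mu]_(x in `[0%R, (2 * pi)%R]) f x.
Proof.
move=> /andP[c0 c2] mf f0 fp.
have p0 : (0 <= 2 * pi :> R)%R by rewrite mulr_ge0// pi_ge0.
have shiftE (a b d : R) : \int[mu]_(x in `[(a + d)%R, (b + d)%R]) f x =
    \int[mu]_(x in `[a, b]) f (x + d)%R.
  rewrite (@integral_shift _ _ f d)//; last exact: measurable_funTS.
  congr (integral _ _ _); apply/seteqP; split => x /=; rewrite !in_itv/= !lerD2r//.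
rewrite -shiftE add0r.
rewrite (@integral_itv_split f c (2 * pi)%R (2 * pi + c)%R)//; last by rewrite c2 lerDl.
have E := shiftE 0%R c (2 * pi)%R; rewrite add0r [(c + _)%R]addrC in E; rewrite E.
rewrite [RHS](@integral_itv_split f 0%R c (2 * pi)%R) ?c0// addeC; congr (_ + _).
by apply: eq_integral => x _; rewrite fp.
Qed.

End Periodic.

Section Tonelli.
Context {R : realType}.
Local Notation mu := (@lebesgue_measure R).
Local Open Scope ereal_scope.

Lemma measurable_restrict_prod (f : R * R -> \bar R) (A B : set R) :
  measurable A -> measurable B -> measurable_fun setT f ->
  measurable_fun setT (f \_ (A `*` B)).
Proof.
move=> mA mB mf; apply/(measurable_restrictT f); first exact: measurableX.
exact: measurable_funTS.
Qed.

Lemma integral_prod_restrict (f : R * R -> \bar R) (A B : set R) (x : R) :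
  \int[mu]_y (f \_ (A `*` B)) (x, y) = ((fun x => \int[mu]_(y in B) f (x, y)) \_ A) x.
Proof.
rewrite patchE; case: ifPn => xA.
  rewrite [RHS]integral_mkcond; apply: eq_integral => y _; rewrite !patchE.
  by rewrite in_setX xA.
by rewrite integral0_eq// => y _; rewrite patchE in_setX (negbTE xA).
Qed.

Lemma integral_prod_restrict_swap (f : R * R -> \bar R) (A B : set R) (y : R) :
  \int[mu]_x (f \_ (A `*` B)) (x, y) = ((fun y => \int[mu]_(x in A) f (x, y)) \_ B) y.
Proof.
rewrite patchE; case: ifPn => yB.
  rewrite [RHS]integral_mkcond; apply: eq_integral => x _; rewrite !patchE.
  by rewrite in_setX yB andbT.
by rewrite integral0_eq// => x _; rewrite patchE in_setX (negbTE yB) andbF.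
Qed.

Lemma measurable_integral_snd (f : R * R -> \bar R) (B : set R) :
  measurable B -> measurable_fun setT f -> (forall v, 0 <= f v) ->
  measurable_fun setT (fun x => \int[mu]_(y in B) f (x, y)).
Proof.
move=> mB mf f0.
have mg := measurable_restrict_prod measurableT mB mf.
have g0 v : 0 <= (f \_ (setT `*` B)) v by apply: erestrict_ge0.
have := @measurable_fun_fubini_tonelli_F _ _ _ _ _ mu _ mg g0.
by apply: eq_measurable_fun => x _; rewrite /fubini_F integral_prod_restrict patch_setT.
Qed.

(** Tonelli's theorem on rectangles, deduced from the one on the plane by
    extending with 0. *)
Lemma tonelli (f : R * R -> \bar R) (A B : set R) :
  measurable A -> measurable B -> measurable_fun setT f -> (forall v, 0 <= f v) ->
  \int[mu]_(x in A) \int[mu]_(y in B) f (x, y) =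
  \int[mu]_(y in B) \int[mu]_(x in A) f (x, y).
Proof.
move=> mA mB mf f0.
have mg := measurable_restrict_prod mA mB mf.
have g0 v : 0 <= (f \_ (A `*` B)) v by apply: erestrict_ge0.
rewrite [LHS]integral_mkcond [RHS]integral_mkcond.
transitivity (\int[mu]_x \int[mu]_y (f \_ (A `*` B)) (x, y)).
  by apply: eq_integral => x _; rewrite integral_prod_restrict.
rewrite (@fubini_tonelli _ _ _ _ _ mu mu _ mg g0).
by apply: eq_integral => y _; rewrite integral_prod_restrict_swap.
Qed.

End Tonelli.

Section Polar.
Context {R : realType}.
Local Notation mu := (@lebesgue_measure R).
Local Open Scope ereal_scope.

(** Polar coordinates in two one-dimensional steps: for fixed [x], substitute
    [y = x m], the slope [m] being the tangent of the angle; then for fixed [m]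
    substitute [x = r cos (atan m)]. Only linear changes of variables occur. *)
Lemma integral_slope (f : R * R -> \bar R) : measurable_fun setT f ->
  (forall v, 0 <= f v) ->
  \int[mu]_(x in `]0%R, +oo[) \int[mu]_y f (x, y) =
  \int[mu]_(r in `]0%R, +oo[)
    (r%:E * \int[mu]_m (((1 + m ^+ 2)^-1)%:E *
       f (r * cos (atan m), r * sin (atan m))%R)).
Proof.
move=> mf f0.
pose P : set R := `]0%R, +oo[%classic.
have mP : measurable P by exact: measurable_itv.
pose h (v : R * R) : \bar R := ((v.1 * \1_P v.1)%:E * f (v.1, v.1 * v.2)%R).
have mI : measurable_fun setT (fun v : R * R => (v.1 * \1_P v.1)%R).
  apply: measurable_funM; first exact: measurable_fst.
  by apply: measurableT_comp; [exact: measurable_indic|exact: measurable_fst].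
have mh : measurable_fun setT h.
  apply: emeasurable_funM; first exact/measurable_EFinP.
  apply: measurableT_comp => //; apply/measurable_fun_pair => /=; first exact: measurable_fst.
  by apply: measurable_funM; [exact: measurable_fst|exact: measurable_snd].
have i0 (r : R) : (0 <= r * \1_P r)%R.
  rewrite indicE; case: (boolP (r \in P)); last by rewrite mulr0.
  by rewrite inE /P/= in_itv/= andbT mulr1 => /ltW.
have h0 v : 0 <= h v by rewrite mule_ge0 ?lee_fin// f0.
transitivity (\int[mu]_x \int[mu]_m h (x, m)).
  rewrite [LHS]integral_mkcond; apply: eq_integral => x _.
  rewrite patchE; case: ifPn => xP; last first.
    by rewrite integral0_eq// => m _; rewrite /h/= indicE (negbTE xP) mulr0 mul0e.
  have x0 : (0 < x)%R by move: xP; rewrite inE /P/= in_itv/= andbT.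
  rewrite (@integral_scale _ _ _ x)//; last exact: measurableT_comp.
  rewrite preimage_setT -ge0_integralZl//.
  - by apply: eq_integral => m _; rewrite /h /= indicE xP mulr1.
  - by do 2 apply: measurableT_comp => //.
  - by rewrite lee_fin ltW.
transitivity (\int[mu]_m \int[mu]_x h (x, m)).
  exact: (@fubini_tonelli _ _ _ _ _ mu mu h mh h0).
pose k (v : R * R) : \bar R := ((v.2 * \1_P v.2)%:E *
   (((1 + v.1 ^+ 2)^-1)%:E * f (v.2 * cos (atan v.1), v.2 * sin (atan v.1))%R)).
have m1 : measurable_fun setT (fun v : R * R => v.1) by exact: measurable_fst.
have m2 : measurable_fun setT (fun v : R * R => v.2) by exact: measurable_snd.
have mca : measurable_fun setT (fun m : R => cos (atan m)).
  apply: measurableT_comp; apply: continuous_measurable_fun; [exact: continuous_cos|exact: continuous_atan].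
have msa : measurable_fun setT (fun m : R => sin (atan m)).
  apply: measurableT_comp; apply: continuous_measurable_fun; [exact: continuous_sin|exact: continuous_atan].
have mq : measurable_fun setT (fun m : R => (1 + m ^+ 2)^-1)%R.
  by apply: continuous_measurable_fun => x; exact: (@continuous_oneDsqrV R x).
have mk : measurable_fun setT k.
  apply: emeasurable_funM.
    apply/measurable_EFinP; apply: measurable_funM => //.
    by apply: (measurableT_comp _ m2); exact: measurable_indic.
  apply: emeasurable_funM.
    apply/measurable_EFinP; exact: (measurableT_comp mq m1).
  apply: measurableT_comp => //; apply/measurable_fun_pair => /=; apply: measurable_funM => //.
    exact: (measurableT_comp mca m1).
  exact: (measurableT_comp msa m1).
have q0 (m : R) : (0 < 1 + m ^+ 2)%R by rewrite ltr_wpDr// sqr_ge0.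
have k0 v : 0 <= k v.
  by rewrite mule_ge0 ?lee_fin// mule_ge0// lee_fin invr_ge0 ltW.
transitivity (\int[mu]_m \int[mu]_r k (m, r)).
  apply: eq_integral => m _.
  have c0 : (0 < cos (atan m))%R by rewrite cos_atan invr_gt0 sqrtr_gt0.
  rewrite (@integral_scale _ _ _ (cos (atan m)))//; last exact: (measurableT_comp mh (pair2_measurable m)).
  rewrite preimage_setT -ge0_integralZl//.
  - apply: eq_integral => r _; rewrite /h /k/=.
    have -> : \1_P (cos (atan m) * r)%R = \1_P r :> R.
      rewrite !indicE; congr (_%:R); congr nat_of_bool; apply/idP/idP; rewrite !inE /P/= !in_itv/= !andbT pmulr_rgt0//.
    have sE : sin (atan m) = (cos (atan m) * m)%R.
      by rewrite -{3}[m]atanK /tan mulrCA mulfV ?mulr1// gt_eqF.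
    rewrite !muleA -!EFinM sE; congr (_%:E * f (_, _)).
    - have -> : ((1 + m ^+ 2)^-1 = cos (atan m) ^+ 2)%R.
        by rewrite cos_atan exprVn sqr_sqrtr// ltW.
      by ring.
    - by ring.
    - by ring.
  - apply: (measurableT_comp (measurableT_comp mh (pair2_measurable m))).
    exact: mulrl_measurable.
  - by rewrite lee_fin ltW.
rewrite (@fubini_tonelli _ _ _ _ _ mu mu k mk k0).
rewrite [RHS]integral_mkcond; apply: eq_integral => r _.
rewrite patchE; case: ifPn => rP; last first.
  by rewrite integral0_eq// => m _; rewrite /k/= indicE (negbTE rP) mulr0 mul0e.
have r0 : (0 < r)%R by move: rP; rewrite inE /P/= in_itv/= andbT.
rewrite -ge0_integralZl//.
- by apply: eq_integral => m _; rewrite /k /= indicE rP mulr1.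
- apply: emeasurable_funM.
    exact/measurable_EFinP.
  apply: measurableT_comp => //; apply/measurable_fun_pair => /=; apply: measurable_funM => //.
- by move=> m _; rewrite mule_ge0// lee_fin invr_ge0 ltW.
- by rewrite lee_fin ltW.
Qed.

Lemma integral_half_plane (f : R * R -> \bar R) (F : R -> R -> R) :
  measurable_fun setT f -> (forall v, 0 <= f v) ->
  (forall r t, (0 < r)%R -> f (r * cos t, r * sin t)%R = (F r t)%:E) ->
  (forall r, (0 < r)%R -> continuous (F r)) ->
  (forall r t, (0 <= F r t)%R) ->
  \int[mu]_(x in `]0%R, +oo[) \int[mu]_y f (x, y) =
  \int[mu]_(r in `]0%R, +oo[)
    (r%:E * \int[mu]_(t in `[(- (pi / 2))%R, (pi / 2)%R]) (F r t)%:E).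
Proof.
move=> mf f0 fF cF F0; rewrite (integral_slope mf f0); apply: eq_integral => r.
rewrite inE/= in_itv/= andbT => r0; congr (_ * _).
rewrite integral_itv_bndoo; last first.
  by apply/measurable_EFinP; apply: measurable_funTS; exact: continuous_measurable_fun (cF _ r0).
rewrite -integral_atan//; last exact: cF.
by apply: eq_integral => m _; rewrite fF// -EFinM mulrC.
Qed.

(** The left half-plane is the image of the right one by a half-turn. *)
Lemma integral_polar (f : R * R -> \bar R) (F : R -> R -> R) :
  measurable_fun setT f -> (forall v, 0 <= f v) ->
  (forall r t, (0 < r)%R -> f (r * cos t, r * sin t)%R = (F r t)%:E) ->
  (forall r, (0 < r)%R -> continuous (F r)) ->
  (forall r t, (0 <= F r t)%R) ->
  (forall r t, F r (t + 2 * pi)%R = F r t) ->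
  \int[(mu \x mu)%E]_v f v =
  \int[mu]_(r in `]0%R, +oo[)
    (r%:E * \int[mu]_(t in `[0%R, (2 * pi)%R]) (F r t)%:E).
Proof.
move=> mf f0 fF cF F0 Fp.
rewrite (@fubini_tonelli1 _ _ _ _ _ mu mu f mf f0).
pose u x := \int[mu]_y f (x, y).
have mu_u : measurable_fun setT u by exact: (@measurable_fun_fubini_tonelli_F _ _ _ _ _ mu f mf).
have u0 x : 0 <= u x by exact: integral_ge0.
rewrite -[LHS]/(\int[mu]_x u x).
have mI i : measurable [set` (i : interval R)] by exact: measurable_itv.
have -> : \int[mu]_x u x = \int[mu]_(x in `]0%R, +oo[) u x + \int[mu]_(x in `]0%R, +oo[) u (- x)%R.
  have -> : \int[mu]_(x in `]0%R, +oo[) u (- x)%R = \int[mu]_(x in `]-oo, 0%R]) u x.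
    rewrite -(@integral_itv_bndo_bndc _ _ _ u); last exact: measurable_funTS.
    rewrite (@integral_reflect _ u)//; last exact: measurable_funTS.
    by congr (integral _ _ _); apply/seteqP; split => x /=; rewrite !in_itv/= andbT oppr_lt0.
  rewrite addeC -ge0_integral_setU//.
  - congr (integral _ _ _); apply/esym/seteqP; split => // x _ /=.
    by rewrite !in_itv/= andbT; have [x0|x0] := leP x 0%R; [left|right].
  - exact: measurable_funTS.
  - apply/disj_setPS => x /= []; rewrite !in_itv/= andbT => x0 x1.
    by move: (le_lt_trans x0 x1); rewrite ltxx.
pose g (v : R * R) := f (- v.1, - v.2)%R.
have mg : measurable_fun setT g.
  apply: measurableT_comp => //; apply/measurable_fun_pair => /=; apply: measurable_funN;
    [exact: measurable_fst | exact: measurable_snd].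
have gF r t : (0 < r)%R -> g (r * cos t, r * sin t)%R = (F r (t + pi))%:E.
  by move=> r0; rewrite /g/= -fF// cosDpi sinDpi !mulrN.
have cG r : (0 < r)%R -> continuous (fun t => F r (t + pi)%R).
  move=> r0 x; apply: (@continuous_comp _ _ _ (fun t => (t + pi)%R) (F r)); last exact: cF.
  by apply: cvgD; [exact: cvg_id|exact: cvg_cst].
have -> : \int[mu]_(x in `]0%R, +oo[) u (- x)%R =
    \int[mu]_(x in `]0%R, +oo[) \int[mu]_y g (x, y).
  apply: eq_integral => x _; rewrite /u /g/= (@integral_reflect _ (fun y => f (- x, y)%R))//.
  exact: (measurableT_comp mf (pair1_measurable (- x)%R)).
rewrite /u (integral_half_plane mf f0 fF cF F0).
rewrite (integral_half_plane mg _ gF cG)//; last by move=> v; exact: f0.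
have p0 : (0 <= pi :> R)%R := pi_ge0 R.
have mFr r : (0 < r)%R -> measurable_fun setT (fun t => (F r t)%:E).
  by move=> r0; apply/measurable_EFinP; exact: continuous_measurable_fun (cF _ r0).
pose A r := \int[mu]_(t in `[(- (pi / 2))%R, (pi / 2)%R]) (F r t)%:E.
pose B r := \int[mu]_(t in `[(- (pi / 2))%R, (pi / 2)%R]) (F r (t + pi))%:E.
have AB r : (0 < r)%R -> A r + B r = \int[mu]_(t in `[0%R, (2 * pi)%R]) (F r t)%:E.
  move=> r0; pose h t := (F r t)%:E.
  have mh : measurable_fun setT h by exact: mFr.
  have h0 t : 0 <= h t by rewrite lee_fin.
  have hp t : h (t + 2 * pi)%R = h t by rewrite /h Fp.
  have shE (a b d : R) : \int[mu]_(x in `[a, b]) h (x + d)%R =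
      \int[mu]_(x in `[(a + d)%R, (b + d)%R]) h x.
    rewrite (@integral_shift _ _ h d)//; last exact: measurable_funTS.
    by congr (integral _ _ _); apply/seteqP; split => x /=; rewrite !in_itv/= !lerD2r.
  have itvE (a b c d : R) : a = c -> b = d -> \int[mu]_(x in `[a, b]) h x =
      \int[mu]_(x in `[c, d]) h x by move=> -> ->.
  have AE : A r = \int[mu]_(t in `[(3 / 2 * pi)%R, (5 / 2 * pi)%R]) h t.
    rewrite /A; under eq_integral do rewrite -Fp.
    by rewrite (shE _ _ (2 * pi)%R); apply: itvE; field.
  have BE : B r = \int[mu]_(t in `[(1 / 2 * pi)%R, (3 / 2 * pi)%R]) h t.
    by rewrite /B (shE _ _ pi); apply: itvE; field.
  rewrite AE BE addeC -integral_itv_split//; last first.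
    by apply/andP; split; rewrite ler_wpM2r//; lra.
  rewrite -[RHS](@integral_periodic _ h (1 / 2 * pi)%R)//; last first.
    by apply/andP; split; [rewrite mulr_ge0//; lra | rewrite ler_wpM2r//; lra].
  rewrite (shE _ _ (1 / 2 * pi)%R).
  by apply: itvE; field.
have mAB (h : R * R -> \bar R) (H : R -> R -> R) : measurable_fun setT h -> (forall v, 0 <= h v) ->
    (forall r t, (0 < r)%R -> h (r * cos t, r * sin t)%R = (H r t)%:E) ->
    measurable_fun (`]0%R, +oo[%classic : set R) (fun r => r%:E *
      \int[mu]_(t in `[(- (pi / 2))%R, (pi / 2)%R]) (H r t)%:E).
  move=> mh h0 hH; apply: emeasurable_funM; first exact/measurable_EFinP.
  pose k (v : R * R) := h (v.1 * cos v.2, v.1 * sin v.2)%R.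
  have mk : measurable_fun setT k.
    apply: measurableT_comp => //; apply/measurable_fun_pair => /=; apply: measurable_funM;
      try exact: measurable_fst; (apply: measurableT_comp; last exact: measurable_snd);
      apply: continuous_measurable_fun; [exact: continuous_cos|exact: continuous_sin].
  have mK : measurable_fun setT (fun r => \int[mu]_(t in `[(- (pi / 2))%R, (pi / 2)%R]) k (r, t)).
    by apply: measurable_integral_snd => // v; exact: h0.
  apply: (eq_measurable_fun (fun r => \int[mu]_(t in `[(- (pi / 2))%R, (pi / 2)%R]) k (r, t))).
    move=> r; rewrite inE/= in_itv/= andbT => r0; apply: eq_integral => t _.
    by rewrite /k/= hH.
  exact: measurable_funTS.
rewrite -ge0_integralD//.
- apply: eq_integral => r; rewrite inE/= in_itv/= andbT => r0.
  by rewrite -ge0_muleDr ?integral_ge0// -?AB// => t _; rewrite lee_fin.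
- by move=> r; rewrite /= in_itv/= andbT => /ltW r0; rewrite mule_ge0// integral_ge0// => t _; rewrite lee_fin.
- exact: mAB mf f0 fF.
- by move=> r; rewrite /= in_itv/= andbT => /ltW r0; rewrite mule_ge0// integral_ge0// => t _; rewrite lee_fin.
- by apply: (mAB g _ mg _ gF) => v; exact: f0.
Qed.

End Polar.

(** * Circle integrals and the Bergman integral *)

Section Means.
Context {R : realType}.
Local Notation mu := (@lebesgue_measure R).
Implicit Types (a g : nat -> R[i]) (z w : R[i]).

Lemma psum_continuous a z (e : R) : disc_coef a -> modulus z < 1 -> 0 < e ->
  exists2 d : R, 0 < d & forall w, modulus (w - z) < d ->
    modulus (psum a w - psum a z) < e.
Proof.
move=> da z1 e0; have rb := recenter_ball da z1.
have r0 : 0 < 1 - modulus z by rewrite subr_gt0.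
pose q := (1 - modulus z) / 2; have q0 : 0 < q by rewrite divr_gt0.
have q1 : q < 1 - modulus z by rewrite ltr_pdivrMr// ltr_pMr// ltr1n.
have [K HK] := psum_quadratic q0 (rb q (introT andP (conj q0 q1))).
set b := recenter a z in HK.
have b0 : psum a z = b 0.
  by rewrite -[z in LHS]addr0 (psum_recenter_ball da) ?modulus0 ?addr0// psum0.
pose L := `|K| + modulus (b 1) + 1.
have L0 : 0 < L by rewrite ltr_wpDl// addr_ge0 ?modulus_ge0.
exists (Num.min (Num.min 1 (q / 2)) (e / L)); first by rewrite !lt_min ltr01 !divr_gt0.
move=> w; rewrite !lt_min => /andP[/andP[w1 wq] we].
have wz' : modulus z + modulus (w - z) < 1 by move: wq q1 q0; rewrite /q; lra.
have := psum_recenter_ball da wz'; rewrite subrKC => ->; rewrite b0.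
have m0 := modulus_ge0 (w - z).
rewrite (_ : _ - b 0 = (psum b (w - z) - b 0 - b 1 * (w - z)) + b 1 * (w - z)); last by rewrite subrK.
apply: (@le_lt_trans _ _ (modulus (w - z) * L)); last by rewrite -ltr_pdivlMr.
rewrite (le_trans (ler_modulusD _ _))// modulusM.
have := HK _ (ltW wq); set T := modulus (_ - b 1 * _) => HT.
have h2 : K * modulus (w - z) ^+ 2 <= `|K| * modulus (w - z).
  rewrite expr2 mulrA (le_trans (ler_norm _))// normrM normrM (ger0_norm m0).
  by rewrite ler_piMr ?mulr_ge0// ltW.
by rewrite /L !mulrDr mulr1 [_ * `|K|]mulrC [_ * modulus (b 1)]mulrC -[leLHS]addr0 lerD// lerD2r (le_trans HT).
Qed.

Definition pt (r t : R) : R[i] := r%:C%C * cis t.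

Lemma ptE r t : pt r t = (r * cos t +i* (r * sin t))%C.
Proof. by rewrite /pt /cis; apply/eqP; rewrite eq_complex/= !mul0r subr0 addr0 !eqxx. Qed.

Lemma modulus_pt r t : modulus (pt r t) = `|r|.
Proof. by rewrite /pt modulusM modulusR modulus_cis mulr1. Qed.

Lemma pt_near r (t d : R) : 0 < d ->
  \forall u \near t, modulus (pt r u - pt r t) < d.
Proof.
move=> d0; pose c := d / (2 * (`|r| + 1)).
have r1 : 0 < `|r| + 1 by rewrite ltr_wpDl.
have c0 : 0 < c by rewrite divr_gt0// mulr_gt0.
have /cvgrPdist_lt/(_ _ c0) Hc := @continuous_cos R t.
have /cvgrPdist_lt/(_ _ c0) Hs := @continuous_sin R t.
near=> u.
have h1 : `|cos t - cos u| < c by near: u; exact: Hc.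
have h2 : `|sin t - sin u| < c by near: u; exact: Hs.
rewrite !ptE modulusBC (le_lt_trans (modulus_le_ReIm _))//= -!mulrBr !normrM -mulrDr.
apply: (@le_lt_trans _ _ ((`|r| + 1) * (`|cos t - cos u| + `|sin t - sin u|))).
  by rewrite ler_wpM2r ?addr_ge0// lerDl.
have -> : d = (`|r| + 1) * (c + c) by rewrite /c; field; rewrite gt_eqF.
by rewrite ltr_pM2l// ltrD.
Unshelve. all: by end_near. Qed.

Lemma modulus_dist_lip z w : `|modulus z - modulus w| <= modulus (z - w).
Proof.
rewrite ler_norml; apply/andP; split; last exact: lerB_modulus.
by rewrite lerNl opprB modulusBC lerB_modulus.
Qed.

(** The value 0 outside the disc makes this function measurable on the whole plane. *)
Definition mdisc a z : R := if modulus z < 1 then modulus (psum a z) else 0.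

Lemma mdisc_ge0 a z : 0 <= mdisc a z.
Proof. by rewrite /mdisc; case: ifP => // _; exact: modulus_ge0. Qed.

Lemma mdisc_in a z : modulus z < 1 -> mdisc a z = modulus (psum a z).
Proof. by rewrite /mdisc => ->. Qed.

Lemma mdisc_out a z : 1 <= modulus z -> mdisc a z = 0.
Proof. by rewrite /mdisc leNgt => /negbTE ->. Qed.

Lemma mdisc_pt a r t : 0 <= r < 1 -> mdisc a (pt r t) = modulus (psum a (pt r t)).
Proof. by move=> /andP[r0 r1]; rewrite /mdisc modulus_pt ger0_norm ?r1. Qed.

Lemma mdisc_pt_continuous a r : disc_coef a -> 0 <= r < 1 ->
  continuous (fun t => mdisc a (pt r t)).
Proof.
move=> da r01 t; apply/cvgrPdist_lt => e e0.
have p1 : modulus (pt r t) < 1 by case/andP: r01 => ? ?; rewrite modulus_pt ger0_norm.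
have [d d0 Hd] := psum_continuous da p1 e0.
near=> u; rewrite !mdisc_pt// distrC (le_lt_trans (modulus_dist_lip _ _))// Hd//.
by near: u; exact: pt_near.
Unshelve. all: by end_near. Qed.

Let cplx (v : R * R) : R[i] := (v.1 +i* v.2)%C.

Let mRe (w : R * R -> R[i]) := measurable_fun setT (fun v => complex.Re (w v)).
Let mIm (w : R * R -> R[i]) := measurable_fun setT (fun v => complex.Im (w v)).

Let mM (w1 w2 : R * R -> R[i]) : mRe w1 -> mIm w1 -> mRe w2 -> mIm w2 ->
  mRe (fun v => w1 v * w2 v) /\ mIm (fun v => w1 v * w2 v).
Proof.
rewrite /mRe /mIm => r1 i1 r2 i2; split.
- rewrite (_ : (fun v => _) = (fun v => complex.Re (w1 v) * complex.Re (w2 v) -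
     complex.Im (w1 v) * complex.Im (w2 v))); last first.
    by apply/funext => v; case: (w1 v) => ? ?; case: (w2 v).
  by apply: measurable_funB; apply: measurable_funM.
- rewrite (_ : (fun v => _) = (fun v => complex.Re (w1 v) * complex.Im (w2 v) +
     complex.Im (w1 v) * complex.Re (w2 v))); last first.
    by apply/funext => v; case: (w1 v) => ? ?; case: (w2 v) => ? ?.
  by apply: measurable_funD; apply: measurable_funM.
Qed.

Let mX n : mRe (fun v => cplx v ^+ n) /\ mIm (fun v => cplx v ^+ n).
Proof.
elim: n => [|n [IHr IHi]].
  by split; rewrite /mRe /mIm; under eq_fun do rewrite expr0; exact: measurable_cst.
have [] := mM (measurable_fst : mRe cplx) (measurable_snd : mIm cplx) IHr IHi.
by rewrite /mRe /mIm; split; under eq_fun do rewrite exprS.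
Qed.

Let mtrunc a N : measurable_fun setT (fun v => modulus (series (fun n => a n * cplx v ^+ n) N)).
Proof.
have [mr mi] : mRe (fun v => series (fun n => a n * cplx v ^+ n) N) /\
    mIm (fun v => series (fun n => a n * cplx v ^+ n) N).
  elim: N => [|N [IHr IHi]].
    by split; rewrite /mRe /mIm; under eq_fun do rewrite series_nat big_ord0; exact: measurable_cst.
  have [xr xi] := mX N.
  have [yr yi] := @mM (fun=> a N) _ (measurable_cst _) (measurable_cst _) xr xi.
  have E v : series (fun n => a n * cplx v ^+ n) N.+1 =
     series (fun n => a n * cplx v ^+ n) N + a N * cplx v ^+ N.
    by rewrite !series_nat big_ord_recr.
  split; rewrite /mRe /mIm.
    rewrite (_ : (fun v => _) = (fun v => complex.Re (series (fun n => a n * cplx v ^+ n) N) +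
      complex.Re (a N * cplx v ^+ N))); first exact: measurable_funD.
    by apply/funext => v; rewrite E; case: (series _ N) => ? ?; case: (_ * _).
  rewrite (_ : (fun v => _) = (fun v => complex.Im (series (fun n => a n * cplx v ^+ n) N) +
      complex.Im (a N * cplx v ^+ N))); first exact: measurable_funD.
  by apply/funext => v; rewrite E; case: (series _ N) => ? ?; case: (_ * _).
rewrite (_ : (fun v => _) = (fun v => Num.sqrt
  (complex.Re (series (fun n => a n * cplx v ^+ n) N) ^+ 2 +
   complex.Im (series (fun n => a n * cplx v ^+ n) N) ^+ 2))); last first.
  by apply/funext => v; rewrite /modulus; case: (series _ N).
apply: measurableT_comp; first by apply: continuous_measurable_fun; exact: sqrt_continuous.
by apply: measurable_funD; apply: measurable_funX.
Qed.

(** A pointwise limit of moduli of polynomials on the disc. *)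
Lemma measurable_mdisc a : disc_coef a ->
  measurable_fun setT (fun v : R * R => mdisc a (v.1 +i* v.2)%C).
Proof.
move=> da.
have mz : measurable_fun setT (fun v => modulus (cplx v)).
  rewrite (_ : (fun v => _) = (fun v : R * R => Num.sqrt (v.1 ^+ 2 + v.2 ^+ 2)))//.
  apply: measurableT_comp; first by apply: continuous_measurable_fun; exact: sqrt_continuous.
  by apply: measurable_funD; apply: measurable_funX; [exact: measurable_fst|exact: measurable_snd].
have mD : measurable [set v | modulus (cplx v) < 1].
  have := measurable_fun_ltr mz (measurable_cst (1 : R)).
  by move=> /(_ measurableT [set true] I); rewrite setTI; congr measurable.
have mf : measurable_fun [set v | modulus (cplx v) < 1] (fun v => modulus (psum a (cplx v))).
  apply: (@measurable_fun_cvg _ _ _ _ (fun N v => modulus (series (fun n => a n * cplx v ^+ n) N))) => //.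
    by move=> N; apply: measurable_funTS; exact: mtrunc.
  move=> v v1; apply/cvgrPdist_le => e e0.
  have /cvg_modulusP/cvgrPdist_le/(_ _ e0) H := disc_psum_cvg da v1.
  near=> N; rewrite distrC (le_trans (modulus_dist_lip _ _))//.
  rewrite -[leLHS]ger0_norm ?modulus_ge0// -normrN -sub0r.
  by near: N; exact: H.
rewrite (_ : (fun v => _) = (fun v => modulus (psum a (cplx v))) \_ [set v | modulus (cplx v) < 1]).
  exact/(measurable_restrictT _ mD).
apply/funext => v; rewrite patchE /mdisc; case: ifPn => [v1|v1].
  by rewrite mem_set.
by rewrite memNset// => /=; exact/negP.
Unshelve. all: by end_near. Qed.

Lemma measurable_mdisc_pt a : disc_coef a ->
  measurable_fun setT (fun v : R * R => mdisc a (pt v.1 v.2)).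
Proof.
move=> da.
rewrite (_ : (fun v => _) = (fun v : R * R => mdisc a (v.1 +i* v.2)%C) \o
   (fun v : R * R => (v.1 * cos v.2, v.1 * sin v.2))); last first.
  by apply/funext => v /=; rewrite ptE.
apply: measurableT_comp; first exact: measurable_mdisc.
apply/measurable_fun_pair => /=; apply: measurable_funM;
      try exact: measurable_fst; (apply: measurableT_comp; last exact: measurable_snd);
      apply: continuous_measurable_fun; [exact: continuous_cos|exact: continuous_sin].
Qed.

Lemma measurable_mdisc_ptp a q : disc_coef a ->
  measurable_fun setT (fun v : R * R => (mdisc a (pt v.1 v.2) `^ q)%:E).
Proof.
move=> da; apply/measurable_EFinP; apply: (measurableT_comp (measurable_powR q)).
exact: measurable_mdisc_pt.
Qed.

Lemma measurable_mdisc_ptr a r : disc_coef a ->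
  measurable_fun setT (fun t => mdisc a (pt r t)).
Proof. by move=> da; apply: (measurableT_comp (measurable_mdisc_pt da) (pair1_measurable r)). Qed.

Lemma measurable_mdisc_ptrp a q r : disc_coef a ->
  measurable_fun setT (fun t => (mdisc a (pt r t) `^ q)%:E).
Proof.
move=> da; apply/measurable_EFinP; apply: (measurableT_comp (measurable_powR q)).
exact: measurable_mdisc_ptr.
Qed.

(** Up to the factor [1/(2 pi)], this is the [q]-th power of the integral mean [M_q(r, psum a)]. *)
Definition circ (q : R) a (r : R) : \bar R :=
  (\int[mu]_(t in `[0%R, (2 * pi)%R]) (mdisc a (pt r t) `^ q)%:E)%E.

Lemma circ_ge0 q a r : (0 <= circ q a r)%E.
Proof. by apply: integral_ge0 => t _; rewrite lee_fin powR_ge0. Qed.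

Lemma measurable_circ q a : disc_coef a -> measurable_fun setT (circ q a).
Proof.
move=> da; apply: (measurable_integral_snd (f := fun v : R * R => (mdisc a (pt v.1 v.2) `^ q)%:E)) => //.
- exact: measurable_mdisc_ptp.
- by move=> v; rewrite lee_fin powR_ge0.
Qed.

(** The [p]-th power of the norm of [psum a] in [A^p], in polar coordinates. *)
Definition berg (p : R) a : \bar R :=
  (\int[mu]_(r in `]0%R, 1%R[) (r%:E * circ p a r))%E.

Lemma berg_ge0 p a : (0 <= berg p a)%E.
Proof.
apply: integral_ge0 => r /=; rewrite in_itv/= => /andP[r0 _].
by rewrite mule_ge0 ?circ_ge0// lee_fin ltW.
Qed.

Lemma mu_circle : mu `[0, 2 * pi] = (2 * pi)%:E.
Proof.
rewrite lebesgue_measure_itv/= lte_fin mulr_gt0 ?pi_gt0// oppr0 adde0//.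
Qed.

Lemma circ_le q a r (M : R) : 0 <= q -> 0 <= M -> (forall t, mdisc a (pt r t) <= M) -> disc_coef a ->
  (circ q a r <= (2 * pi * M `^ q)%:E)%E.
Proof.
move=> q0 M0 HM da; apply: (@le_trans _ _ (\int[mu]_(t in `[0%R, (2 * pi)%R]) (M `^ q)%:E)%E).
  apply: ge0_le_integral => //.
  - by move=> t _; rewrite lee_fin powR_ge0.
  - by apply: measurable_funTS; exact: measurable_mdisc_ptrp.
  - by move=> t _; rewrite lee_fin ge0_ler_powR ?nnegrE ?mdisc_ge0.
by rewrite integral_cst//= mu_circle -EFinM mulrC.
Qed.

Lemma circ_fin q a r : 0 <= q -> disc_coef a -> 0 <= r < 1 -> circ q a r \is a fin_num.
Proof.
move=> q0 da r01; have ca := disc_summable da r01.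
rewrite ge0_fin_numE ?circ_ge0//.
apply: (le_lt_trans (@circ_le q a r (limn (series (fun n => modulus (a n) * r ^+ n))) _ _ _ _)) => //.
- apply: (le_trans _ (series_le_lim 0 _ ca)); first by rewrite series_nat big_ord0.
  by move=> n; case/andP: r01 => r0 _; rewrite mulr_ge0 ?modulus_ge0 ?exprn_ge0.
- move=> t; rewrite mdisc_pt//; apply: psum_le => //.
  by rewrite modulus_pt; case/andP: r01 => r0 _; rewrite ger0_norm.
- exact: ltry.
Qed.

Lemma continuous_powR_comp (m : R -> R) p : 0 < p -> (forall u, 0 <= m u) ->
  continuous m -> continuous (fun u => m u `^ p).
Proof.
move=> p0 m0 cm t.
have := m0 t; rewrite le_eqVlt => /predU1P[mt|mt].
  apply/cvgrPdist_lt => e e0; rewrite -mt powR0 ?gt_eqF//.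
  have e1 : 0 < e `^ p^-1 by rewrite powR_gt0.
  have /cvgrPdist_lt/(_ _ e1) H := cm t.
  near=> u; rewrite sub0r normrN ger0_norm ?powR_ge0//.
  have : `|m t - m u| < e `^ p^-1 by near: u; exact: H.
  rewrite -mt sub0r normrN ger0_norm// => mu1.
  rewrite -[e]powRr1 ?(ltW e0)// -(mulVf (lt0r_neq0 p0)) powRrM.
  by rewrite gt0_ltr_powR// ?nnegrE ?powR_ge0.
apply: (@continuous_comp _ _ _ m (fun x => x `^ p)); first exact: cm.
apply: differentiable_continuous; apply/derivable1_diffP; apply: derivable_powR.
by rewrite in_itv/= andbT.
Unshelve. all: by end_near. Qed.

Lemma berg_prod p a : 0 < p -> disc_coef a ->
  (\int[(mu \x mu)]_v (mdisc a (v.1 +i* v.2)%C `^ p)%:E)%E = berg p a.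
Proof.
move=> p0 da; pose h (v : R * R) := (mdisc a (v.1 +i* v.2)%C `^ p)%:E.
rewrite -/h.
pose F r t := if r < 1 then mdisc a (pt r t) `^ p else 0.
rewrite (@integral_polar R h F).
- rewrite /berg (_ : `]0, +oo[%classic = `]0, 1[%classic `|` `[1, +oo[%classic); last first.
    apply/seteqP; split => r /=; rewrite !in_itv/= !andbT.
      by move=> r0; have [r1|r1] := ltP r 1; [left; rewrite r0|right].
    by move=> [/andP[]//|]; apply: lt_le_trans.
  rewrite ge0_integral_setU//=.
  + rewrite [X in (_ + X)%E]integral0_eq ?adde0 => [|r /=]; last first.
      rewrite in_itv/= andbT leNgt => /negbTE r1.
      by rewrite integral0_eq ?mule0// => t _; rewrite /F r1.
    apply: eq_integral => r; rewrite inE/= in_itv/= => /andP[r0 r1]; congr (_ * _)%E.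
    by apply: eq_integral => t _; rewrite /F r1.
  + apply: emeasurable_funM; first exact/measurable_EFinP.
    apply: measurable_funTS.
    have -> : (fun r => \int[mu]_(t in `[0%R, (2 * pi)%R]) (F r t)%:E)%E =
       (fun r => if r < 1 then circ p a r else 0%E).
      apply/funext => r; rewrite /F; case: ifP => // _; by rewrite integral0.
    apply: measurable_fun_ifT => //=.
    * by apply: measurable_fun_ltr => //; exact: measurable_id.
    * exact: measurable_circ.
  + move=> r r01; apply: mule_ge0; last by apply: integral_ge0 => t _; rewrite lee_fin /F; case: ifP => // _; exact: powR_ge0.
    case: r01 => /=; rewrite in_itv/= ?andbT lee_fin; first by move=> /andP[/ltW].
    exact: le_trans.
  + apply/disj_setPS => r /= []; rewrite !in_itv/= andbT => /andP[_ r1] r1'.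
    by move: (lt_le_trans r1 r1'); rewrite ltxx.
- apply/measurable_EFinP; apply: (measurableT_comp (measurable_powR p)).
  exact: measurable_mdisc.
- by move=> v; rewrite lee_fin powR_ge0.
- move=> r t r0; rewrite /h /F/= -ptE.
  case: ifPn => [//|]; rewrite -leNgt => r1.
  by rewrite /mdisc modulus_pt ger0_norm ?(ltW r0)// ltNge r1/= powR0// gt_eqF.
- move=> r r0; have [r1|r1] := ltP r 1; last first.
    rewrite (_ : F r = cst 0); first by move=> t; exact: cvg_cst.
    by apply/funext => t; rewrite /F ltNge r1.
  rewrite (_ : F r = (fun t => mdisc a (pt r t) `^ p)); last by apply/funext => t; rewrite /F r1.
  apply: continuous_powR_comp => // [u|]; first exact: mdisc_ge0.
  by apply: mdisc_pt_continuous; rewrite ?(ltW r0).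
- by move=> r t; rewrite /F; case: ifP => // _; exact: powR_ge0.
- by move=> r t; rewrite /F /pt mulr_natl cisD2pi.
Qed.

Lemma bergman_integralE p (f : R[i] -> R[i]) a : 0 < p -> disc_coef a ->
  (forall z, modulus z < 1 -> f z = psum a z) ->
  bergman_integral p f = berg p a.
Proof.
move=> p0 da fa; rewrite /bergman_integral -berg_prod// integral_mkcond.
apply: eq_integral => v _.
rewrite patchE /mdisc; case: ifPn => [|/negP]; rewrite inE /unit_disc/= => v1.
  by rewrite v1 fa.
by move/negP/negbTE : v1 => ->; rewrite powR0// gt_eqF.
Qed.

End Means.

(** * Hoelder's inequality with a weight *)

Section HoelderWeight.
Context {R : realType}.
Local Notation mu := (@lebesgue_measure R).
Implicit Types (x y p q : R).

(** Convexity of [x^q]; integrating it with [m] equal to the mean of the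
    function yields the inequalities of Hoelder and Jensen below. *)
Lemma powR_tangent q x m : 1 < q -> 0 <= x -> 0 <= m ->
  q * m `^ (q - 1) * x <= x `^ q + (q - 1) * m `^ q.
Proof.
move=> q1 x0 m0; have q0 : 0 < q by exact: lt_trans q1.
have q10 : 0 < q - 1 by rewrite subr_gt0.
have := @conjugate_powR R x (m `^ (q - 1)) q (q / (q - 1)) x0 (powR_ge0 _ _) q0.
rewrite divr_gt0// => /(_ isT); rewrite invf_div.
have -> : q^-1 + (q - 1) / q = 1 by field; rewrite gt_eqF.
move=> /(_ erefl); rewrite -powRrM.
have -> : (q - 1) * (q / (q - 1)) = q by field; rewrite gt_eqF.
move=> H; rewrite -mulrA -ler_pdivlMl// [m `^ _ * _]mulrC (le_trans H)//.
by rewrite le_eqVlt; apply/orP; left; apply/eqP; field; rewrite !gt_eqF.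
Qed.

(** Jensen's inequality for the weights [w], multiplied by the power [q] of their
    sum, which may vanish. *)
Lemma powR_mean_sum (I : finType) (w x : I -> R) q : 1 < q ->
  (forall i, 0 <= w i) -> (forall i, 0 <= x i) ->
  (\sum_i w i * x i) `^ q <= (\sum_i w i) `^ (q - 1) * \sum_i w i * x i `^ q.
Proof.
move=> q1 w0 x0; have q0 : 0 < q by exact: lt_trans q1.
set W := \sum_i w i; set S := \sum_i w i * x i.
have W0 : 0 <= W by apply: sumr_ge0 => i _.
have S0 : 0 <= S by apply: sumr_ge0 => i _; rewrite mulr_ge0.
move: W0; rewrite le_eqVlt => /predU1P[W0|W0].
  have wi0 i : w i = 0.
    by move/esym/eqP : W0; rewrite psumr_eq0// => /allP/(_ i); rewrite mem_index_enum => /(_ isT)/eqP.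
  rewrite /S big1 => [|i _]; last by rewrite wi0 mul0r.
  by rewrite powR0 ?gt_eqF// mulr_ge0 ?powR_ge0 ?sumr_ge0// => i _; rewrite mulr_ge0 ?powR_ge0.
pose m := S / W; have m0 : 0 <= m by rewrite divr_ge0// ltW.
have H : \sum_i w i * (q * m `^ (q - 1) * x i) <= \sum_i w i * (x i `^ q + (q - 1) * m `^ q).
  by apply: ler_sum => i _; rewrite ler_wpM2l// powR_tangent.
have L : \sum_i w i * (q * m `^ (q - 1) * x i) = q * m `^ (q - 1) * S.
  by rewrite mulr_sumr; apply: eq_bigr => i _; rewrite mulrCA.
have Rr : \sum_i w i * (x i `^ q + (q - 1) * m `^ q) = \sum_i w i * x i `^ q + W * ((q - 1) * m `^ q).
  by rewrite mulr_suml -big_split; apply: eq_bigr => i _; rewrite mulrDr.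
rewrite L Rr in H; move: H; set J := \sum_i w i * x i `^ q => H.
have mS : m `^ (q - 1) * S = W * m `^ q.
  by rewrite -(mulr_powRB1 m0 q0) /m; field; rewrite gt_eqF.
have {}H : W * m `^ q <= J.
  move: H; rewrite -mulrA mS; lra.
have -> : S `^ q = W `^ (q - 1) * (W * m `^ q).
  rewrite mulrA [_ * W]mulrC mulr_powRB1 ?(ltW W0)// -powRM ?(ltW W0)//.
  by rewrite /m mulrCA mulfV ?mulr1// gt_eqF.
by rewrite ler_wpM2l ?powR_ge0.
Qed.

(** The number [S] stands for the integral of [rho * h], which is not assumed to
    be finite: any lower bound will do. *)
Lemma hoelder_weight (D : set R) (h rho : R -> R) q (S W : R) : 1 < q ->
  measurable D -> measurable_fun D h -> measurable_fun D rho ->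
  (forall x, D x -> 0 <= h x) -> (forall x, D x -> 0 <= rho x) -> 0 < W -> 0 <= S ->
  (\int[mu]_(x in D) (rho x)%:E <= W%:E)%E ->
  (S%:E <= \int[mu]_(x in D) (rho x * h x)%:E)%E ->
  ((S `^ q)%:E <= (W `^ (q - 1))%:E * \int[mu]_(x in D) (rho x * h x `^ q)%:E)%E.
Proof.
move=> q1 mD mh mr h0 r0 W0 S0 HW HS; have q0 : 0 < q by exact: lt_trans q1.
pose m := S / W; have m0 : 0 <= m by rewrite divr_ge0// ltW.
have mhq : measurable_fun D (fun x => h x `^ q).
  exact: (measurableT_comp (measurable_powR q)).
have c0 : 0 <= q * m `^ (q - 1) by rewrite mulr_ge0 ?powR_ge0// ltW.
have d0 : 0 <= (q - 1) * m `^ q by rewrite mulr_ge0 ?powR_ge0// subr_ge0 ltW.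
set J := (\int[mu]_(x in D) (rho x * h x `^ q)%:E)%E.
have H : ((q * m `^ (q - 1))%:E * S%:E <= J + ((q - 1) * m `^ q)%:E * W%:E)%E.
  apply: (@le_trans _ _ ((q * m `^ (q - 1))%:E * \int[mu]_(x in D) (rho x * h x)%:E)%E).
    by rewrite lee_wpmul2l// lee_fin.
  apply: (@le_trans _ _ (J + ((q - 1) * m `^ q)%:E * \int[mu]_(x in D) (rho x)%:E)%E); last first.
    by rewrite leeD2l// lee_wpmul2l// lee_fin.
  have E1 : ((q * m `^ (q - 1))%:E * \int[mu]_(x in D) (rho x * h x)%:E =
      \int[mu]_(x in D) (q * m `^ (q - 1) * (rho x * h x))%:E)%E.
    rewrite -ge0_integralZl//.
    - by apply/measurable_EFinP; exact: measurable_funM.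
    - by move=> x Dx; rewrite lee_fin mulr_ge0 ?r0 ?h0.
  have E2 : (((q - 1) * m `^ q)%:E * \int[mu]_(x in D) (rho x)%:E =
      \int[mu]_(x in D) ((q - 1) * m `^ q * rho x)%:E)%E.
    rewrite -ge0_integralZl//; first exact/measurable_EFinP.
  rewrite E1 E2 -ge0_integralD//; last 4 first.
  - by move=> x Dx; rewrite lee_fin mulr_ge0 ?r0 ?powR_ge0.
  - by apply/measurable_EFinP; exact: measurable_funM.
  - by move=> x Dx; rewrite lee_fin mulr_ge0 ?r0.
  - by apply/measurable_EFinP; exact: measurable_funM.
  apply: ge0_le_integral => //.
  - by move=> x Dx; rewrite lee_fin mulr_ge0// mulr_ge0 ?r0 ?h0.
  - by apply/measurable_EFinP; apply: measurable_funM => //; exact: measurable_funM.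
  - apply/measurable_EFinP; apply: measurable_funD; apply: measurable_funM => //.
  - move=> x Dx; rewrite -EFinD lee_fin mulrCA [(q - 1) * _ * _]mulrC -mulrDr.
    by rewrite ler_wpM2l ?r0// powR_tangent ?h0.
have J0 : (0 <= J)%E by apply: integral_ge0 => x Dx; rewrite lee_fin mulr_ge0 ?r0 ?powR_ge0.
have [Jy|Jf] := eqVneq J +oo%E.
  by rewrite Jy gt0_muley ?leey// lte_fin powR_gt0.
have {}Jf : J \is a fin_num by rewrite ge0_fin_numE// ltey.
move: H; rewrite -(fineK Jf) -!EFinM -EFinD !lee_fin; set j := fine J => H.
have mS : m `^ (q - 1) * S = W * m `^ q.
  by rewrite -(mulr_powRB1 m0 q0) /m; field; rewrite gt_eqF.
have {}H : W * m `^ q <= j by move: H; rewrite -mulrA mS; lra.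
have -> : S `^ q = W `^ (q - 1) * (W * m `^ q).
  rewrite mulrA [_ * W]mulrC mulr_powRB1 ?(ltW W0)// -powRM ?(ltW W0)//.
  by rewrite /m mulrCA mulfV ?mulr1// gt_eqF.
by rewrite ler_wpM2l ?powR_ge0.
Qed.

Lemma integral_powR_affine (d c k a b : R) : a <= b -> c != 0 -> k != 0 ->
  (forall t, a <= t <= b -> 0 < d + c * t) ->
  (\int[mu]_(t in `[a, b]) ((d + c * t) `^ (k - 1))%:E =
   (((d + c * b) `^ k - (d + c * a) `^ k) / (c * k))%:E)%E.
Proof.
rewrite le_eqVlt => /predU1P[->|ab] c0 k0 lp.
  by rewrite set_itv1 integral_set1 subrr mul0r.
pose F t := (d + c * t) `^ k / (c * k).
have dl (t : R) : is_derive t 1 (fun t => d + c * t) c.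
  have H : is_derive t 1 (cst d + (c \*: (@id R))) (0 + c *: 1).
    by apply: is_deriveD; apply: is_deriveZ.
  by apply: (is_derive_eq H); rewrite add0r; exact: mulr1.
have dp (e t : R) : a <= t <= b -> is_derive t 1 (fun t => (d + c * t) `^ e) (e * (d + c * t) `^ (e - 1) * c).
  move=> tab; exact: (@is_derive1_comp _ (fun x => x `^ e) (fun t => d + c * t) t _ _
    (is_derive1_powR e (lp _ tab)) (dl t)).
have dF t : a <= t <= b -> is_derive t 1 F ((d + c * t) `^ (k - 1)).
  move=> tab; have FE : F = (c * k)^-1 \*: (fun t => (d + c * t) `^ k).
    by apply/funext => u; rewrite /F mulrC.
  rewrite FE; apply: (is_derive_eq (is_deriveZ (c * k)^-1 (dp k t tab))).
  by rewrite /GRing.scale/=; field; rewrite k0.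
have cf : {within `[a, b], continuous (fun t => (d + c * t) `^ (k - 1))}.
  apply: derivable_within_continuous => t; rewrite in_itv/= => tab.
  by have [] := dp (k - 1) t tab.
have cF t : a <= t <= b -> {for t, continuous F}.
  move=> tab; apply: differentiable_continuous; apply/derivable1_diffP.
  by have [] := dF t tab.
rewrite (@continuous_FTC2 R _ F a b ab cf).
- by rewrite -EFinB /F mulrBl.
- split.
  + by move=> t; rewrite in_itv/= => /andP[ta tb]; have [] := dF t; rewrite ?(ltW ta) ?(ltW tb).
  + by apply: cvg_at_right_filter; apply: cF; rewrite lexx ltW.
  + by apply: cvg_at_left_filter; apply: cF; rewrite lexx ltW.
- move=> t; rewrite in_itv/= => /andP[ta tb]; rewrite derive1E.
  by have [] := dF t; rewrite ?(ltW ta) ?(ltW tb)// => _ ->.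
Qed.

End HoelderWeight.

(** * Integral means of the kernel *)

Section Kernel.
Context {R : realType}.
Local Notation mu := (@lebesgue_measure R).
Implicit Types (k s t : R).

Lemma sin_ge_linear x : 0 <= x <= pi / 2 -> cos 1 / 2 * x <= sin x :> R.
Proof.
move=> /andP[x0 x2]; have c1 := @cos1_gt0 R.
have p2 := @pihalf_lt2 R.
have sin1 (y : R) : 0 <= y <= 1 -> cos 1 * y <= sin y.
  move=> /andP[]; rewrite le_eqVlt => /predU1P[<- _|y0 y1].
    by rewrite mulr0 sin0.
  have [z] := @MVT R sin cos 0 y y0 (fun z _ => is_derive_sin z) (continuous_subspaceT (@continuous_sin R)).
  rewrite in_itv/= sin0 !subr0 => /andP[z0 zy] ->.
  rewrite ler_wpM2r ?(ltW y0)// leNgt; apply/negP.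
  have pi2 := @pi_ge2 R.
  rewrite ltr_cos ?in_itv/=; [|lra..].
  by move: zy y1; lra.
have [x1|x1] := leP x 1.
  by rewrite (le_trans _ (sin1 x _)) ?x0// ler_wpM2r// ler_pdivrMr// ler_peMr ?ler1n// ltW.
apply: (@le_trans _ _ (cos 1)).
  by rewrite -mulrA ler_piMr ?(ltW c1)// mulrC ler_pdivrMr// mul1r ltW// (le_lt_trans x2).
have := sin1 1; rewrite ler01 lexx mulr1 => /(_ isT) h; rewrite (le_trans h)//.
have m1 : (1 : R) \in `[(- (pi / 2)), (pi / 2)] by rewrite in_itv/= pihalf_ge1; have := @pihalf_ge1 R; lra.
have m2 : x \in `[(- (pi / 2)), (pi / 2)] by rewrite in_itv/= x2; lra.
by rewrite leNgt; apply/negP; rewrite ltr_sin//; lra.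
Qed.

Lemma modulus_1Bpt s t : modulus (1 - pt s t) ^+ 2 = (1 - s) ^+ 2 + 4 * s * sin (t / 2) ^+ 2.
Proof.
rewrite ptE /modulus /= sqr_sqrtr ?addr_ge0 ?sqr_ge0//.
have := cos2Dsin2 t; have := cos2Dsin2 (t / 2).
have : cos t = cos (t / 2) ^+ 2 *+ 2 - 1 by rewrite -cos_mulr2n; congr cos; rewrite mulr2n -splitr.
move=> -> h1 h2; have : (s * sin t) ^+ 2 = s ^+ 2 * (1 - (cos (t / 2) ^+ 2 *+ 2 - 1) ^+ 2).
  by rewrite exprMn; congr (_ * _); move: h2; lra.
rewrite sub0r sqrrN => ->; move: h1; set u := cos (t / 2); set v := sin (t / 2) => h1.
have -> : v ^+ 2 = 1 - u ^+ 2 by rewrite -h1 addrC addKr.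
by ring.
Qed.

(** Comparison of the kernel with an affine function of [t], whose powers have
    explicit integrals. *)
Lemma modulus_1Bpt_ge s t : 2^-1 <= s < 1 -> 0 <= t <= pi ->
  (1 - s) / 2 + cos 1 / 8 * t <= modulus (1 - pt s t).
Proof.
move=> /andP[s2 s1] /andP[t0 tp]; have c1 := @cos1_gt0 R.
have A : 0 <= (1 - s) / 2 + cos 1 / 8 * t by rewrite addr_ge0 ?mulr_ge0 ?divr_ge0 ?subr_ge0 ?(ltW c1) ?(ltW s1).
rewrite -(@ler_pXn2r _ 2) ?nnegrE ?modulus_ge0// modulus_1Bpt.
have h : cos 1 / 4 * t <= sin (t / 2).
  by rewrite (le_trans _ (@sin_ge_linear (t / 2) _))//; [lra | rewrite divr_ge0//= ler_pM2r].
have h0 : 0 <= cos 1 / 4 * t by rewrite mulr_ge0// divr_ge0// ltW.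
have h2 : (cos 1 / 4 * t) ^+ 2 <= sin (t / 2) ^+ 2 by rewrite lerXn2r// nnegrE// (le_trans h0).
set x := cos 1 / 4 * t in h h0 h2.
have -> : cos 1 / 8 * t = x / 2 by rewrite /x; field.
have sx : (1 - s) / 2 ^+ 2 * 0 <= 0 :> R by rewrite mulr0.
have : 4 * s * x ^+ 2 <= 4 * s * sin (t / 2) ^+ 2 by rewrite ler_wpM2l// mulr_ge0//; lra.
have : 2 * x ^+ 2 <= 4 * s * x ^+ 2 by rewrite ler_wpM2r ?sqr_ge0//; lra.
by have := sqr_ge0 (1 - s - x); rewrite !expr2; nra.
Qed.

Lemma modulus_1Bpt_ge1 s t : 0 <= s < 1 -> 1 - s <= modulus (1 - pt s t).
Proof.
move=> /andP[s0 s1]; have := lerB_modulus 1 (pt s t).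
by rewrite modulus1 modulus_pt ger0_norm.
Qed.

Lemma modulus_1Bpt_pi s t : modulus (1 - pt s (2 * pi - t)) = modulus (1 - pt s t).
Proof.
apply/eqP; rewrite -(@eqrXn2 _ 2) ?modulus_ge0// !modulus_1Bpt; apply/eqP.
rewrite (_ : (2 * pi - t) / 2 = pi - t / 2); last by field.
by rewrite sinB sinpi cospi mul0r sub0r mulN1r opprK.
Qed.

Lemma measurable_1Bpt k : measurable_fun setT (fun v : R * R => modulus (1 - pt v.1 v.2) `^ (- k)).
Proof.
apply: (measurableT_comp (measurable_powR _)).
rewrite (_ : (fun v => _) = (fun v : R * R => Num.sqrt ((1 - v.1) ^+ 2 + 4 * v.1 * sin (v.2 / 2) ^+ 2))); last first.
  by apply/funext => v; rewrite -modulus_1Bpt sqrtr_sqr ger0_norm ?modulus_ge0.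
apply: measurableT_comp; first by apply: continuous_measurable_fun; exact: sqrt_continuous.
apply: measurable_funD.
  by apply: measurable_funX; apply: measurable_funB => //; exact: measurable_fst.
apply: measurable_funM; first by apply: measurable_funM => //; exact: measurable_fst.
apply: measurable_funX; apply: measurableT_comp; first by apply: continuous_measurable_fun; exact: continuous_sin.
by apply: measurable_funM => //; exact: measurable_snd.
Qed.

Lemma integral_mirror (f : R -> \bar R) : measurable_fun setT f ->
  (forall t, 0 <= f t)%E -> (forall t, f (2 * pi - t) = f t) ->
  (\int[mu]_(t in `[pi, (2 * pi)%R]) f t = \int[mu]_(t in `[0%R, pi]) f t)%E.
Proof.
move=> mf f0 fs.
have mfD (i : interval R) : measurable_fun [set` i] f by exact: measurable_funTS.
rewrite (@integral_reflect R f _ _ (mfD _))//.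
rewrite [RHS](@integral_shift R _ f (2 * pi) _ (mfD _))//.
rewrite (_ : _ @^-1` _ = (fun x => x + 2 * pi) @^-1` `[0, pi]%classic); last first.
  by apply/seteqP; split => x /=; rewrite !in_itv/= => /andP[h1 h2]; apply/andP; split; lra.
by apply: eq_integral => t _; rewrite -fs opprK addrC.
Qed.

(** For [s >= 1/2] the kernel is dominated on each half of the circle by a power of
    an affine function; for [s < 1/2] it is bounded. *)
Lemma kernel_integral k : 1 < k -> exists2 C : R, 0 < C & forall s, 0 <= s < 1 ->
  (\int[mu]_(t in `[0%R, (2 * pi)%R]) (modulus (1 - pt s t) `^ (- k))%:E <= (C * (1 - s) `^ (1 - k))%:E)%E.
Proof.
move=> k1; have c1 := @cos1_gt0 R; have p0 := @pi_gt0 R.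
pose c := cos 1 / 8 : R; have cc : 0 < c by rewrite divr_gt0.
have k0 : 0 < k - 1 by rewrite subr_gt0.
pose C1 := 2 * pi * (2^-1) `^ (- k).
pose C2 := 2 * ((2^-1) `^ (1 - k) / (c * (k - 1))).
have C10 : 0 < C1 by rewrite !mulr_gt0 ?powR_gt0.
have C20 : 0 < C2 by rewrite mulr_gt0// divr_gt0 ?powR_gt0// mulr_gt0.
exists (C1 + C2); first by rewrite addr_gt0.
move=> s /andP[s0 s1]; have s10 : 0 < 1 - s by rewrite subr_gt0.
have mk : measurable_fun setT (fun t => (modulus (1 - pt s t) `^ (- k))%:E).
  by apply/measurable_EFinP; exact: (measurableT_comp (measurable_1Bpt k) (pair1_measurable s)).
have [s2|s2] := ltP s 2^-1.
  apply: (@le_trans _ _ (\int[mu]_(t in `[0%R, (2 * pi)%R]) ((2^-1) `^ (- k))%:E)%E).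
    apply: ge0_le_integral => //.
    - by move=> t _; rewrite lee_fin powR_ge0.
    - exact: measurable_funTS.
    - move=> t _; rewrite lee_fin !powRN lef_pV2 ?posrE ?powR_gt0//; last first.
        by rewrite (lt_le_trans s10)// modulus_1Bpt_ge1 ?s0.
      rewrite ge0_ler_powR ?nnegrE ?modulus_ge0 ?invr_ge0//; first by lra.
      by rewrite (le_trans _ (@modulus_1Bpt_ge1 s t _)) ?s0//; lra.
  rewrite integral_cst//= mu_circle -EFinM mulrC lee_fin.
  have h1 : 1 <= (1 - s) `^ (1 - k).
    rewrite -(opprB k 1) powRN invf_ge1 ?powR_gt0// -[leRHS](powRr0 (1 - s)).
    by rewrite ger_powR ?(ltW k0)// s10/= gerBl.
  apply: (@le_trans _ _ (C1 * 1)); first by rewrite mulr1.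
  by rewrite ler_pM ?(ltW C10)// lerDl ltW.
pose J := ((1 - s) / 2) `^ (1 - k) / (c * (k - 1)).
have I1 : (\int[mu]_(t in `[0%R, pi]) (modulus (1 - pt s t) `^ (- k))%:E <= J%:E)%E.
  apply: (@le_trans _ _ (\int[mu]_(t in `[0%R, pi]) (((1 - s) / 2 + c * t) `^ ((1 - k) - 1))%:E)%E).
    apply: ge0_le_integral => //.
    - by move=> t _; rewrite lee_fin powR_ge0.
    - exact: measurable_funTS.
    - apply: measurable_funTS; apply/measurable_EFinP; apply: (measurableT_comp (measurable_powR _)).
      by apply: measurable_funD => //; exact: measurable_funM.
    - move=> t /=; rewrite in_itv/= => tp; rewrite lee_fin (_ : 1 - k - 1 = - k); last by ring.
      have l0 : 0 < (1 - s) / 2 + c * t.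
        by case/andP: tp => t0 _; rewrite ltr_wpDr ?divr_gt0// mulr_ge0// ltW.
      have lm : (1 - s) / 2 + c * t <= modulus (1 - pt s t) by apply: modulus_1Bpt_ge; rewrite ?s2.
      rewrite !powRN lef_pV2 ?posrE ?powR_gt0//; last exact: lt_le_trans lm.
      by rewrite ge0_ler_powR ?nnegrE ?modulus_ge0 ?(ltW l0)//; lra.
  have cn0 : c != 0 by rewrite gt_eqF.
  have kn0 : 1 - k != 0 by rewrite lt_eqF// subr_lt0.
  rewrite (integral_powR_affine (ltW p0) cn0 kn0); last first.
    by move=> t /andP[t0 _]; rewrite ltr_wpDr ?divr_gt0// mulr_ge0// ltW.
  rewrite lee_fin mulr0 addr0 /J -(opprB k 1) mulrN invrN mulrN -mulNr opprB.
  apply: ler_wpM2r; last by rewrite opprB gerBl powR_ge0.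
  by rewrite invr_ge0 mulr_ge0// ltW.
have I2 : (\int[mu]_(t in `[pi, (2 * pi)%R]) (modulus (1 - pt s t) `^ (- k))%:E =
   \int[mu]_(t in `[0%R, pi]) (modulus (1 - pt s t) `^ (- k))%:E)%E.
  apply: integral_mirror => // [t|t]; first by rewrite lee_fin powR_ge0.
  by rewrite modulus_1Bpt_pi.
rewrite (@integral_itv_split _ _ 0 pi) ?(ltW p0)//; last 2 first.
- by rewrite ler_peMl ?(ltW p0)// ler1n.
- by move=> t; rewrite lee_fin powR_ge0.
rewrite I2; apply: (le_trans (leeD I1 I1)); rewrite -EFinD lee_fin.
have -> : J + J = C2 * (1 - s) `^ (1 - k).
  by rewrite /J /C2 [(1 - s) / 2]mulrC powRM ?invr_ge0 ?(ltW s10)//; field; rewrite !gt_eqF.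
by rewrite ler_wpM2r ?powR_ge0// lerDr ltW.
Qed.

End Kernel.

(** * Partial sums and Euler derivative of the coefficients *)

Section PartialSums.
Context {R : realType}.
Implicit Types (a g : nat -> R[i]) (z w : R[i]).

Definition partial_sum a (n : nat) : R[i] := \sum_(k < n.+1) a k.

Lemma disc_coef_partial_sum a : disc_coef a -> disc_coef (partial_sum a).
Proof.
move=> da r /andP[r0 r1]; have ca := disc_summable da (introT andP (conj (ltW r0) r1)).
exists (limn (series (fun n => modulus (a n) * r ^+ n))) => n.
have b0 k : 0 <= modulus (a k) * r ^+ k by rewrite mulr_ge0 ?modulus_ge0 ?exprn_ge0// ltW.
apply: (le_trans _ (series_le_lim n.+1 b0 ca)); rewrite series_nat.
apply: (@le_trans _ _ (\sum_(k < n.+1) modulus (a k) * r ^+ n)).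
  by rewrite -mulr_suml ler_wpM2r ?exprn_ge0 ?(ltW r0)// ler_modulus_sum.
apply: ler_sum => k _; rewrite ler_wpM2l ?modulus_ge0// ler_wiXn2l ?(ltW r0) ?(ltW r1)//.
by rewrite -ltnS.
Qed.

Lemma disc_coefM a g : disc_coef a -> disc_coef g -> disc_coef (fun n => g n * a n).
Proof.
move=> da dg r /andP[r0 r1].
pose s := Num.sqrt r; have s01 : 0 < s < 1 by rewrite sqrtr_gt0 r0/= -sqrtr1 ltr_sqrt.
have [M HM] := da s s01; have [L HL] := dg s s01.
exists (L * M) => n; have -> : r = s * s by rewrite -expr2 sqr_sqrtr// ltW.
rewrite modulusM exprMn mulrACA ler_pM ?mulr_ge0 ?modulus_ge0 ?exprn_ge0//; by case/andP: s01 => /ltW.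
Qed.

(** Coefficients of [z f'(z)] when [f = psum a]. *)
Definition theta a (n : nat) : R[i] := n%:R * a n.

Lemma disc_coef_nat : disc_coef (fun n => n%:R : R[i]).
Proof.
have d1 : disc_coef (fun=> 1 : R[i]).
  by move=> r /andP[r0 r1]; exists 1 => n; rewrite modulus1 mul1r exprn_ile1// ltW.
move=> r r01; have [M HM] := disc_coef_partial_sum d1 r01.
exists M => n; apply: le_trans (HM n); case/andP: r01 => r0 _.
rewrite ler_wpM2r ?exprn_ge0 ?(ltW r0)// /partial_sum sumr_const card_ord.
by rewrite !modulus_nat ler_nat.
Qed.

Lemma disc_coef_theta a : disc_coef a -> disc_coef (theta a).
Proof. by move=> da; apply: disc_coefM => //; exact: disc_coef_nat. Qed.

(** Multiplication by [1 - b z] on coefficients. *)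
Lemma psum_telescope a b z : disc_coef a -> modulus z < 1 ->
  (1 - b * z) * psum a z = psum (fun n => a n - (if n is m.+1 then b * a m else 0)) z.
Proof.
move=> da z1; apply/esym/psum_eq.
have H := disc_psum_cvg da z1.
have H1 : series (fun n => (if n is m.+1 then b * a m else 0) * z ^+ n) @ \oo --> b * z * psum a z.
  rewrite -cvg_shiftS.
  rewrite (_ : (fun n => _) = (fun n => b * z * series (fun n => a n * z ^+ n) n)); last first.
    apply/funext => n; rewrite !series_nat big_ord_recl/= mul0r add0r mulr_sumr.
    by apply: eq_bigr => i _; rewrite /bump/= exprS; ring.
  by apply: cvgM; [exact: cvg_cst|exact: H].
rewrite mulrBl mul1r /power_sum_at.
rewrite (_ : series _ = (fun n => series (fun n => a n * z ^+ n) n -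
  series (fun n => (if n is m.+1 then b * a m else 0) * z ^+ n) n)); last first.
  by apply/funext => n; rewrite !series_nat -sumrB; apply: eq_bigr => i _; rewrite mulrBl.
exact: (cvgB H H1).
Qed.

(** The partial sums are the coefficients of [f / (1 - z)]. *)
Lemma psum_partial_sum a z : disc_coef a -> modulus z < 1 ->
  (1 - z) * psum (partial_sum a) z = psum a z.
Proof.
move=> da z1; rewrite -[z in 1 - z]mul1r psum_telescope//; last exact: disc_coef_partial_sum.
congr (psum _ z); apply/funext => -[|n]; rewrite /partial_sum.
  by rewrite big_ord1 subr0.
by rewrite [X in X - _]big_ord_recr/= mul1r addrAC subrr add0r.
Qed.

End PartialSums.

#[local] Opaque mdisc psum csum cis.

(** * Young's inequality on circles *)

Section Young.
Context {R : realType}.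
Local Notation mu := (@lebesgue_measure R).
Implicit Types (a g : nat -> R[i]) (z w : R[i]) (q r s : R).

Lemma powRD_le q (x y : R) : 0 < q -> 0 <= x -> 0 <= y ->
  (x + y) `^ q <= 2 `^ q * (x `^ q + y `^ q).
Proof.
move=> q0; wlog xy : x y / x <= y => [H x0 y0|x0 y0].
  by have [xy|/ltW yx] := leP x y; [exact: H|rewrite addrC [X in _ * X]addrC; exact: H].
apply: (@le_trans _ _ ((2 * y) `^ q)).
  by rewrite ge0_ler_powR ?nnegrE ?addr_ge0 ?mulr_ge0 ?(ltW q0)// mulr_natl mulr2n lerD2r.
by rewrite powRM// ler_wpM2l ?powR_ge0// lerDr powR_ge0.
Qed.

Lemma integral_periodicN (f : R -> \bar R) (c : R) : 0 <= c <= 2 * pi ->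
  measurable_fun setT f -> (forall x, (0 <= f x)%E) ->
  (forall x, f (x + 2 * pi) = f x) ->
  (\int[mu]_(x in `[0%R, (2 * pi)%R]) f (x - c)%R =
  \int[mu]_(x in `[0%R, (2 * pi)%R]) f x)%E.
Proof.
move=> c0 mf f0 fp.
rewrite -(@integral_periodic _ (fun x => f (x - c)) c c0)//.
- by apply: eq_integral => x _; rewrite addrK.
- apply: measurableT_comp => //; exact: measurable_funB.
- by move=> x; rewrite addrAC fp.
Qed.

Lemma pt_periodic r t : pt r (t + 2 * pi) = pt r t.
Proof. by rewrite /pt mulr_natl cisD2pi. Qed.

Lemma circ_shift q a r c : disc_coef a -> 0 <= c <= 2 * pi ->
  (\int[mu]_(t in `[0%R, (2 * pi)%R]) (mdisc a (pt r (t + c)) `^ q)%:E = circ q a r)%E.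
Proof.
move=> da c0; pose f t := (mdisc a (pt r t) `^ q)%:E.
have mf : measurable_fun setT f by exact: measurable_mdisc_ptrp.
have f0 t : (0 <= f t)%E by rewrite lee_fin powR_ge0.
have fp t : f (t + 2 * pi) = f t by rewrite /f pt_periodic.
exact: (integral_periodic c0 mf f0 fp).
Qed.

Lemma circ_shiftN q a r c d : disc_coef a -> 0 <= c <= 2 * pi -> 0 <= d <= 2 * pi ->
  (\int[mu]_(t in `[0%R, (2 * pi)%R]) (mdisc a (pt r (t - c - d)) `^ q)%:E = circ q a r)%E.
Proof.
move=> da c0 d0.
pose f t := (mdisc a (pt r t) `^ q)%:E.
have mf : measurable_fun setT f by exact: measurable_mdisc_ptrp.
have f0 t : (0 <= f t)%E by rewrite lee_fin powR_ge0.
have fp t : f (t + 2 * pi) = f t by rewrite /f pt_periodic.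
pose g t := f (t - d).
have mg : measurable_fun setT g by apply: (measurableT_comp mf); exact: measurable_funB.
have g0 t : (0 <= g t)%E by exact: f0.
have gp t : g (t + 2 * pi) = g t by rewrite /g addrAC fp.
have E1 := integral_periodicN c0 mg g0 gp.
have E2 := integral_periodicN d0 mf f0 fp.
exact: (etrans E1 E2).
Qed.

(** Young's inequality for the convolution that represents [psum (g * a)]. The
    discrete average at the [N]-th roots of unity is a weighted mean, with weights
    [v tau j] given by the values of [psum a] on a rotated set of nodes. Averaging over
    the rotation [tau], some choice makes the total weight at most [2 L]; Jensen's
    inequality then gives the result up to the error of [node_average]. *)
Lemma young_circ q g a r s (L : R) : 1 < q -> disc_coef g -> disc_coef a ->
  0 <= r < 1 -> 0 <= s < 1 -> 0 < L -> (circ 1 a s <= L%:E)%E ->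
  (circ q (fun n => g n * a n)%R (r * s) <= ((4 * L) `^ q)%:E * circ q g r)%E.
Proof.
move=> q1 dg da r01 s01 L0 HL; have q0 : 0 < q by exact: lt_trans q1.
have [r0 r1] := andP r01; have [s0 s1] := andP s01.
have rs01 : 0 <= r * s < 1 by rewrite mulr_ge0//= mulr_ilt1.
have cf : circ q g r \is a fin_num by apply: circ_fin; rewrite ?(ltW q0).
have pi0 : 0 < 2 * pi :> R by rewrite mulr_gt0 ?pi_gt0.
have cancel_card (x y n : R) : n != 0 -> x * y <= n^-1 * y * x * n.
  by move=> n0; rewrite le_eqVlt; apply/orP; left; apply/eqP; field.
have cg := disc_summable dg r01; have ca := disc_summable da s01.
have [err err0 Herr] := node_average r0 s0 cg ca.
apply/lee_addgt0Pr => d d0.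
(* e is the error on the integrand for which the error on the integral is d *)
pose e := (d / (2 `^ q * (2 * pi))) `^ q^-1.
have d1 : 0 < d / (2 `^ q * (2 * pi)) by rewrite divr_gt0// mulr_gt0// powR_gt0.
have e0 : 0 < e by rewrite powR_gt0.
have eq : e `^ q = d / (2 `^ q * (2 * pi)).
  by rewrite /e -powRrM mulVf ?gt_eqF// powRr1// ltW.
have [N [N0 HN]] : exists N : nat, (0 < N)%N /\ err N <= e.
  move/cvgrPdist_le : err0 => /(_ _ e0)[K _ HK]; exists K.+1; split => //.
  by have := HK K.+1 (leqnSn _); rewrite /= sub0r normrN; exact: le_trans (ler_norm _).
have Nr0 : 0 < N%:R :> R by rewrite ltr0n.
have nb (j : 'I_N) : 0 <= (node N j : R) <= 2 * pi by exact: node_bound.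
pose v (tau : R) (j : 'I_N) := N%:R^-1 * mdisc a (pt s (tau + node N j)).
have v0 tau j : 0 <= v tau j by rewrite mulr_ge0 ?invr_ge0 ?(ltW Nr0)// mdisc_ge0.
(* the mean over tau of the total weight is at most L / (2 pi) *)
have [tau tau2 Htau] : exists2 tau : R, 0 <= tau <= 2 * pi & \sum_j v tau j <= 2 * L.
  apply: contrapT => H.
  have {}H tau : 0 <= tau <= 2 * pi -> 2 * L <= \sum_j v tau j.
    by move=> ht; rewrite leNgt; apply/negP => /ltW hl; apply: H; exists tau.
  have mv j : measurable_fun setT (fun tau => (v tau j)%:E).
    apply/measurable_EFinP; apply: measurable_funM => //.
    by apply: (measurableT_comp (measurable_mdisc_ptr s da)); exact: measurable_funD.
  have : (\int[mu]_(tau in `[0%R, (2 * pi)%R]) (2 * L)%:E <=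
     \int[mu]_(tau in `[0%R, (2 * pi)%R]) \sum_j (v tau j)%:E)%E.
    apply: ge0_le_integral => //.
    - by move=> t _; rewrite lee_fin mulr_ge0// ltW.
    - by apply: measurable_funTS; apply: emeasurable_sum => j; exact: mv.
    - by move=> t; rewrite /= in_itv/= => ht; rewrite sumEFin lee_fin H.
  rewrite integral_cst//= mu_circle ge0_integral_sum//; last 2 first.
  - by move=> j; apply: measurable_funTS; exact: mv.
  - by move=> j x _; rewrite lee_fin.
  rewrite (eq_bigr (fun=> N%:R^-1%:E * circ 1 a s)%E); last first.
    move=> j _; rewrite -(circ_shift 1 s da (nb j)) -ge0_integralZl//.
    - by apply: eq_integral => t _; rewrite -EFinM powRr1 ?mdisc_ge0.
    - apply: measurable_funTS; apply/measurable_EFinP; apply: (measurableT_comp (measurable_powR _)).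
      by apply: (measurableT_comp (measurable_mdisc_ptr s da)); exact: measurable_funD.
    - by move=> t _; rewrite lee_fin powR_ge0.
  move=> H2; have : ((2 * L)%:E * (2 * pi)%:E <= L%:E)%E.
    apply: (le_trans H2); apply: (@le_trans _ _ (\sum_(j < N) (N%:R^-1 * L)%:E)%E).
      by apply: lee_sum => j _; rewrite EFinM lee_wpmul2l// lee_fin invr_ge0 ltW.
    by rewrite sumEFin lee_fin sumr_const card_ord -[(_ * L) *+ N]mulr_natl mulrA mulfV ?mul1r// gt_eqF.
  rewrite -EFinM lee_fin; have := @pi_ge2 R; have := L0; nra.
have pw t : mdisc (fun n => g n * a n) (pt (r * s) t) `^ q <=
    2 `^ q * e `^ q + \sum_j (2 `^ q * (2 * L) `^ (q - 1) * v tau j) *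
      mdisc g (pt r (t - tau - node N j)) `^ q.
  have h1 : mdisc (fun n => g n * a n) (pt (r * s) t) <=
     e + \sum_j v tau j * mdisc g (pt r (t - tau - node N j)).
    rewrite mdisc_pt//.
    have := Herr N (pt r (t - tau)) (pt s tau) N0; rewrite !modulus_pt !ger0_norm// => /(_ (lexx _) (lexx _)).
    have -> : pt r (t - tau) * pt s tau = pt (r * s) t.
      by rewrite /pt rmorphM mulrACA -cisD subrK.
    set X := _ * \sum_(_ < _) _ => hX.
    rewrite -(subrK X (psum _ _)) (le_trans (ler_modulusD _ _))// modulusBC lerD//.
      exact: le_trans HN.
    rewrite /X modulusM modulusV modulus_nat mulrC ler_pdivrMr//.
    apply: (le_trans (ler_modulus_sum _ _ _)).
    rewrite mulr_suml; apply: ler_sum => j _; rewrite modulusM /v.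
    have -> : pt r (t - tau) * cis (- node N j) = pt r (t - tau - node N j).
      by rewrite /pt -mulrA -cisD.
    have -> : pt s tau * cis (node N j) = pt s (tau + node N j) by rewrite /pt -mulrA -cisD.
    rewrite [mdisc a _]mdisc_pt// [mdisc g _]mdisc_pt//.
    exact: cancel_card (lt0r_neq0 Nr0).
  have X0 : 0 <= \sum_j v tau j * mdisc g (pt r (t - tau - node N j)).
    by apply: sumr_ge0 => j _; rewrite mulr_ge0 ?mdisc_ge0.
  apply: (@le_trans _ _ ((e + \sum_j v tau j * mdisc g (pt r (t - tau - node N j))) `^ q)).
    by rewrite ge0_ler_powR ?nnegrE ?mdisc_ge0 ?addr_ge0 ?(ltW q0) ?(ltW e0).
  apply: (le_trans (powRD_le q0 (ltW e0) X0)); rewrite mulrDr lerD2l.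
  rewrite [leRHS](eq_bigr (fun j => 2 `^ q * (2 * L) `^ (q - 1) *
     (v tau j * mdisc g (pt r (t - tau - node N j)) `^ q))); last by move=> j _; exact/esym/mulrA.
  rewrite -mulr_sumr -mulrA ler_wpM2l ?powR_ge0//.
  apply: (le_trans (powR_mean_sum q1 (v0 tau) (fun j => mdisc_ge0 _ _))).
  rewrite ler_wpM2r ?sumr_ge0// => [j _|]; first by rewrite mulr_ge0 ?powR_ge0.
  by rewrite ge0_ler_powR ?nnegrE ?sumr_ge0 ?mulr_ge0 ?(ltW L0)// subr_ge0 ltW.
have mg (j : 'I_N) : measurable_fun setT (fun t : R => mdisc g (pt r (t - tau - node N j)) `^ q).
  apply: (measurableT_comp (measurable_powR _)); apply: (measurableT_comp (measurable_mdisc_ptr r dg)).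
  by apply: measurable_funB => //; exact: measurable_funB.
clearbody v.
have k0 j : 0 <= 2 `^ q * (2 * L) `^ (q - 1) * v tau j by rewrite !mulr_ge0 ?powR_ge0.
pose G (j : 'I_N) (t : R) := mdisc g (pt r (t - tau - node N j)) `^ q.
pose F (t : R) := (mdisc (fun n => g n * a n) (pt (r * s) t) `^ q)%:E.
have IG (j : 'I_N) : (\int[mu]_(t in `[0%R, (2 * pi)%R]) (G j t)%:E = circ q g r)%E.
  exact: circ_shiftN (nb j).
have mF : measurable_fun setT F.
  by apply: measurable_mdisc_ptrp; exact: disc_coefM.
have G0 (j : 'I_N) t : 0 <= G j t by exact: powR_ge0.
have F0 t : (0 <= F t)%E by rewrite lee_fin powR_ge0.
have {}pw t : (F t <= (2 `^ q * e `^ q)%:E +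
   \sum_j ((2 `^ q * (2 * L) `^ (q - 1) * v tau j) * G j t)%:E)%E.
  by rewrite sumEFin -EFinD lee_fin pw.
have {}mg (j : 'I_N) : measurable_fun setT (G j) by exact: mg.
have ee0 : 0 <= 2 `^ q * e `^ q by rewrite mulr_ge0 ?powR_ge0.
have -> : circ q (fun n => g n * a n) (r * s) = (\int[mu]_(t in `[0%R, (2 * pi)%R]) F t)%E by [].
clearbody G F.
have mvG (j : 'I_N) : measurable_fun setT (fun t : R =>
    (2 `^ q * (2 * L) `^ (q - 1) * v tau j * G j t)%:E).
  by apply/measurable_EFinP; apply: measurable_funM (mg j); exact: measurable_cst.
apply: (@le_trans _ _ (\int[mu]_(t in `[0%R, (2 * pi)%R]) ((2 `^ q * e `^ q)%:E +
   \sum_j ((2 `^ q * (2 * L) `^ (q - 1) * v tau j) * G j t)%:E))%E).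
  apply: ge0_le_integral => //.
  - by apply: measurable_funTS.
  - apply: measurable_funTS; apply: emeasurable_funD => //; apply: emeasurable_sum => j.
    exact: mvG.
rewrite ge0_integralD//; last 2 first.
- by move=> t _; apply: sume_ge0 => j _; rewrite lee_fin mulr_ge0.
- by apply: measurable_funTS; apply: emeasurable_sum => j; exact: mvG.
rewrite integral_cst//= mu_circle ge0_integral_sum//; last 2 first.
- by move=> j; apply: measurable_funTS; exact: mvG.
- by move=> j t _; rewrite lee_fin mulr_ge0.
rewrite (eq_bigr (fun j => (2 `^ q * (2 * L) `^ (q - 1) * v tau j)%:E * circ q g r)%E); last first.
  move=> j _; rewrite -(IG j) -ge0_integralZl//.
  - by apply: measurable_funTS; apply/measurable_EFinP; exact: mg.
  - by move=> t _; rewrite lee_fin; exact: G0.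
  - by rewrite lee_fin.
rewrite -(fineK cf); set c := fine _.
have c0 : 0 <= c by apply: fine_ge0; exact: circ_ge0.
rewrite (eq_bigr (fun j => (2 `^ q * (2 * L) `^ (q - 1) * v tau j * c)%:E)); last by move=> j _; rewrite EFinM.
rewrite sumEFin -!EFinM -!EFinD lee_fin -mulr_suml -mulr_sumr addrC lerD//.
  rewrite ler_wpM2r//.
  rewrite (_ : (4 * L) `^ q = 2 `^ q * (2 * L) `^ (q - 1) * (2 * L)).
    by rewrite ler_wpM2l ?mulr_ge0 ?powR_ge0.
  have L2 : 0 <= 2 * L by rewrite mulr_ge0// ltW.
  rewrite -mulrA [_ * (2 * L)]mulrC mulr_powRB1// -powRM//; congr (_ `^ _); ring.
rewrite eq le_eqVlt; apply/orP; left; apply/eqP; rewrite mulrAC mulrC divfK//.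
by rewrite gt_eqF// mulr_gt0 ?powR_gt0.
Qed.

(** Hoelder's inequality for [f / (1 - z)], with the weight [|1 - z|^(-k)] and
    [k = p / (p - 1)], the exponent for which the powers of [|1 - z|] cancel. *)
Lemma circ1_partial_sum (p : R) : 1 < p -> exists2 C : R, 0 < C & forall a s,
  disc_coef a -> 0 <= s < 1 ->
  (((fine (circ 1 (partial_sum a) s)) `^ p)%:E <= (C * (1 - s)^-1)%:E * circ p a s)%E.
Proof.
move=> p1; have p0 : 0 < p by exact: lt_trans p1.
pose k := p / (p - 1); have pp : 0 < p - 1 by rewrite subr_gt0.
have k1 : 1 < k by rewrite ltr_pdivlMr// mul1r gtrBl.
have [C C0 HC] := kernel_integral k1.
exists (C `^ (p - 1)); first exact: powR_gt0.
move=> a s da s01; have [s0 s1] := andP s01; have s10 : 0 < 1 - s by rewrite subr_gt0.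
have dA := disc_coef_partial_sum da.
have cf : circ 1 (partial_sum a) s \is a fin_num by exact: circ_fin.
pose W := C * (1 - s) `^ (1 - k).
have W0 : 0 < W by rewrite mulr_gt0 ?powR_gt0.
pose m t := modulus (1 - pt s t).
have m0 t : 0 < m t by rewrite (lt_le_trans s10)// modulus_1Bpt_ge1.
have mm e : measurable_fun setT (fun t => m t `^ (- e)).
  exact: (measurableT_comp (measurable_1Bpt e) (pair1_measurable s)).
pose h t := mdisc a (pt s t) * m t `^ (- (1 - k)).
have rh t : m t `^ (- k) * h t = mdisc (partial_sum a) (pt s t).
  have pt1 : modulus (pt s t) < 1 by rewrite modulus_pt ger0_norm.
  rewrite /h mulrCA -powRD; last by rewrite (gt_eqF (m0 t)) implybT.
  rewrite (_ : - k + - (1 - k) = -1); last by ring.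
  rewrite powR_inv1 ?(ltW (m0 t))// !mdisc_pt// -(psum_partial_sum da pt1).
  by rewrite modulusM mulrC mulKf// gt_eqF// m0.
have rhp t : m t `^ (- k) * h t `^ p = mdisc a (pt s t) `^ p.
  rewrite /h powRM ?mdisc_ge0 ?powR_ge0// mulrCA -powRrM -powRD; last by rewrite (gt_eqF (m0 t)) implybT.
  rewrite (_ : - k + - (1 - k) * p = 0) ?powRr0 ?mulr1//.
  by rewrite /k; field; rewrite gt_eqF.
have := @hoelder_weight _ `[0, 2 * pi]%classic h (fun t => m t `^ (- k)) p
   (fine (circ 1 (partial_sum a) s)) W p1.
under [X in (_ <= _ * X)%E]eq_integral do rewrite rhp.
rewrite -/(circ p a s) => H; apply: (le_trans (H _ _ _ _ _ _ _ _ _)) => //.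
- by apply: measurable_funTS; apply: measurable_funM; [exact: measurable_mdisc_ptr|exact: mm].
- by apply: measurable_funTS; exact: mm.
- by move=> t _; rewrite mulr_ge0 ?mdisc_ge0 ?powR_ge0.
- by move=> t _; exact: powR_ge0.
- by apply: fine_ge0; exact: circ_ge0.
- exact: HC.
- rewrite fineK// /circ le_eqVlt; apply/orP; left; apply/eqP; apply: eq_integral => t _.
  by rewrite rh powRr1 ?mdisc_ge0.
- rewrite lee_wpmul2r ?circ_ge0// lee_fin /W powRM ?powR_ge0 ?(ltW C0)// -powRrM.
  rewrite (_ : (1 - k) * (p - 1) = -1); last by rewrite /k; field; rewrite gt_eqF.
  by rewrite powR_inv1// ltW.
Qed.

End Young.

(** * Hardy's inequality for integral means *)

Section Hardy.
Context {R : realType}.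
Local Notation mu := (@lebesgue_measure R).
Implicit Types (a g : nat -> R[i]) (z w : R[i]).

Lemma psum_theta a z : disc_coef a -> modulus z < 1 ->
  psum (theta a) z = z * psum (dcoef a) z.
Proof.
move=> da z1; apply: psum_eq.
have dd : disc_coef (dcoef a) by exact: rad_ball_dcoef.
have H := disc_psum_cvg dd z1.
rewrite /power_sum_at -cvg_shiftS.
rewrite (_ : (fun n => _) = (fun n => z * series (fun n => dcoef a n * z ^+ n) n)); last first.
  apply/funext => n; rewrite !series_nat big_ord_recl/= /theta !mul0r add0r mulr_sumr.
  by apply: eq_bigr => i _; rewrite /bump/= /dcoef exprS; ring.
by apply: cvgM; [exact: cvg_cst|exact: H].
Qed.

(** Real differentiability from a quadratic remainder. *)
Lemma is_derive_quadratic (f : R -> R) (u d K e : R) : 0 < e ->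
  (forall k, `|k| < e -> `|f (k + u) - f u - k * d| <= K * k ^+ 2) ->
  is_derive u 1 f d.
Proof.
move=> e0 H.
have cv : (fun h : R => h^-1 *: ((f \o shift u) (h *: 1) - f u)) @ (0 : R)^' --> d.
  apply/cvgrPdist_le => eps eps0; near=> h.
  have h0 : h != 0 by near: h; exact: nbhs_dnbhs_neq.
  have he : `|h| < e by near: h; apply: dnbhs0_lt.
  have hK : `|h| <= eps / (`|K| + 1).
    by near: h; apply: dnbhs0_le; rewrite divr_gt0// ltr_wpDl.
  rewrite /shift /= [h *: 1]mulr1 distrC.
  have -> : h^-1 *: (f (h + u) - f u) - d = h^-1 * (f (h + u) - f u - h * d).
    by rewrite /GRing.scale/=; field.
  rewrite normrM normfV ler_pdivrMl ?normr_gt0//.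
  apply: (le_trans (H _ he)); apply: (@le_trans _ _ (`|K| * h ^+ 2)).
    by rewrite ler_wpM2r ?sqr_ge0// ler_norm.
  rewrite -real_normK ?num_real// expr2 mulrA [_ * eps]mulrC ler_wpM2r//.
  rewrite mulrC; move: hK; rewrite ler_pdivlMr ?ltr_wpDl// => hK.
  by rewrite (le_trans _ hK)// ler_wpM2l// lerDl.
by split; [apply/cvg_ex; exists d; exact: cv | apply/cvg_lim => //; exact: cv].
Unshelve. all: by end_near. Qed.

Lemma psum_radial_derive a (c w : R[i]) (u : R) : disc_coef a -> modulus w = 1 ->
  modulus c = 1 -> `|u| < 1 ->
  is_derive u 1 (fun v => complex.Re (c * psum a (v%:C%C * w)))
    (complex.Re (c * w * psum (dcoef a) (u%:C%C * w))).
Proof.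
move=> da w1 c1 u1; set z := u%:C%C * w.
have z1 : modulus z < 1 by rewrite modulusM modulusR w1 mulr1.
have rb := recenter_ball da z1.
have r0 : 0 < 1 - modulus z by rewrite subr_gt0.
pose e := (1 - modulus z) / 2; have e0 : 0 < e by rewrite divr_gt0.
have e1 : e < 1 - modulus z by rewrite ltr_pdivrMr// ltr_pMr// ltr1n.
have [K HK] := psum_quadratic e0 (rb e (introT andP (conj e0 e1))).
set b := recenter a z in HK.
have b0 : psum a z = b 0.
  by rewrite -[z in LHS]addr0 (psum_recenter_ball da) ?modulus0 ?addr0// psum0.
apply: (@is_derive_quadratic _ _ _ K (e / 2)); first by rewrite divr_gt0.
move=> k ke; rewrite -(recenter1 da z1) -/b.
have kw : modulus (k%:C%C * w) = `|k| by rewrite modulusM modulusR w1 mulr1.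
have zk : modulus z + modulus (k%:C%C * w) < 1 by rewrite kw; move: ke e1 e0; rewrite /e; lra.
have -> : (k + u)%:C%C * w = z + k%:C%C * w by rewrite rmorphD mulrDl addrC.
rewrite (psum_recenter_ball da zk) -/b b0.
have Rs : complex.Re (c * psum b (k%:C%C * w)) - complex.Re (c * b 0%N) - k * complex.Re (c * w * b 1%N) =
  complex.Re (c * (psum b (k%:C%C * w) - b 0 - b 1 * (k%:C%C * w))).
  case: c c1 => ? ? _; case: (psum b _) => ? ?; case: (b 0%N) => ? ?; case: (b 1%N) => ? ?.
  by case: w {w1 z z1 rb r0 e e0 e1 HK b b0 ke kw zk} => ? ? /=; ring.
rewrite Rs (le_trans (Re_le_modulus _))// modulusM c1 mul1r.
apply: (le_trans (HK _ _)); first by rewrite kw ltW.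
by rewrite kw real_normK ?num_real.
Qed.

(** The fundamental theorem of calculus along a radius, for the real part of
    [c f] where the unimodular [c] makes the increment real and nonnegative. *)
Lemma radial_increment a (r0 r t : R) : disc_coef a -> 0 < r0 -> r0 <= r < 1 ->
  ((modulus (psum a (pt r t) - psum a (pt r0 t)))%:E <=
    \int[mu]_(u in `[r0, r]) (r0^-1 * mdisc (theta a) (pt u t))%:E)%E.
Proof.
move=> da r00 /andP[]; rewrite le_eqVlt => /predU1P[<- _|r0r r1].
  rewrite subrr modulus0; apply: integral_ge0 => u _.
  by rewrite lee_fin mulr_ge0 ?mdisc_ge0// invr_ge0 ltW.
set D := psum a (pt r t) - psum a (pt r0 t).
have [D0|D0] := eqVneq (modulus D) 0.
  rewrite D0; apply: integral_ge0 => u _.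
  by rewrite lee_fin mulr_ge0 ?mdisc_ge0// invr_ge0 ltW.
(* the direction of the increment *)
pose c : R[i] := (D^*)%C / (modulus D)%:C%C.
have mD : 0 < modulus D by rewrite lt_neqAle eq_sym D0 modulus_ge0.
have c1 : modulus c = 1.
  rewrite /c modulusM modulusV modulusR ger0_norm ?modulus_ge0//.
  have -> : modulus (D^*)%C = modulus D by case: (D) => x y; rewrite /modulus/= sqrrN.
  by rewrite divff.
have cD : complex.Re (c * D) = modulus D.
  rewrite /c mulrAC.
  have -> : (D^*)%C * D = (modulus D ^+ 2)%:C%C.
    case: (D) => x y; rewrite /modulus/= sqr_sqrtr ?addr_ge0 ?sqr_ge0//.
    by apply/eqP; rewrite eq_complex/=; apply/andP; split; apply/eqP; ring.
  rewrite -[_ / _]/(_ * _) -fmorphV -rmorphM/= expr2 mulfK//.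
pose w := cis t : R[i].
have w1 : modulus w = 1 by exact: modulus_cis.
have dd : disc_coef (dcoef a) by exact: rad_ball_dcoef.
pose psi v := complex.Re (c * psum a (v%:C%C * w)).
pose dpsi v := complex.Re (c * w * psum (dcoef a) (v%:C%C * w)).
have dP u : r0 <= u <= r -> is_derive u 1 psi (dpsi u).
  move=> /andP[ru ur]; apply: psum_radial_derive => //.
  by rewrite ger0_norm ?(le_lt_trans ur)// (le_trans (ltW r00)).
have cpsi u : r0 <= u <= r -> {for u, continuous psi}.
  move=> ur; apply: differentiable_continuous; apply/derivable1_diffP.
  by have [] := dP u ur.
have cdpsi : {within `[r0, r], continuous dpsi}.
  apply: derivable_within_continuous => u; rewrite in_itv/= => /andP[ru ur].
  have u1 : `|u| < 1 by rewrite ger0_norm ?(le_lt_trans ur)// (le_trans (ltW r00)).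
  by have [] := psum_radial_derive dd w1 (c := c * w) _ u1 => //; rewrite modulusM c1 w1 mulr1.
have FTC : (\int[mu]_(u in `[r0, r]) (dpsi u)%:E = (modulus D)%:E)%E.
  rewrite (@continuous_FTC2 R dpsi psi r0 r r0r cdpsi).
  - have ReB (x y : R[i]) : complex.Re (x - y) = complex.Re x - complex.Re y.
      by case: x => ? ?; case: y.
    by rewrite -EFinB -cD /psi /D /pt mulrBr ReB.
  - split.
    + by move=> u; rewrite in_itv/= => /andP[ua ub]; have [] := dP u; rewrite ?(ltW ua) ?(ltW ub).
    + by apply: cvg_at_right_filter; apply: cpsi; rewrite lexx ltW.
    + by apply: cvg_at_left_filter; apply: cpsi; rewrite lexx ltW.
  - move=> u; rewrite in_itv/= => /andP[ua ub]; rewrite derive1E.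
    by have [] := dP u; rewrite ?(ltW ua) ?(ltW ub)// => _ ->.
have mdp : measurable_fun `[r0, r] dpsi by exact: subspace_continuous_measurable_fun.
have -> : ((modulus D)%:E = `|(modulus D)%:E|)%E by rewrite gee0_abs// lee_fin modulus_ge0.
rewrite -FTC; apply: (le_trans (le_abse_integral _ _ _)) => //; first exact/measurable_EFinP.
apply: ge0_le_integral => //.
- by apply/measurable_EFinP; apply: measurableT_comp.
- apply/measurable_EFinP; apply: measurable_funM => //.
  have := measurableT_comp (measurable_mdisc_pt (disc_coef_theta da)) (pair2_measurable t).
  exact: measurable_funTS.
- move=> u; rewrite /= in_itv/= => /andP[ru ur]; rewrite lee_fin.
  have u0 : 0 < u := lt_le_trans r00 ru.
  have u1 : 0 <= u < 1 by rewrite ltW//= (le_lt_trans ur).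
  have z1 : modulus (u%:C%C * w) < 1 by rewrite modulusM modulusR w1 mulr1 ger0_norm ?ltW//; case/andP: u1.
  rewrite mdisc_pt// /pt -/w psum_theta// 2!modulusM w1 mulr1 modulusR (ger0_norm (ltW u0)).
  rewrite (le_trans (Re_le_modulus _))// 2!modulusM c1 w1 !mul1r mulrA.
  by rewrite ler_peMl ?modulus_ge0// ler_pdivlMl// mulr1.
Qed.

(** Along each radius the increment of [f] is the integral of its derivative; Hoelder's
    inequality with the weight [(1 - u)^(-l)], [l = k / (q - 1)], has an integral of
    order [(1 - r)^(1 - l)] up to [r] because [k > q - 1]. Integrating over the circle exchanges the two integrals. *)
Lemma hardy (q k : R) : 1 < q -> q - 1 < k -> exists2 C : R, 0 < C & forall a r0 r,
  disc_coef a -> 2^-1 <= r0 -> r0 <= r < 1 ->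
  (circ q a r <= C%:E * (circ q a r0 + ((1 - r) `^ (q - 1 - k))%:E *
    \int[mu]_(u in `[r0, r]) (((1 - u) `^ k)%:E * circ q (theta a) u)))%E.
Proof.
move=> q1 kq; have q0 : 0 < q by exact: lt_trans q1.
have q10 : 0 < q - 1 by rewrite subr_gt0.
pose l := k / (q - 1); have l1 : 1 < l by rewrite ltr_pdivlMr// mul1r.
have l10 : 0 < l - 1 by rewrite subr_gt0.
pose B := (l - 1)^-1; have B0 : 0 < B by rewrite invr_gt0.
pose C2 := 2 `^ q * 2 `^ q * B `^ (q - 1).
have C20 : 0 < C2 by rewrite !mulr_gt0 ?powR_gt0.
pose C := 2 `^ q + C2; have C0 : 0 < C by rewrite addr_gt0 ?powR_gt0.
exists C => // a r0 r da r2 /andP[r0r r1].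
have r00 : 0 < r0 by rewrite (lt_le_trans _ r2)// invr_gt0.
have r10 : 0 < 1 - r by rewrite subr_gt0.
have dt := disc_coef_theta da.
have rr : 0 <= r < 1 by rewrite r1 andbT (le_trans (ltW r00)).
have rr0 : 0 <= r0 < 1 by rewrite (ltW r00)/= (le_lt_trans r0r).
pose m u t := mdisc (theta a) (pt u t).
have mmu t : measurable_fun setT (fun u => m u t).
  exact: (measurableT_comp (measurable_mdisc_pt dt) (pair2_measurable t)).
have m1u (e : R) : measurable_fun setT (fun u : R => (1 - u) `^ e).
  by apply: (measurableT_comp (measurable_powR _)); exact: measurable_funB.
pose J t := (\int[mu]_(u in `[r0, r]) ((1 - u) `^ k * m u t `^ q)%:E)%E.
have J0 t : (0 <= J t)%E by apply: integral_ge0 => u _; rewrite lee_fin mulr_ge0 ?powR_ge0.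
have pw t : ((mdisc a (pt r t) `^ q)%:E <=
   (2 `^ q * mdisc a (pt r0 t) `^ q)%:E + (C2 * (1 - r) `^ (q - 1 - k))%:E * J t)%E.
  have [Jy|Jf] := eqVneq (J t) +oo%E.
    by rewrite Jy gt0_muley ?leey// lte_fin mulr_gt0 ?powR_gt0.
  set D := modulus (psum a (pt r t) - psum a (pt r0 t)).
  have D0 : 0 <= D by exact: modulus_ge0.
  have inc := radial_increment t da r00 (introT andP (conj r0r r1)).
  have inc2 : ((2^-1 * D)%:E <= \int[mu]_(u in `[r0, r]) (m u t)%:E)%E.
    apply: (@le_trans _ _ ((2^-1)%:E * (2%:E * \int[mu]_(u in `[r0, r]) (m u t)%:E))%E); last first.
      by rewrite muleA -EFinM mulVf// mul1e.
    rewrite EFinM lee_wpmul2l ?lee_fin ?invr_ge0//; apply: (le_trans inc).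
    rewrite -ge0_integralZl//; last 2 first.
    - by apply/measurable_EFinP; apply: measurable_funTS; exact: mmu.
    - by move=> u _; rewrite lee_fin mdisc_ge0.
    apply: ge0_le_integral => //.
    - by move=> u _; rewrite lee_fin mulr_ge0 ?mdisc_ge0// invr_ge0 ltW.
    - by apply/measurable_EFinP; apply: measurable_funM => //; apply: measurable_funTS; exact: mmu.
    - by apply/measurable_EFinP; apply: measurable_funM => //; apply: measurable_funTS; exact: mmu.
    - move=> u _; rewrite -EFinM lee_fin ler_wpM2r ?mdisc_ge0//.
      by rewrite -[leRHS]invrK lef_pV2 ?posrE ?invr_gt0.
  pose W := B * (1 - r) `^ (1 - l).
  have W0 : 0 < W by rewrite mulr_gt0 ?powR_gt0.
  have u10 u : r0 <= u <= r -> 0 < 1 - u by move=> /andP[_ ur]; rewrite subr_gt0 (le_lt_trans ur).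
  pose h u := m u t * (1 - u) `^ l.
  have H : (((2^-1 * D) `^ q)%:E <= (W `^ (q - 1))%:E *
      \int[mu]_(u in `[r0, r]) ((1 - u) `^ (- l) * h u `^ q)%:E)%E.
    apply: (@hoelder_weight _ `[r0, r]%classic h (fun u => (1 - u) `^ (- l))) => //.
    - by apply: measurable_funTS; apply: measurable_funM.
    - by apply: measurable_funTS; exact: m1u.
    - by move=> u _; rewrite mulr_ge0 ?mdisc_ge0 ?powR_ge0.
    - by move=> u _; exact: powR_ge0.
    - by rewrite mulr_ge0// invr_ge0.
    - have N1 : (-1 : R) != 0 by rewrite oppr_eq0 oner_eq0.
      have l0 : 1 - l != 0 by rewrite lt_eqF// subr_lt0.
      have := @integral_powR_affine R 1 (-1) (1 - l) r0 r r0r N1 l0.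
      rewrite (_ : 1 - l - 1 = - l); last by ring.
      under eq_integral do rewrite mulN1r.
      move=> ->; last by move=> u ur; rewrite mulN1r u10.
      rewrite lee_fin !mulN1r opprB /W /B mulrC ler_wpM2l ?(ltW B0)//.
      by rewrite lerBlDr lerDl powR_ge0.
    - apply: (le_trans inc2); apply: ge0_le_integral => //.
      + by move=> u _; rewrite lee_fin mdisc_ge0.
      + by apply/measurable_EFinP; apply: measurable_funTS; exact: mmu.
      + apply/measurable_EFinP; apply: measurable_funTS; apply: measurable_funM.
          exact: m1u.
        by apply: measurable_funM; [exact: mmu|exact: m1u].
      + move=> u; rewrite /= in_itv/= => ur; rewrite lee_fin /h mulrCA -powRD; last first.
          by rewrite (gt_eqF (u10 u ur)) implybT.
        by rewrite addNr powRr0 mulr1.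
  have H2 : (((2^-1 * D) `^ q)%:E <= (W `^ (q - 1))%:E * J t)%E.
    rewrite /J; under [X in (_ <= _ * X)%E]eq_integral => u.
      rewrite inE/= in_itv/= => ur.
      have -> : (1 - u) `^ k * m u t `^ q = (1 - u) `^ (- l) * h u `^ q.
        rewrite /h powRM ?mdisc_ge0 ?powR_ge0// mulrCA -powRrM -powRD; last first.
          by rewrite (gt_eqF (u10 u ur)) implybT.
        rewrite mulrC; congr (_ * (_ `^ _)); rewrite /l; field.
        by rewrite gt_eqF.
      over.
    exact: H.
  have Jfin : J t \is a fin_num by rewrite ge0_fin_numE// ltey.
  move: H2; rewrite -(fineK Jfin) -!EFinM -EFinD !lee_fin; set j := fine _ => H2.
  have j0 : 0 <= j by apply: fine_ge0.
  apply: (@le_trans _ _ ((mdisc a (pt r0 t) + D) `^ q)).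
    rewrite ge0_ler_powR ?nnegrE ?mdisc_ge0 ?addr_ge0 ?(ltW q0) ?mdisc_ge0//.
    rewrite !mdisc_pt// -lerBlDl; exact: lerB_modulus.
  apply: (le_trans (powRD_le q0 (mdisc_ge0 _ _) D0)).
  rewrite mulrDr lerD2l.
  have -> : D = 2 * (2^-1 * D) by rewrite mulrA divff ?mul1r.
  rewrite [(2 * _) `^ q]powRM ?mulr_ge0 ?invr_ge0//.
  have WE : W `^ (q - 1) = B `^ (q - 1) * (1 - r) `^ (q - 1 - k).
    rewrite /W powRM ?powR_ge0 ?(ltW B0)// -powRrM; congr (_ * _ `^ _).
    by rewrite /l; field; rewrite gt_eqF.
  rewrite WE in H2; rewrite /C2 -!mulrA; do 2 rewrite ler_wpM2l ?powR_ge0//.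
  by rewrite (le_trans H2)// -mulrA.
pose F (v : R * R) := (((1 - v.2) `^ k * m v.2 v.1 `^ q)%:E)%E.
have mF : measurable_fun setT F.
  apply/measurable_EFinP; apply: measurable_funM.
    by apply: (measurableT_comp (m1u k)); exact: measurable_snd.
  apply: (measurableT_comp (measurable_powR _)).
  have -> : (fun v : R * R => m v.2 v.1) = (fun v : R * R => mdisc (theta a) (pt v.1 v.2)) \o
     (fun v : R * R => (v.2, v.1)) by [].
  apply: measurableT_comp; first exact: measurable_mdisc_pt.
  by apply/measurable_fun_pair; [exact: measurable_snd|exact: measurable_fst].
have F0 v : (0 <= F v)%E by rewrite lee_fin mulr_ge0 ?powR_ge0.
have mJ : measurable_fun setT J by exact: (measurable_integral_snd (f := F)).
have TJ : (\int[mu]_(t in `[0%R, (2 * pi)%R]) J t =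
   \int[mu]_(u in `[r0, r]) (((1 - u) `^ k)%:E * circ q (theta a) u))%E.
  rewrite (@tonelli _ F)//; apply: eq_integral => u _; rewrite -ge0_integralZl//.
  - by apply: measurable_funTS; exact: measurable_mdisc_ptrp.
  - by move=> t _; rewrite lee_fin powR_ge0.
  - by rewrite lee_fin powR_ge0.
apply: (@le_trans _ _ ((2 `^ q)%:E * circ q a r0 + (C2 * (1 - r) `^ (q - 1 - k))%:E *
   \int[mu]_(t in `[0%R, (2 * pi)%R]) J t)%E).
  pose A0 t := (mdisc a (pt r0 t) `^ q)%:E; pose A1 t := (mdisc a (pt r t) `^ q)%:E.
  have mA0 : measurable_fun `[0, 2 * pi] A0.
    by apply: measurable_funTS; exact: measurable_mdisc_ptrp.
  have mA1 : measurable_fun `[0, 2 * pi] A1.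
    by apply: measurable_funTS; exact: measurable_mdisc_ptrp.
  have A00 t : (0 <= A0 t)%E by rewrite lee_fin powR_ge0.
  have A10 t : (0 <= A1 t)%E by rewrite lee_fin powR_ge0.
  have mJ' : measurable_fun `[0, 2 * pi] J by exact: measurable_funTS.
  have pw' t : (A1 t <= (2 `^ q)%:E * A0 t + (C2 * (1 - r) `^ (q - 1 - k))%:E * J t)%E.
    by rewrite -EFinM; exact: pw.
  have c1 : (0 <= (2 `^ q : R)%:E)%E by rewrite lee_fin powR_ge0.
  have c2 : (0 <= (C2 * (1 - r) `^ (q - 1 - k))%:E)%E.
    by rewrite lee_fin mulr_ge0 ?powR_ge0// ltW.
  have -> : circ q a r = (\int[mu]_(t in `[0%R, (2 * pi)%R]) A1 t)%E by [].
  have -> : circ q a r0 = (\int[mu]_(t in `[0%R, (2 * pi)%R]) A0 t)%E by [].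
  move: (2 `^ q)%:E c1 (_%:E) c2 pw' => x1 x10 x2 x20 pw'.
  move: A0 A1 J mA0 mA1 A00 A10 mJ' J0 pw' {mJ TJ pw} => A0 A1 J1 mA0 mA1 A00 A10 mJ1 J10 pw'.
  rewrite -[X in (_ <= X + _)%E]ge0_integralZl// -[X in (_ <= _ + X)%E]ge0_integralZl//.
  rewrite -ge0_integralD//; last 4 first.
  - by move=> t _; rewrite mule_ge0.
  - exact: emeasurable_funM.
  - by move=> t _; rewrite mule_ge0.
  - exact: emeasurable_funM.
  apply: ge0_le_integral => //.
  by apply: emeasurable_funD; exact: emeasurable_funM.
have P0 : 0 <= (1 - r) `^ (q - 1 - k) by exact: powR_ge0.
have Y0 : (0 <= \int[mu]_(u in `[r0, r]) (((1 - u) `^ k)%:E * circ q (theta a) u))%E.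
  by apply: integral_ge0 => u _; rewrite mule_ge0 ?circ_ge0// lee_fin powR_ge0.
have X0 := circ_ge0 q a r0.
rewrite TJ; move: (circ q a r0) (integral _ _ _) X0 Y0 => X Y X0 Y0.
rewrite ge0_muleDr ?mule_ge0//; apply: leeD.
  by rewrite lee_wpmul2r// lee_fin lerDl ltW.
rewrite EFinM -muleA lee_wpmul2r// ?mule_ge0// ?lee_fin// lerDr powR_ge0//.
Qed.

End Hardy.

(** * Tonelli on regions and choice of a radius *)

Section PowerInequalities.
Context {R : realType}.
Implicit Types (q x y : R).

Lemma powR_root_le q x y : 0 < q -> 0 <= x -> x `^ q <= y -> x <= y `^ q^-1.
Proof.
move=> q0 x0 xy; have -> : x = (x `^ q) `^ q^-1.
  by rewrite -powRrM mulfV ?gt_eqF// powRr1.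
by rewrite ge0_ler_powR ?nnegrE ?invr_ge0 ?(ltW q0) ?powR_ge0// (le_trans (powR_ge0 _ _) xy).
Qed.

Lemma powR_le_inv q x y : 0 < q -> 0 <= x -> 0 <= y -> x `^ q <= y `^ q -> x <= y.
Proof.
move=> q0 x0 y0 /(powR_root_le q0 x0).
by rewrite -powRrM mulfV ?gt_eqF// powRr1.
Qed.

Lemma powR_neg_le q x y : q <= 0 -> 0 < x -> x <= y -> y `^ q <= x `^ q.
Proof.
move=> q0 x0 xy; have y0 : 0 < y by exact: lt_le_trans xy.
rewrite -[q]opprK !(powRN _ (- q)) lef_pV2 ?posrE ?powR_gt0//.
by rewrite ge0_ler_powR ?nnegrE ?oppr_ge0 ?(ltW x0) ?(ltW y0).
Qed.

End PowerInequalities.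

Section RegionIntegrals.
Context {R : realType}.
Local Notation mu := (@lebesgue_measure R).
Local Open Scope ereal_scope.

Lemma tonelli_region (K1 K2 : R -> \bar R) (A B : set R) (W : set (R * R)) :
  measurable A -> measurable B -> measurable W ->
  measurable_fun setT K1 -> measurable_fun setT K2 ->
  (forall x, 0 <= K1 x) -> (forall x, 0 <= K2 x) ->
  \int[mu]_(x in A) (K1 x * \int[mu]_(y in B `&` [set y | W (x, y)]) K2 y) =
  \int[mu]_(y in B) (K2 y * \int[mu]_(x in A `&` [set x | W (x, y)]) K1 x).
Proof.
move=> mA mB mW m1 m2 p1 p2.
pose f := (fun v : R * R => K1 v.1 * K2 v.2) \_ W.
have mf : measurable_fun setT f.
  apply/(measurable_restrictT (fun v : R * R => K1 v.1 * K2 v.2)) => //.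
  apply: measurable_funTS; by apply: emeasurable_funM; [exact: (measurableT_comp m1)|exact: (measurableT_comp m2)].
have f0 v : 0 <= f v by rewrite /f patchE; case: ifPn => // _; rewrite mule_ge0.
have mWx x : measurable [set y | W (x, y)].
  by rewrite (_ : [set y | _] = xsection W x); [exact: measurable_xsection|exact/esym/xsectionE].
have mWy y : measurable [set x | W (x, y)].
  by rewrite (_ : [set x | _] = ysection W y); [exact: measurable_ysection|exact/esym/ysectionE].
transitivity (\int[mu]_(x in A) \int[mu]_(y in B) f (x, y)).
  apply: eq_integral => x _; rewrite -ge0_integralZl//; last 2 first.
  - exact: (measurableI _ _ mB (mWx x)).
  - exact: measurable_funTS.
  rewrite integral_mkcondr; apply: eq_integral => y _; rewrite /f !patchE/=.
  by congr (if _ then _ else _); apply/idP/idP; rewrite !inE.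
rewrite (tonelli mA mB mf f0); apply: eq_integral => y _.
rewrite -ge0_integralZl//; last 2 first.
- exact: (measurableI _ _ mA (mWy y)).
- exact: measurable_funTS.
rewrite integral_mkcondr; apply: eq_integral => x _; rewrite /f !patchE/= muleC.
by congr (if _ then _ else _); apply/idP/idP; rewrite !inE.
Qed.

Lemma measurable_region_integral (K : R -> \bar R) (B : set R) (W : set (R * R)) :
  measurable B -> measurable W -> measurable_fun setT K -> (forall x, 0 <= K x) ->
  measurable_fun setT (fun x => \int[mu]_(y in B `&` [set y | W (x, y)]) K y).
Proof.
move=> mB mW mK K0.
pose f := (fun v : R * R => K v.2) \_ W.
have mf : measurable_fun setT f.
  apply/(measurable_restrictT (fun v : R * R => K v.2)) => //.
  by apply: measurable_funTS; exact: (measurableT_comp mK).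
have f0 v : 0 <= f v by rewrite /f patchE; case: ifPn.
rewrite (_ : (fun x => _) = (fun x => \int[mu]_(y in B) f (x, y))).
  exact: measurable_integral_snd.
apply/funext => x; rewrite integral_mkcondr; apply: eq_integral => y _.
by rewrite /f !patchE/=; congr (if _ then _ else _); apply/idP/idP; rewrite !inE.
Qed.

(** Monotone convergence: it suffices to bound the integrals over [u, rho]. *)
Lemma integral_co_le (f : R -> \bar R) (u c : R) : (u < 1)%R -> measurable_fun setT f ->
  (forall x, 0 <= f x) ->
  (forall rho : R, (u <= rho < 1)%R -> \int[mu]_(x in `[u, rho]) f x <= c%:E) ->
  \int[mu]_(x in `[u, 1%R[) f x <= c%:E.
Proof.
move=> u1 mf f0 H.
pose rho (n : nat) : R := (1 - (1 - u) / n.+1%:R)%R.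
have u10 : (0 < 1 - u)%R by rewrite subr_gt0.
have rhoP n : (u <= rho n < 1)%R.
  rewrite /rho ltrBlDr ltrDl divr_gt0// andbT lerBrDr -lerBrDl ler_pdivrMr//.
  by rewrite ler_peMr ?(ltW u10)// ler1n.
have -> : `[u, 1%R[%classic = \bigcup_n `[u, rho n]%classic.
  apply/seteqP; split => x /=; rewrite in_itv/=.
    move=> /andP[ux x1]; have x10 : (0 < 1 - x)%R by rewrite subr_gt0.
    exists (Num.truncn ((1 - u) / (1 - x))) => //=; rewrite in_itv/= ux/=.
    rewrite /rho lerBrDr -lerBrDl ler_pdivrMr// -ler_pdivrMl// mulrC.
    exact/ltW/truncnS_gt.
  move=> [n _]; rewrite /= in_itv/= => /andP[-> xr]/=.
  by have /andP[_] := rhoP n; exact: le_lt_trans.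
have ndr : nondecreasing_seq (fun n => `[u, rho n]%classic).
  move=> m n mn; rewrite subsetEset => x /=; rewrite !in_itv/= => /andP[-> xm]/=.
  rewrite (le_trans xm)// lerB// ler_wpM2l ?(ltW u10)// lef_pV2 ?posrE//.
  by rewrite ler_nat.
have cv := @ge0_nondecreasing_set_cvg_integral _ (measurableTypeR R) R
  (fun n => `[u, rho n]%classic) f mu ndr.
apply: (cvge_le _ (cv _ _ _)) => //.
- by apply: nearW => n; exact: H.
- by move=> i; exact: measurable_funTS.
Qed.

(** A function exceeding [c] everywhere would have a larger integral. *)
Lemma exists_le_mean (f : R -> \bar R) (a b c : R) : (a <= b)%R -> (0 <= c)%R ->
  measurable_fun setT f -> (forall x, 0 <= f x) ->
  \int[mu]_(x in `[a, b]) f x < (c * (b - a))%:E ->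
  exists2 s : R, (a <= s <= b)%R & f s <= c%:E.
Proof.
move=> ab c0 mf f0 H; apply: contrapT => K.
have : \int[mu]_(x in `[a, b]) (cst c%:E) x <= \int[mu]_(x in `[a, b]) f x.
  apply: ge0_le_integral => //; first exact: measurable_funTS.
  move=> x; rewrite /= in_itv/= => xab; rewrite leNgt; apply/negP => /ltW fc.
  by apply: K; exists x.
rewrite integral_cst//= lebesgue_measure_itv/= lte_fin.
case: ifPn => ab'; first by rewrite -EFinB -EFinM leNgt H.
move: H; have -> : b = a by apply/eqP; rewrite eq_le ab leNgt ab'.
rewrite subrr mulr0 => H _; move: H; rewrite ltNge integral_ge0//.
Qed.

Lemma subset_integral_le (A B : set R) (f : R -> \bar R) : measurable A -> measurable B ->
  measurable_fun setT f -> (forall x, 0 <= f x) -> A `<=` B ->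
  \int[mu]_(x in A) f x <= \int[mu]_(x in B) f x.
Proof.
by move=> mA mB mf f0 AB; apply: ge0_subset_integral => //; exact: measurable_funTS.
Qed.

End RegionIntegrals.

(** * Bounds for the partial sums *)

Section CoefficientBounds.
Context {R : realType}.
Local Notation mu := (@lebesgue_measure R).
Implicit Types (a g : nat -> R[i]) (z w : R[i]) (p q r s : R).

Definition monomial k (n : nat) : R[i] := (n == k)%:R.

Lemma psum_monomial (c : R[i]) k z : psum (fun n => monomial k n * c) z = c * z ^+ k.
Proof.
apply: psum_eq; rewrite /power_sum_at.
apply: cvg_near_cst; exists k.+1 => // n /= kn; rewrite series_nat.
rewrite (bigD1 (Ordinal kn))//= big1 => [|i ik].
  by rewrite /monomial eqxx mul1r addr0.
rewrite /monomial (_ : (i == k :> nat) = false) ?mul0r//.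
by apply: contraNF ik => /eqP ik; apply/eqP/val_inj.
Qed.

Lemma disc_coef_monomial k : disc_coef (monomial k).
Proof.
move=> s /andP[s0 s1]; exists 1 => n; rewrite /monomial modulus_nat.
by rewrite mulr_ile1 ?ler0n ?exprn_ge0 ?exprn_ile1 ?(ltW s0) ?(ltW s1)//; case: eqP.
Qed.

Lemma circ_monomial q (c : R[i]) k r : 0 < q -> 0 <= r < 1 ->
  circ q (fun n => monomial k n * c) r = (2 * pi * (modulus c * r ^+ k) `^ q)%:E.
Proof.
move=> q0 r01; rewrite /circ.
under eq_integral => t _ do rewrite mdisc_pt// psum_monomial modulusM modulusX modulus_pt.
rewrite integral_cst//= mu_circle -EFinM ger0_norm; last by case/andP: r01.
by rewrite mulrC.
Qed.

(** [young_circ] with a monomial for [g]. *)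
Lemma coef_le_circ1 a s k (L : R) : disc_coef a -> 0 <= s < 1 -> 0 < L ->
  (circ 1 a s <= L%:E)%E -> modulus (a k) * s ^+ k <= 4 * L.
Proof.
move=> da s01 L0 HL; have [s0 s1] := andP s01.
have L4 : 0 < 4 * L by rewrite mulr_gt0.
have h01 : 0 <= (2^-1 : R) < 1 by rewrite invr_ge0 ler0n/= invf_lt1// ltr1n.
have hs01 : 0 <= (2^-1 : R) * s < 1.
  by rewrite mulr_ge0 ?invr_ge0//= mulr_ilt1// ?invr_ge0//; case/andP: h01.
have q1 : 1 < (2 : R) by rewrite ltr1n.
have := young_circ q1 (disc_coef_monomial k) da h01 s01 L0 HL.
have E1 : (fun n => monomial k n * 1) = monomial k by apply/funext => n; rewrite mulr1.
have E2 : (fun n => monomial k n * a n) = (fun n => monomial k n * a k).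
  apply/funext => n; rewrite /monomial.
  by case: eqP => [->//|_]; rewrite !mul0r.
rewrite E2 circ_monomial// -E1 circ_monomial// -EFinM lee_fin modulus1 mul1r mulrCA ler_pM2l ?mulr_gt0 ?pi_gt0//.
have X0 : 0 <= modulus (a k) * (2^-1 * s) ^+ k.
  by rewrite mulr_ge0 ?modulus_ge0 ?exprn_ge0 ?mulr_ge0 ?invr_ge0.
have Y0 : 0 <= (2^-1 : R) ^+ k by rewrite exprn_ge0 ?invr_ge0.
rewrite -powRM ?(ltW L4)//.
move=> H.
have {H} := powR_le_inv (lt_trans ltr01 q1) X0 (mulr_ge0 (ltW L4) Y0) H.
rewrite exprMn mulrCA mulrC ler_pM2r//.
Qed.

(** Choose a radius [s] between [rho] and [(1 + rho)/2] where [circ p a s] is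
    controlled by its mean, and bound the coefficients of [f / (1 - z)] there. *)
Lemma partial_sum_bound p (rho : R) : 1 < p -> 2^-1 <= rho < 1 -> exists2 C : R, 0 < C &
  forall a (Phi : R), disc_coef a -> 0 < Phi -> (berg p a <= Phi%:E)%E ->
  forall k, modulus (partial_sum a k) * rho ^+ k <= C * Phi `^ p^-1.
Proof.
move=> p1 /andP[rho2 rho1]; have p0 : 0 < p by exact: lt_trans p1.
have [C1 C10 HC1] := circ1_partial_sum p1.
have rho10 : 0 < 1 - rho by rewrite subr_gt0.
have rho0 : 0 < rho by rewrite (lt_le_trans _ rho2)// invr_gt0.
pose b := (1 + rho) / 2.
have b1 : b < 1 by rewrite /b; lra.
have rb : rho < b by rewrite /b; lra.
pose c := 5 / (1 - rho); have c0 : 0 < c by rewrite divr_gt0.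
pose K := C1 * (2 / (1 - rho)) * c.
have K0 : 0 < K by rewrite !mulr_gt0// invr_gt0.
exists (4 * K `^ p^-1); first by rewrite mulr_gt0 ?powR_gt0.
move=> a Phi da Phi0 HPhi k.
have mc := measurable_circ p da.
have [s /andP[s1 s2] Hs] : exists2 s : R, rho <= s <= b & (circ p a s <= (c * Phi)%:E)%E.
  apply: exists_le_mean => //; [exact: ltW| by rewrite mulr_ge0// ltW|exact: circ_ge0|].
  apply: (@le_lt_trans _ _ ((2 * Phi)%:E)); last first.
    rewrite lte_fin /c /b.
    have -> : 5 / (1 - rho) * Phi * ((1 + rho) / 2 - rho) = 5 / 2 * Phi.
      by field; rewrite gt_eqF.
    by move: Phi0; lra.
  apply: (@le_trans _ _ (2%:E * berg p a)%E); last by rewrite EFinM lee_wpmul2l// lee_fin.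
  apply: (@le_trans _ _ (2%:E * \int[mu]_(r in `[rho, b]) (r%:E * circ p a r))%E); last first.
    rewrite lee_wpmul2l ?lee_fin//; apply: ge0_subset_integral => //.
    - by apply: measurable_funTS; apply: emeasurable_funM => //.
    - by move=> r; rewrite /= in_itv/= => /andP[r0 _]; rewrite mule_ge0 ?circ_ge0// lee_fin ltW.
    - by move=> r; rewrite /= !in_itv/= => /andP[? ?]; apply/andP; split; lra.
  rewrite -ge0_integralZl//; last 2 first.
  - by apply: measurable_funTS; apply: emeasurable_funM => //.
  - move=> r; rewrite /= in_itv/= => /andP[r0 _]; rewrite mule_ge0 ?circ_ge0// lee_fin.
    by rewrite (le_trans _ r0)// ltW.
  apply: ge0_le_integral => //.
  - by move=> r _; exact: circ_ge0.
  - exact: measurable_funTS.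
  - by apply: measurable_funTS; apply: emeasurable_funM => //; apply: emeasurable_funM.
  - move=> r; rewrite /= in_itv/= => /andP[r0 _]; rewrite muleA -EFinM.
    rewrite -[leLHS]mul1e lee_wpmul2r ?circ_ge0// lee_fin; lra.
have s0 : 0 < s by exact: lt_le_trans s1.
have s11 : s < 1 by exact: le_lt_trans b1.
have s01 : 0 <= s < 1 by rewrite ltW.
have s10 : 0 < 1 - s by rewrite subr_gt0.
have dA := disc_coef_partial_sum da.
have cf : circ 1 (partial_sum a) s \is a fin_num by exact: circ_fin.
have := HC1 a s da s01; move: (cf); set f := fine _ => _ Hf.
have f0 : 0 <= f by apply: fine_ge0; exact: circ_ge0.
have HfK : f `^ p <= K * Phi.
  rewrite -lee_fin; apply: (le_trans Hf).
  apply: (@le_trans _ _ ((C1 * (1 - s)^-1)%:E * (c * Phi)%:E)%E).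
    by rewrite lee_wpmul2l// lee_fin mulr_ge0 ?invr_ge0 ?(ltW C10) ?(ltW s10).
  have sr : (1 - s)^-1 <= 2 / (1 - rho).
    rewrite -[leRHS]invrK lef_pV2 ?posrE ?invr_gt0 ?divr_gt0// invf_div.
    by move: s2; rewrite /b; lra.
  rewrite -EFinM lee_fin /K -[leRHS]mulrA ler_wpM2r ?ler_wpM2l ?(ltW C10)//.
  exact: mulr_ge0 (ltW c0) (ltW Phi0).
pose L := (K * Phi) `^ p^-1.
have KP0 : 0 < K * Phi by rewrite mulr_gt0.
have L0 : 0 < L by rewrite powR_gt0.
have fL : f <= L by exact: powR_root_le.
have HL : (circ 1 (partial_sum a) s <= L%:E)%E by rewrite -(fineK cf) lee_fin.
apply: (@le_trans _ _ (modulus (partial_sum a k) * s ^+ k)).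
  rewrite ler_wpM2l ?modulus_ge0//; apply: lerXn2r; rewrite ?nnegrE//; exact/ltW.
rewrite (le_trans (coef_le_circ1 k dA s01 L0 HL))// /L powRM ?(ltW K0) ?(ltW Phi0)//.
by rewrite mulrA.
Qed.

End CoefficientBounds.

(** * The local estimate *)

Section MainEstimate.
Context {R : realType}.
Local Notation mu := (@lebesgue_measure R).
Implicit Types (a g : nat -> R[i]) (z w : R[i]) (p q r s u : R).

(** Coefficients of [R_g f] when [f = psum a]. *)
Definition rhaly_coef g a (n : nat) : R[i] := g n * partial_sum a n.

Lemma theta_rhaly_coef g a : theta (rhaly_coef g a) = (fun n => theta g n * partial_sum a n).
Proof. by apply/funext => n; rewrite /theta /rhaly_coef mulrA. Qed.

Lemma disc_coef_rhaly g a : disc_coef g -> disc_coef a -> disc_coef (rhaly_coef g a).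
Proof. by move=> dg da; apply: disc_coefM => //; exact: disc_coef_partial_sum. Qed.

Definition window u : set R := `[1 - (1 - u) / 2, 1 - (1 - u) / 4].

Lemma mu_window u : u < 1 -> mu (window u) = ((1 - u) / 4)%:E.
Proof.
move=> u1; rewrite /window lebesgue_measure_itv/= lte_fin ifT; last by lra.
by rewrite -EFinB; congr _%:E; field.
Qed.

Lemma outer_berg p a (Phi : R) : disc_coef a -> 0 < Phi -> (berg p a <= Phi%:E)%E ->
  (\int[mu]_(s in `[2^-1%R, 1%R[) (circ p a s + Phi%:E) <= (3 * Phi)%:E)%E.
Proof.
move=> da Phi0 HPhi.
have mc := measurable_circ p da.
rewrite ge0_integralD//; last 3 first.
- by move=> s _; exact: circ_ge0.
- exact: measurable_funTS.
- by move=> s _; rewrite lee_fin ltW.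
have -> : 3 * Phi = 2 * Phi + Phi by ring.
rewrite EFinD leeD//; last first.
  rewrite integral_cst//= lebesgue_measure_itv/= lte_fin ifT; last by lra.
  by rewrite -EFinB -EFinM lee_fin -[leRHS]mulr1 ler_wpM2l ?(ltW Phi0)//; lra.
apply: (@le_trans _ _ (2%:E * berg p a)%E); last by rewrite EFinM lee_wpmul2l// lee_fin.
rewrite /berg -ge0_integralZl//; last 2 first.
- by apply: measurable_funTS; apply: emeasurable_funM => //.
- by move=> r; rewrite /= in_itv/= => /andP[? _]; rewrite mule_ge0 ?circ_ge0// lee_fin ltW.
apply: (@le_trans _ _ (\int[mu]_(s in `[2^-1%R, 1%R[) (2%:E * (s%:E * circ p a s)))%E).
  apply: ge0_le_integral => //.
  - by move=> s _; exact: circ_ge0.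
  - exact: measurable_funTS.
  - by apply: measurable_funTS; apply: emeasurable_funM => //; apply: emeasurable_funM.
  - move=> s; rewrite /= in_itv/= => /andP[s1 s2]; rewrite muleA -EFinM.
    rewrite -[leLHS]mul1e lee_wpmul2r ?circ_ge0// lee_fin; lra.
apply: ge0_subset_integral => //.
- by apply: measurable_funTS; apply: emeasurable_funM => //; apply: emeasurable_funM.
- move=> s; rewrite /= in_itv/= => /andP[? _]; rewrite mule_ge0// mule_ge0 ?circ_ge0// lee_fin ltW//.
- by move=> s; rewrite /= !in_itv/= => /andP[s1 ->]; rewrite andbT; lra.
Qed.

Lemma window_berg p a (Phi : R) u : disc_coef a -> 0 < Phi -> (berg p a <= Phi%:E)%E ->
  2^-1 <= u < 1 -> (\int[mu]_(s in window u) (circ p a s + Phi%:E) <= (3 * Phi)%:E)%E.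
Proof.
move=> da Phi0 HPhi /andP[u2 u1]; apply: le_trans (outer_berg da Phi0 HPhi).
have mc := measurable_circ p da.
apply: subset_integral_le => //.
- exact: measurable_itv.
- exact: emeasurable_funD.
- by move=> s; rewrite adde_ge0 ?circ_ge0// lee_fin ltW.
- by move=> s; rewrite /window /= !in_itv/= => /andP[s1 s2]; apply/andP; split; lra.
Qed.

(** In the window, [circ p a] plus the constant [Phi] has a finite positive mean, so
    that some [s] makes it at most twice this mean. Young's inequality at the radii
    [u / s] and [s] then applies, since [1 - u/s >= (1 - u)/2]. The power [q / p] of the
    integral over the window is one factor of it times [Phi^(q/p - 1)], because [p < q].
    Adding [Phi] avoids the case of a vanishing function. *)
Lemma local_estimate p q : 1 < p -> p < q -> 2 / p - q^-1 < 1 -> exists2 C : R, 0 < C &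
  forall g a (kap Phi r0 u : R), disc_coef g -> disc_coef a ->
  0 <= kap -> 0 < Phi -> (berg p a <= Phi%:E)%E -> 2^-1 <= r0 -> r0 <= u < 1 ->
  (forall r, r0 <= r < 1 -> (circ q (theta g) r <= (kap * (1 - r) `^ ((2 / p - q^-1 - 1) * q))%:E)%E) ->
  (circ q (theta (rhaly_coef g a)) u <=
    (C * kap * Phi `^ (q / p - 1) * (1 - u) `^ (- q - 1))%:E *
    \int[mu]_(s in window u) (circ p a s + Phi%:E))%E.
Proof.
move=> p1 pq al1; have p0 : 0 < p by exact: lt_trans p1.
have q1 : 1 < q by exact: lt_trans pq.
have q0 : 0 < q by exact: lt_trans q1.
have [C1 C10 HC1] := circ1_partial_sum p1.
set be := (2 / p - q^-1 - 1) * q.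
pose C := 4 `^ q * (32 * C1) `^ (q / p) * 3 `^ (q / p - 1) * 2^-1 `^ be.
have C0 : 0 < C by rewrite /C !mulr_gt0 ?powR_gt0// ?mulr_gt0 ?invr_gt0.
exists C => // g a kap Phi r0 u dg da kap0 Phi0 HPhi r02 /andP[r0u u1] Hk.
have u2 : 2^-1 <= u by exact: le_trans r0u.
have u0 : 0 < u by rewrite (lt_le_trans _ u2)// invr_gt0.
have u10 : 0 < 1 - u by rewrite subr_gt0.
have mc := measurable_circ p da.
have mw : measurable (window u) by exact: measurable_itv.
pose N s := (circ p a s + Phi%:E)%E.
have mN : measurable_fun setT N by apply: emeasurable_funD.
have N0 s : (0 <= N s)%E by rewrite /N adde_ge0 ?circ_ge0// lee_fin ltW.
have I3 := window_berg da Phi0 HPhi (introT andP (conj u2 u1)).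
rewrite -/(N _) in I3.
have [I IE] : exists I : R, (\int[mu]_(s in window u) N s = I%:E)%E.
  have : (0 <= \int[mu]_(s in window u) N s)%E by exact: integral_ge0.
  move: I3; rewrite /N; case: (integral _ _ _) => [I _ _|//|//]; by exists I.
rewrite IE; rewrite IE lee_fin in I3.
have Ipos : 0 < I.
  have : ((Phi * ((1 - u) / 4))%:E <= I%:E)%E.
    rewrite -IE; apply: (@le_trans _ _ (\int[mu]_(s in window u) (cst Phi%:E) s)%E).
      by rewrite integral_cst//= mu_window.
    apply: ge0_le_integral => //; first by move=> s _; rewrite lee_fin ltW.
    - exact: measurable_funTS.
    - by move=> s _; rewrite /N leeDr// circ_ge0.
  by rewrite lee_fin; apply: lt_le_trans; rewrite mulr_gt0// divr_gt0.
(* the window has length (1 - u)/4, so that c is twice the mean *)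
pose c := 8 * I / (1 - u).
have c0 : 0 < c by rewrite divr_gt0// mulr_gt0.
have ab : 1 - (1 - u) / 2 <= 1 - (1 - u) / 4 by lra.
have [s /andP[s1 s2] Hs] : exists2 s : R, 1 - (1 - u) / 2 <= s <= 1 - (1 - u) / 4 & (N s <= c%:E)%E.
  apply: exists_le_mean => //; first exact: ltW.
  rewrite -/(window u) IE lte_fin /c.
  rewrite (_ : 1 - (1 - u) / 4 - (1 - (1 - u) / 2) = (1 - u) / 4); last by field.
  rewrite (_ : _ * _ = 2 * I); last by field; rewrite gt_eqF.
  by move: Ipos; lra.
have s0 : 0 < s by lra.
have s11 : s < 1 by lra.
have s01 : 0 <= s < 1 by rewrite ltW.
have s10 : 0 < 1 - s by rewrite subr_gt0.
have dA := disc_coef_partial_sum da.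
have cf : circ 1 (partial_sum a) s \is a fin_num by exact: circ_fin.
have := HC1 a s da s01; move: (cf); set f := fine _ => _ Hf.
have f0 : 0 <= f by apply: fine_ge0; exact: circ_ge0.
pose K := 32 * C1 * I * (1 - u) `^ (-2).
have C1I : 0 < 32 * C1 * I by rewrite !mulr_gt0.
have K0 : 0 < K by rewrite mulr_gt0 ?powR_gt0.
have HfK : f `^ p <= K.
  rewrite -lee_fin; apply: (le_trans Hf).
  apply: (@le_trans _ _ ((C1 * (1 - s)^-1)%:E * c%:E)%E).
    rewrite lee_wpmul2l ?lee_fin ?mulr_ge0 ?invr_ge0 ?(ltW C10) ?(ltW s10)//.
    by apply: le_trans Hs; rewrite /N leeDl// lee_fin ltW.
  have sr : (1 - s)^-1 <= 4 / (1 - u).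
    rewrite -[leRHS]invrK lef_pV2 ?posrE ?invr_gt0 ?divr_gt0// invf_div; lra.
  rewrite -EFinM lee_fin /K.
  have -> : 32 * C1 * I * (1 - u) `^ (-2) = C1 * (4 / (1 - u)) * c.
    rewrite powRN /c (_ : 2 = 2%:R :> R)// powR_mulrn ?(ltW u10)//; field.
    by rewrite gt_eqF.
  by rewrite ler_wpM2r ?(ltW c0)// ler_wpM2l// ltW.
pose L := K `^ p^-1.
have L0 : 0 < L by rewrite powR_gt0.
have fL : f <= L by exact: powR_root_le.
have HL : (circ 1 (partial_sum a) s <= L%:E)%E by rewrite -(fineK cf) lee_fin.
have us : u < s by lra.
have r01 : 0 <= u / s < 1.
  by rewrite divr_ge0 ?(ltW u0) ?(ltW s0)//= ltr_pdivrMr// mul1r.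
have uus : u <= u / s by rewrite ler_pdivlMr// ler_piMr ?(ltW u0)// ltW.
have := young_circ q1 (disc_coef_theta dg) dA r01 s01 L0 HL.
rewrite divfK ?gt_eqF// -theta_rhaly_coef => H; apply: (le_trans H).
have r0us : r0 <= u / s < 1 by rewrite (le_trans r0u uus); case/andP: r01.
apply: (@le_trans _ _ (((4 * L) `^ q)%:E * (kap * (1 - u / s) `^ be)%:E)%E).
  by rewrite lee_wpmul2l ?lee_fin ?powR_ge0//; exact: Hk.
have us2 : (1 - u) / 2 <= 1 - u / s.
  have -> : 1 - u / s = (s - u) / s by field; rewrite gt_eqF.
  by rewrite ler_pdivlMr//; move: s1 s11 u10; nra.
have be0 : be <= 0 by rewrite /be nmulr_rle0 ?subr_lt0 ?(ltW q0).
have hk : (1 - u / s) `^ be <= (1 - u) `^ be * 2^-1 `^ be.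
  rewrite -powRM ?invr_ge0 ?(ltW u10)//; apply: powR_neg_le => //; by rewrite divr_gt0.
have qp : 0 < q / p by rewrite divr_gt0.
have qp1 : 0 <= q / p - 1 by rewrite subr_ge0 ler_pdivlMr// mul1r ltW.
have Iq : I `^ (q / p) <= I * (3 `^ (q / p - 1) * Phi `^ (q / p - 1)).
  have -> : I `^ (q / p) = I * I `^ (q / p - 1).
    by rewrite -{2}[I]powRr1 ?(ltW Ipos)// -powRD ?(gt_eqF Ipos) ?implybT// addrC subrK.
  rewrite ler_wpM2l ?(ltW Ipos)// -powRM ?(ltW Phi0)//.
  by rewrite ge0_ler_powR ?nnegrE ?(ltW Ipos)// mulr_ge0// ltW.
have LE : (4 * L) `^ q = 4 `^ q * ((32 * C1) `^ (q / p) * I `^ (q / p) * (1 - u) `^ (-2 * (q / p))).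
  rewrite powRM ?(ltW L0)// /L -powRrM [p^-1 * q]mulrC /K.
  rewrite powRM ?powR_ge0 ?(ltW C1I)// powRM ?(ltW Ipos) ?mulr_ge0 ?(ltW C10)//.
  by rewrite -powRrM.
rewrite LE -!EFinM lee_fin.
set X := (32 * C1) `^ _ in C C0 *; set v := (1 - u) `^ (-2 * _).
have X0 : 0 <= X by exact: powR_ge0.
have v0 : 0 <= v by exact: powR_ge0.
apply: (@le_trans _ _ (4 `^ q * (X * (I * (3 `^ (q / p - 1) * Phi `^ (q / p - 1))) * v) *
   (kap * ((1 - u) `^ be * 2^-1 `^ be)))).
  apply: ler_pM; rewrite ?mulr_ge0 ?powR_ge0//.
    by rewrite ler_wpM2l ?powR_ge0// ler_wpM2r// ler_wpM2l.
  by rewrite ler_wpM2l.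
have -> : (1 - u) `^ (- q - 1) = v * (1 - u) `^ be.
  rewrite /v -powRD ?(gt_eqF u10) ?implybT//; congr (_ `^ _).
  by rewrite /be; field; rewrite !gt_eqF.
by rewrite le_eqVlt; apply/orP; left; apply/eqP; rewrite /C; ring.
Qed.

Lemma measurable_1BpowR (e : R) : measurable_fun setT (fun u : R => ((1 - u) `^ e)%:E).
Proof.
apply/measurable_EFinP; apply: (measurableT_comp (measurable_powR _)).
exact: measurable_funB.
Qed.

Lemma integral_sqrt_weight u : u < 1 ->
  (\int[mu]_(r in `[u, 1%R[) ((1 - r) `^ (- 2^-1))%:E <= (2 * (1 - u) `^ 2^-1)%:E)%E.
Proof.
move=> u1; apply: integral_co_le => //.
- exact: measurable_1BpowR.
- by move=> x; rewrite lee_fin powR_ge0.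
move=> rho /andP[ur r1].
have N1 : (-1 : R) != 0 by rewrite oppr_eq0 oner_eq0.
have l0 : (2^-1 : R) != 0 by rewrite invr_eq0.
have := @integral_powR_affine R 1 (-1) 2^-1 u rho ur N1 l0.
rewrite (_ : 2^-1 - 1 = - 2^-1 :> R); last by field.
under eq_integral do rewrite mulN1r.
move=> ->; last by move=> t /andP[_ tr]; rewrite mulN1r subr_gt0 (le_lt_trans tr).
rewrite lee_fin !mulN1r.
have := powR_ge0 (1 - rho) 2^-1; set X := _ `^ _ => X0; set Y := _ `^ _.
have -> : (X - Y) / - 2^-1 = 2 * (Y - X) by field.
by rewrite ler_wpM2l// gerBl.
Qed.

Lemma measurable_bool_set (P : R * R -> bool) : measurable_fun setT P ->
  measurable [set v | P v].
Proof.
move=> mP; have -> : [set v | P v] = setT `&` P @^-1` [set true].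
  by rewrite setTI; apply/seteqP; split => v.
by apply: mP.
Qed.

Definition window_set : set (R * R) := [set v | 1 - (1 - v.1) / 2 <= v.2 <= 1 - (1 - v.1) / 4].

Lemma measurable_window_set : measurable window_set.
Proof.
have m1 : measurable_fun setT (fun v : R * R => (1 - (1 - v.1) / 2 <= v.2) && (v.2 <= 1 - (1 - v.1) / 4)).
  have m c : measurable_fun setT (fun v : R * R => 1 - (1 - v.1) / c).
    by apply: measurable_funB => //; apply: measurable_funM => //; apply: measurable_funB.
  by apply: measurable_and; apply: measurable_fun_ler.
exact: measurable_bool_set m1.
Qed.

(** The domain is cut out of a fixed interval by a measurable set of the plane, so that
    [tonelli_region] applies. *)
Definition window_mean (N : R -> \bar R) u : \bar R :=
  (\int[mu]_(s in `[2^-1%R, 1%R[ `&` [set s | window_set (u, s)]) N s)%E.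

Lemma window_meanE N u : 2^-1 <= u < 1 -> window_mean N u = (\int[mu]_(s in window u) N s)%E.
Proof.
move=> /andP[u2 u1]; congr (integral _ _ _); apply/seteqP; split => s /=.
  by rewrite /window_set/= in_itv/= => -[].
rewrite /window /window_set /= !in_itv/= => su; split=> //.
by case/andP: su => ? ?; apply/andP; split; lra.
Qed.

Lemma measurable_window_mean N : measurable_fun setT N -> (forall s, (0 <= N s)%E) ->
  measurable_fun setT (window_mean N).
Proof.
by move=> mN N0; apply: measurable_region_integral => //; exact: measurable_window_set.
Qed.

Lemma window_mean_ge0 N u : (forall s, (0 <= N s)%E) -> (0 <= window_mean N u)%E.
Proof. by move=> N0; exact: integral_ge0. Qed.

(** The radii [u] whose window contains [s] satisfy
    [2 (1 - s) <= 1 - u <= 4 (1 - s)]. *)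
Lemma window_weight r0 s : s < 1 -> (\int[mu]_(u in `[r0, 1%R[ `&`
   [set u | window_set (u, s)]) ((1 - u) `^ (- 1))%:E <= 1%:E)%E.
Proof.
move=> s1; have s10 : 0 < 1 - s by rewrite subr_gt0.
have mW : measurable [set u | window_set (u, s)].
  rewrite (_ : [set u | _] = ysection window_set s); last exact/esym/ysectionE.
  by apply: measurable_ysection; exact: measurable_window_set.
have mA : measurable (`[r0, 1%R[ `&` [set u | window_set (u, s)]).
  by apply: measurableI.
have mm := measurable_1BpowR (-1).
set c : R := (2 * (1 - s))^-1.
have c0 : 0 <= c by rewrite invr_ge0 mulr_ge0// ltW.
apply: (@le_trans _ _ (\int[mu]_(u in `[r0, 1%R[ `&` [set u | window_set (u, s)]) cst c%:E u)%E).
  apply: ge0_le_integral => //.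
  - by move=> u _; rewrite lee_fin powR_ge0.
  - exact: measurable_funTS.
  - move=> u [/=]; rewrite in_itv/= => /andP[_ u1] /andP[/= u2 u3].
    rewrite lee_fin powR_inv1; last by lra.
    rewrite /c lef_pV2 ?posrE ?mulr_gt0//; lra.
apply: (@le_trans _ _ (\int[mu]_(u in `[(1 - 4 * (1 - s))%R, (1 - 2 * (1 - s))%R]) cst c%:E u)%E).
  apply: subset_integral_le => //.
  by move=> u [_] /andP[/= u2 u3]; rewrite /= in_itv/=; apply/andP; split; lra.
rewrite integral_cst//= lebesgue_measure_itv/= lte_fin ifT; last by lra.
rewrite -EFinB -EFinM lee_fin /c mulrC ler_pdivrMr ?mulr_gt0//; lra.
Qed.

(** Tonelli twice: the integral of [(1 - r)^(-1/2)] over [u, 1) leaves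
    [(1 - u)^(-1)], and [window_weight] absorbs the latter. *)
Lemma double_integral (N : R -> \bar R) r0 : 2^-1 <= r0 < 1 ->
  measurable_fun setT N -> (forall s, (0 <= N s)%E) ->
  (\int[mu]_(r in `[r0, 1%R[) (((1 - r) `^ (- 2^-1))%:E *
     \int[mu]_(u in `[r0, r]) (((1 - u) `^ (- (3 / 2)))%:E * window_mean N u))
   <= 2%:E * \int[mu]_(s in `[2^-1%R, 1%R[) N s)%E.
Proof.
move=> /andP[r02 r01] mN N0.
have mI := measurable_window_mean mN N0; have I0 u := @window_mean_ge0 N u N0.
have m1 := measurable_1BpowR.
have p1 e u : (0 <= ((1 - u) `^ e)%:E)%E by rewrite lee_fin powR_ge0.
pose K1 r : \bar R := ((1 - r) `^ (- 2^-1))%:E.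
pose K2 u : \bar R := (((1 - u) `^ (- (3 / 2)))%:E * window_mean N u)%E.
pose K3 u : \bar R := ((1 - u) `^ (- 1))%:E.
have mK2 : measurable_fun setT K2 by apply: emeasurable_funM.
have K20 u : (0 <= K2 u)%E by rewrite mule_ge0.
pose W : set (R * R) := [set v | v.2 <= v.1].
have mW : measurable W.
  by apply: measurable_bool_set; exact: (measurable_fun_ler measurable_snd measurable_fst).
rewrite (_ : (\int[mu]_(r in _) _)%E =
   (\int[mu]_(r in `[r0, 1%R[) (K1 r * \int[mu]_(u in `[r0, 1%R[ `&` [set u | W (r, u)]) K2 u))%E); last first.
  apply: eq_integral => r; rewrite inE/= in_itv/= => /andP[r0r r1]; congr (_ * integral _ _ _)%E.
  apply/seteqP; split => u /=; rewrite !in_itv/= /W/=.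
    by move=> /andP[-> ur]/=; split => //; exact: le_lt_trans r1.
  by move=> [/andP[-> _]].
rewrite tonelli_region//; [|exact: m1|by move=> x; exact: p1].
apply: (@le_trans _ _ (\int[mu]_(u in `[r0, 1%R[) (2%:E * (K3 u * window_mean N u)))%E).
  apply: ge0_le_integral => //.
  - by move=> u _; rewrite mule_ge0//; apply: integral_ge0 => r _; exact: p1.
  - apply: measurable_funTS; apply: emeasurable_funM => //.
    have := @measurable_region_integral R K1 `[r0, 1%R[%classic [set v | W (v.2, v.1)].
    apply => //; last by move=> x; exact: p1.
    + by apply: measurable_bool_set; exact: (measurable_fun_ler measurable_fst measurable_snd).
    + exact: m1.
  - by apply: measurable_funTS; apply: emeasurable_funM => //; apply: emeasurable_funM => //; exact: m1.
  - move=> u; rewrite /= in_itv/= => /andP[r0u u1].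
    have u10 : 0 < 1 - u by rewrite subr_gt0.
    have -> : (\int[mu]_(x in `[r0, 1%R[ `&` [set x | W (x, u)]) K1 x)%E =
              (\int[mu]_(x in `[u, 1%R[) K1 x)%E.
      congr (integral _ _ _); apply/seteqP; split => r /=; rewrite !in_itv/= /W/=.
        by move=> [/andP[_ ->] ->].
      by move=> /andP[ur ->]; rewrite ur (le_trans r0u ur).
    apply: (@le_trans _ _ (K2 u * (2 * (1 - u) `^ 2^-1)%:E)%E).
      by rewrite lee_wpmul2l//; exact: integral_sqrt_weight.
    rewrite /K2 muleAC -EFinM muleA -EFinM le_eqVlt; apply/orP; left; apply/eqP.
    congr (_%:E * _)%E; rewrite mulrCA -powRD ?(gt_eqF u10) ?implybT//.
    by congr (_ * _ `^ _); field.
rewrite ge0_integralZl//; last 2 first.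
- by apply: measurable_funTS; apply: emeasurable_funM => //; exact: m1.
- by move=> u _; rewrite mule_ge0//; exact: p1.
rewrite lee_wpmul2l ?lee_fin// tonelli_region//; last 3 first.
- exact: measurable_window_set.
- exact: m1.
- by move=> x; exact: p1.
apply: ge0_le_integral => //.
- by move=> s _; rewrite mule_ge0//; apply: integral_ge0 => u _; exact: p1.
- apply: measurable_funTS; apply: emeasurable_funM => //.
  have := @measurable_region_integral R K3 `[r0, 1%R[%classic [set v | window_set (v.2, v.1)].
  apply => //; [|exact: m1|by move=> x; exact: p1].
  have : measurable_fun setT (fun v : R * R => (v.2, v.1)).
    by apply/measurable_fun_pair; [exact: measurable_snd|exact: measurable_fst].
  by move=> /(_ measurableT _ measurable_window_set); rewrite setTI.
- exact: measurable_funTS.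
- move=> s; rewrite /= in_itv/= => /andP[s2 s1].
  by rewrite -[leRHS]mule1 lee_wpmul2l//; exact: window_weight.
Qed.

End MainEstimate.

(** * The main estimate *)

Section Sufficiency.
Context {R : realType}.
Local Notation mu := (@lebesgue_measure R).

Lemma integral_le_affine (A : set R) (f G : R -> \bar R) (y d e : R) : measurable A ->
  (mu A <= 1)%E -> measurable_fun A f -> measurable_fun A G ->
  (forall x, (0 <= f x)%E) -> (forall x, (0 <= G x)%E) -> 0 <= y -> 0 <= d ->
  (forall x, A x -> (f x <= y%:E + d%:E * G x)%E) -> (\int[mu]_(x in A) G x <= e%:E)%E ->
  (\int[mu]_(x in A) f x <= (y + d * e)%:E)%E.
Proof.
move=> mA A1 mf mG f0 G0 y0 d0 H HG.
have mdG : measurable_fun A (fun x => d%:E * G x)%E by exact: emeasurable_funM.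
have dG0 x : A x -> (0 <= d%:E * G x)%E by move=> _; rewrite mule_ge0 ?lee_fin.
apply: (@le_trans _ _ (\int[mu]_(x in A) (y%:E + d%:E * G x))%E).
  by apply: ge0_le_integral => //; exact: emeasurable_funD.
rewrite ge0_integralD// EFinD; apply: leeD.
  by rewrite integral_cst//= -[leRHS]mule1 lee_wpmul2l ?lee_fin.
by rewrite ge0_integralZl// EFinM lee_wpmul2l ?lee_fin.
Qed.

Implicit Types (a g : nat -> R[i]) (z w : R[i]) (p q r s u : R).

Lemma circ_le_sup q h r0 (S : R) r : 0 < q -> disc_coef h -> 0 <= S -> 0 <= r <= r0 -> r0 < 1 ->
  (forall z, modulus z <= r0 -> modulus (psum h z) <= S) ->
  (circ q h r <= (2 * pi * S `^ q)%:E)%E.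
Proof.
move=> q0 dh S0 /andP[rp rr] r1 HS; apply: circ_le => //; first exact: ltW.
have r01 : 0 <= r < 1 by rewrite rp (le_lt_trans rr).
by move=> t; rewrite mdisc_pt// HS// modulus_pt ger0_norm.
Qed.

Lemma berg_split q h r0 (S : R) : 0 < q -> disc_coef h -> 0 <= S -> 0 < r0 < 1 ->
  (forall z, modulus z <= r0 -> modulus (psum h z) <= S) ->
  (berg q h <= (2 * pi * S `^ q)%:E + \int[mu]_(r in `[r0, 1%R[) circ q h r)%E.
Proof.
move=> q0 dh S0 /andP[r00 r01] HS.
have mc := measurable_circ q dh.
have mf : measurable_fun setT (fun r : R => (r%:E * circ q h r)%E) by apply: emeasurable_funM.
have -> : berg q h = (\int[mu]_(r in `]0%R, r0[ `|` `[r0, 1%R[) (r%:E * circ q h r))%E.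
  congr (integral _ _ _); apply/seteqP; split => r /=; rewrite !in_itv/=.
    by move=> /andP[-> ->]; rewrite andbT/=; case: (ltP r r0) => ?; [left|right].
  by move=> [/andP[-> rr]|/andP[rr ->]]/=; [exact: lt_trans r01|rewrite andbT (lt_le_trans r00)].
have P2 : 0 <= 2 * pi * S `^ q by rewrite !mulr_ge0 ?powR_ge0 ?pi_ge0.
rewrite ge0_integral_setU//; last 3 first.
- exact: measurable_funTS.
- move=> r [|]; rewrite /= in_itv/= => /andP[? _]; rewrite mule_ge0 ?circ_ge0// lee_fin.
    exact: ltW.
  by rewrite (le_trans (ltW r00)).
- apply/eqP; rewrite -subset0 => r [/=]; rewrite !in_itv/= => /andP[_ ?] /andP[? _].
  by lra.
apply: leeD.
  apply: (@le_trans _ _ (\int[mu]_(r in `]0%R, r0[) cst (2 * pi * S `^ q)%:E r)%E).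
    apply: ge0_le_integral => //.
    - by move=> r; rewrite /= in_itv/= => /andP[? _]; rewrite mule_ge0 ?circ_ge0// lee_fin ltW.
    - exact: measurable_funTS.
    - move=> r; rewrite /= in_itv/= => /andP[rp rr].
      have H : (circ q h r <= (2 * pi * S `^ q)%:E)%E.
        by apply: (circ_le_sup (r0 := r0)); rewrite ?(ltW rp) ?(ltW rr).
      apply: le_trans H; rewrite -[leRHS]mul1e lee_wpmul2r ?circ_ge0// lee_fin.
      by rewrite ltW// (lt_trans rr).
  rewrite integral_cst//= lebesgue_measure_itv/= lte_fin r00 oppr0 adde0 -EFinM lee_fin.
  by rewrite ler_piMr// ltW.
apply: ge0_le_integral => //.
- move=> r; rewrite /= in_itv/= => /andP[? _]; rewrite mule_ge0 ?circ_ge0// lee_fin.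
  by rewrite (le_trans (ltW r00)).
- exact: measurable_funTS.
- exact: measurable_funTS.
- move=> r; rewrite /= in_itv/= => /andP[_ ?]; rewrite -[leRHS]mul1e lee_wpmul2r ?circ_ge0//.
  by rewrite lee_fin ltW.
Qed.

(** Hardy's inequality with [k = q - 1/2], where the local estimate bounds the
    integrand by [(1 - u)^(-3/2)] times a mean over the window; then integrate over [r]. *)
Lemma main_estimate p q : 1 < p -> p < q -> 2 / p - q^-1 < 1 -> exists2 C : R, 0 < C &
  forall g a (kap Phi r0 S : R), disc_coef g -> disc_coef a ->
  0 <= kap -> 0 < Phi -> (berg p a <= Phi%:E)%E -> 2^-1 <= r0 < 1 -> 0 <= S ->
  (forall r, r0 <= r < 1 -> (circ q (theta g) r <= (kap * (1 - r) `^ ((2 / p - q^-1 - 1) * q))%:E)%E) ->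
  (forall z, modulus z <= r0 -> modulus (psum (rhaly_coef g a) z) <= S) ->
  (berg q (rhaly_coef g a) <= (C * (S `^ q + kap * Phi `^ (q / p)))%:E)%E.
Proof.
move=> p1 pq al1; have p0 : 0 < p by exact: lt_trans p1.
have q1 : 1 < q by exact: lt_trans pq.
have q0 : 0 < q by exact: lt_trans q1.
have [C1 C10 HC1] := local_estimate p1 pq al1.
(* any exponent in (q - 1, q) would do for the double integral below *)
have kq : q - 1 < q - 2^-1 by lra.
have [C2 C20 HC2] := hardy q1 kq.
exists (2 * pi + C2 * (2 * pi) + 6 * (C2 * C1)).
  by rewrite !addr_gt0 ?mulr_gt0 ?pi_gt0.
move=> g a kap Phi r0 S dg da kap0 Phi0 HPhi /andP[r02 r01] S0 Hk HS.
have r00 : 0 < r0 by rewrite (lt_le_trans _ r02)// invr_gt0.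
set h := rhaly_coef g a in HS *.
have dh : disc_coef h by exact: disc_coef_rhaly.
have mc := measurable_circ q dh.
have mca := measurable_circ p da.
pose N s := (circ p a s + Phi%:E)%E.
have mN : measurable_fun setT N by apply: emeasurable_funD.
have N0 s : (0 <= N s)%E by rewrite /N adde_ge0 ?circ_ge0// lee_fin ltW.
have mI := measurable_window_mean mN N0; have I0 u := @window_mean_ge0 _ N u N0.
pose D := C1 * kap * Phi `^ (q / p - 1).
have D0 : 0 <= D by rewrite !mulr_ge0 ?powR_ge0// ltW.
pose K2 u : \bar R := (((1 - u) `^ (- (3 / 2)))%:E * window_mean N u)%E.
have mK2 : measurable_fun setT K2 by apply: emeasurable_funM => //; exact: measurable_1BpowR.
have K20 u : (0 <= K2 u)%E by rewrite mule_ge0// lee_fin powR_ge0.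
have p1B (e u : R) : (0 <= ((1 - u) `^ e)%:E)%E by rewrite lee_fin powR_ge0.
have mdt : disc_coef (theta h) by exact: disc_coef_theta.
pose V r := (\int[mu]_(u in `[r0, r]) K2 u)%E.
have V0 r : (0 <= V r)%E by exact: integral_ge0.
have mV : measurable_fun `[r0, 1%R[ V.
  pose W : set (R * R) := [set v | v.2 <= v.1].
  have mW : measurable W.
    by apply: measurable_bool_set; exact: (measurable_fun_ler measurable_snd measurable_fst).
  have := @measurable_region_integral R K2 `[r0, 1%R[%classic W _ mW mK2 K20.
  move=> /(_ _)/measurable_funTS => /(_ _ _) H.
  apply: (eq_measurable_fun _ _ (H _ _)) => //.
  move=> r; rewrite inE/= in_itv/= => /andP[r0r r1]; congr (integral _ _ _).
  apply/seteqP; split => u /=; rewrite !in_itv/= /W/=.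
    by move=> [/andP[-> _]].
  by move=> /andP[-> ur]/=; split => //; exact: le_lt_trans r1.
have stepA r : r0 <= r < 1 -> (circ q h r <= (C2 * (2 * pi * S `^ q))%:E +
   (C2 * D)%:E * (((1 - r) `^ (- 2^-1))%:E * V r))%E.
  move=> /[dup] r01' /andP[r0r r1]; apply: (le_trans (HC2 h r0 r dh r02 r01')).
  have X0 : (0 <= ((1 - r) `^ (q - 1 - (q - 2^-1)))%:E * \int[mu]_(u in `[r0, r])
      (((1 - u) `^ (q - 2^-1))%:E * circ q (theta h) u))%E.
    by rewrite mule_ge0//; apply: integral_ge0 => u _; rewrite mule_ge0 ?circ_ge0.
  rewrite (ge0_muleDr _ (circ_ge0 _ _ _) X0).
  apply: leeD.
    rewrite EFinM lee_wpmul2l ?lee_fin ?(ltW C20)//.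
    by apply: (circ_le_sup (r0 := r0)); rewrite ?lexx ?(ltW r00).
  rewrite EFinM -muleA lee_wpmul2l ?lee_fin ?(ltW C20)//.
  rewrite (_ : q - 1 - (q - 2^-1) = - 2^-1); last by field.
  rewrite [leRHS]muleCA; apply: lee_wpmul2l; first exact: p1B.
  have -> : (D%:E * V r = \int[mu]_(u in `[r0, r]) (D%:E * K2 u))%E.
    by rewrite /V ge0_integralZl//; exact: measurable_funTS.
  apply: ge0_le_integral => //.
  - by move=> u _; rewrite mule_ge0 ?circ_ge0.
  - apply: measurable_funTS; apply: emeasurable_funM; first exact: measurable_1BpowR.
    exact: measurable_circ.
  - by apply: measurable_funTS; apply: emeasurable_funM.
  - move=> u; rewrite /= in_itv/= => /andP[r0u ur].
    have u01 : r0 <= u < 1 by rewrite r0u (le_lt_trans ur).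
    have u21 : 2^-1 <= u < 1 by rewrite (le_trans r02)//; case/andP: u01.
    have u10 : 0 < 1 - u by rewrite subr_gt0; case/andP: u01.
    have := HC1 g a kap Phi r0 u dg da kap0 Phi0 HPhi r02 u01 Hk.
    rewrite -/h -/D -/(N _) -window_meanE// => H.
    apply: (@le_trans _ _ (((1 - u) `^ (q - 2^-1))%:E * ((D * (1 - u) `^ (- q - 1))%:E * window_mean N u))%E).
      by apply: lee_wpmul2l; [exact: p1B|exact: H].
    rewrite /K2 !muleA -!EFinM lee_wpmul2r// lee_fin mulrCA -powRD ?(gt_eqF u10) ?implybT//.
    rewrite le_eqVlt; apply/orP; left; apply/eqP; congr (_ * _ `^ _); by field.
have DI := double_integral (introT andP (conj r02 r01)) mN N0.
apply: (le_trans (berg_split q0 dh S0 (introT andP (conj r00 r01)) HS)).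
set Y := 2 * pi * S `^ q.
have Y0 : 0 <= Y by rewrite !mulr_ge0 ?powR_ge0 ?pi_ge0.
have NI := outer_berg da Phi0 HPhi; rewrite -/(N _) in NI.
have mG : measurable_fun `[r0, 1%R[ (fun r => ((1 - r) `^ (- 2^-1))%:E * V r)%E.
  by apply: emeasurable_funM => //; apply: measurable_funTS; exact: measurable_1BpowR.
have G0 r : (0 <= ((1 - r) `^ (- 2^-1))%:E * V r)%E by rewrite mule_ge0.
have CY0 : 0 <= C2 * Y by rewrite mulr_ge0// ltW.
have CD0 : 0 <= C2 * D by rewrite mulr_ge0// ltW.
have {}DI : (\int[mu]_(r in `[r0, 1%R[) (((1 - r) `^ (- 2^-1))%:E * V r) <= (2 * (3 * Phi))%:E)%E.
  by apply: (le_trans DI); rewrite EFinM lee_wpmul2l ?lee_fin.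
have m1 : (mu `[r0, 1%R[%classic <= 1)%E.
  rewrite lebesgue_measure_itv/= lte_fin r01 -EFinB lee_fin; lra.
have fin : (\int[mu]_(r in `[r0, 1%R[) circ q h r <= (C2 * Y + C2 * D * (2 * (3 * Phi)))%:E)%E.
  have ci := circ_ge0 q h.
  have stepB r : `[r0, 1%R[%classic r -> (circ q h r <= (C2 * Y)%:E +
     (C2 * D)%:E * (((1 - r) `^ (- 2^-1))%:E * V r))%E.
    by rewrite /= in_itv/= => rr; exact: stepA.
  apply: (integral_le_affine _ m1 (measurable_funTS mc) mG ci G0 CY0 CD0 stepB DI).
  exact: measurable_itv.
apply: (@le_trans _ _ (Y%:E + (C2 * Y + C2 * D * (2 * (3 * Phi)))%:E)%E).
  by rewrite leeD2l.
rewrite -EFinD lee_fin.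
have -> : C2 * D * (2 * (3 * Phi)) = 6 * (C2 * C1) * (kap * Phi `^ (q / p)).
  have -> : Phi `^ (q / p) = Phi `^ (q / p - 1) * Phi.
    by rewrite -{3}[Phi]powRr1 ?(ltW Phi0)// -powRD ?(gt_eqF Phi0) ?implybT// subrK.
  by rewrite /D; ring.
have X0 : 0 <= kap * Phi `^ (q / p) by rewrite mulr_ge0 ?powR_ge0.
have s0 := powR_ge0 S q; rewrite /Y; move: (S `^ q) s0 (kap * _) X0 => s s0 X X0.
have P0 := @pi_ge0 R; have CC : 0 <= C2 * C1 by rewrite mulr_ge0// ltW.
have -> : (2 * pi + C2 * (2 * pi) + 6 * (C2 * C1)) * (s + X) =
  (2 * pi * s + (C2 * (2 * pi * s) + 6 * (C2 * C1) * X)) + (2 * pi * X + C2 * (2 * pi) * X + 6 * (C2 * C1) * s).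
  by ring.
by rewrite lerDl !addr_ge0 ?mulr_ge0 ?(ltW C20) ?(ltW C10).
Qed.

End Sufficiency.

(** * Bergman and Lipschitz conditions on coefficients *)

Section Translation.
Context {R : realType}.
Local Notation mu := (@lebesgue_measure R).
Implicit Types (a g eta : nat -> R[i]) (z w : R[i]) (p q r s u : R) (f : R[i] -> R[i]).

Lemma near_left1P (P : R -> Prop) : (\forall r \near (1 : R)^'-, P r) <->
  exists2 r0 : R, r0 < 1 & forall r, r0 <= r < 1 -> P r.
Proof.
split.
  move=> /nbhs_ballP [e /= e0 H]; exists (1 - e / 2); first by rewrite gtrBl divr_gt0.
  move=> r /andP[r0 r1]; apply: H => //; rewrite /ball/= ltr_norml.
  by apply/andP; split; lra.
move=> [r0 r01 H]; apply/nbhs_ballP; exists (1 - r0); first by rewrite /= subr_gt0.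
move=> r; rewrite /ball/= ltr_norml => /andP[r1 r2] rr; apply: H.
by rewrite rr andbT; lra.
Qed.

Lemma power_sum_disc_coef eta f :
  (forall z, unit_disc z -> power_sum_at eta z (f z)) ->
  disc_coef eta /\ forall z, modulus z < 1 -> f z = psum eta z.
Proof.
move=> H; split; last by move=> z z1; rewrite (psum_eq (H z z1)).
move=> s /andP[s0 s1]; have sE : modulus (s%:C%C : R[i]) = s by rewrite modulusR gtr0_norm.
by rewrite -sE; apply: power_sum_rad; apply: H; rewrite /unit_disc/= sE.
Qed.

Lemma rhalyE eta f a : disc_coef eta -> disc_coef a ->
  (forall z, modulus z < 1 -> f z = psum a z) ->
  forall z, modulus z < 1 -> rhaly eta f z = psum (rhaly_coef eta a) z.
Proof.
move=> de da fa z z1; rewrite /rhaly (taylor_coefE da fa).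
apply: cvg_lim; first exact: norm_hausdorff.
exact: (disc_psum_cvg (disc_coef_rhaly de da) z1).
Qed.

(** Chooses the Taylor coefficients, on which all the estimates bear. *)
Lemma bergmanP p f : 0 < p -> bergman p f -> exists a,
  [/\ disc_coef a, forall z, modulus z < 1 -> f z = psum a z,
      berg p a \is a fin_num & bergman_norm p f = fine (berg p a) `^ p^-1].
Proof.
move=> p0 [/Hol_global[a [da fa]]]; rewrite /bergman_norm (bergman_integralE p0 da fa) => afin.
by exists a; split=> //; rewrite ge0_fin_numE ?berg_ge0.
Qed.

Lemma bergman_psum p f a : 0 < p -> disc_coef a ->
  (forall z, modulus z < 1 -> f z = psum a z) -> (berg p a < +oo)%E -> bergman p f.
Proof.
by move=> p0 da fa afin; split; [exact: Hol_psum fa|rewrite /= (bergman_integralE p0 da fa)].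
Qed.

Lemma bergman_normE p f a : 0 < p -> disc_coef a ->
  (forall z, modulus z < 1 -> f z = psum a z) ->
  bergman_norm p f = fine (berg p a) `^ p^-1.
Proof. by move=> p0 da fa; rewrite /bergman_norm (bergman_integralE p0 da fa). Qed.

Lemma circ_theta q a r : disc_coef a -> 0 <= r < 1 ->
  circ q (theta a) r = ((r `^ q)%:E * circ q (dcoef a) r)%E.
Proof.
move=> da r01; have dd : disc_coef (dcoef a) by exact: rad_ball_dcoef.
have r0 : 0 <= r by case/andP: r01.
rewrite /circ -ge0_integralZl//; last 3 first.
- by apply: measurable_funTS; exact: measurable_mdisc_ptrp.
- by move=> t _; rewrite lee_fin powR_ge0.
- by rewrite lee_fin powR_ge0.
apply: eq_integral => t _; rewrite -EFinM -powRM ?mdisc_ge0//.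
have pt1 : modulus (pt r t) < 1 by rewrite modulus_pt ger0_norm//; case/andP: r01.
by rewrite !mdisc_pt// psum_theta// modulusM modulus_pt ger0_norm.
Qed.

Lemma integral_mean_derive q g f r : disc_coef g -> (forall z, modulus z < 1 -> f z = psum g z) ->
  0 <= r < 1 -> integral_mean q r (derive1 f) =
    ((2 * pi)^-1 * fine (circ q (dcoef g) r)) `^ q^-1.
Proof.
move=> dg fg /andP[r0 r1]; rewrite /integral_mean.
set I1 := Rintegral _ _ _; suff -> : I1 = fine (circ q (dcoef g) r) by [].
rewrite /I1 /Rintegral /circ; congr fine; apply: eq_integral => t _; congr _%:E.
have pt1 : modulus (pt r t) < 1 by rewrite modulus_pt ger0_norm.
rewrite mdisc_pt ?r0// -[r%:C%C * _]/(pt r t).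
have H := @derive1_psum R f g 0 1 dg _ (pt r t); rewrite H ?subr0// => w.
by rewrite subr0 => /fg.
Qed.

(** Only radii [r >= 1/2] matter, for which the factor [r^q] between
    [circ q (theta g) r] and the mean of the derivative is harmless. *)
Lemma mean_bound q (al k : R) g f r : 0 < q -> 0 < k -> disc_coef g ->
  (forall z, modulus z < 1 -> f z = psum g z) -> 2^-1 <= r < 1 ->
  (integral_mean q r (derive1 f) <= k * (1 - r) `^ (al - 1) ->
    (circ q (theta g) r <= (2 * pi * k `^ q * (1 - r) `^ ((al - 1) * q))%:E)%E) /\
  ((circ q (theta g) r <= (k * (1 - r) `^ ((al - 1) * q))%:E)%E ->
    integral_mean q r (derive1 f) <= ((2 * pi)^-1 * (2 `^ q * k)) `^ q^-1 * (1 - r) `^ (al - 1)).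
Proof.
move=> q0 k0 dg fg /andP[r2 r1].
have r0 : 0 < r by rewrite (lt_le_trans _ r2)// invr_gt0.
have r01 : 0 <= r < 1 by rewrite ltW.
have dd : disc_coef (dcoef g) by exact: rad_ball_dcoef.
have cf : circ q (dcoef g) r \is a fin_num by apply: circ_fin => //; exact: ltW.
rewrite (integral_mean_derive _ dg fg r01) (circ_theta _ dg r01) -(fineK cf).
have c0 : 0 <= fine (circ q (dcoef g) r) by apply: fine_ge0; exact: circ_ge0.
rewrite -EFinM !lee_fin; move: (fine _) c0 => c c0 {cf}.
have P0 : 0 < 2 * pi :> R by rewrite mulr_gt0 ?pi_gt0.
have PE : (1 - r) `^ ((al - 1) * q) = ((1 - r) `^ (al - 1)) `^ q by rewrite powRrM.
rewrite PE; move: ((1 - r) `^ _) (powR_ge0 (1 - r) (al - 1)) => X X0 {PE}.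
have pow1 : 1 `^ q = 1 :> R by rewrite powR1.
have rq1 : r `^ q <= 1.
  by rewrite -[leRHS]pow1 ge0_ler_powR ?nnegrE ?(ltW q0) ?(ltW r0) ?(ltW r1).
have rq2 : 1 <= 2 `^ q * r `^ q.
  rewrite -powRM ?(ltW r0)// -[leLHS]pow1 ge0_ler_powR ?nnegrE ?(ltW q0) ?mulr_ge0 ?(ltW r0)//.
  by move: r2; lra.
split=> H.
  have : ((2 * pi)^-1 * c) <= (k * X) `^ q.
    have [c1|c1] := eqVneq ((2 * pi)^-1 * c) 0; first by rewrite c1 powR_ge0.
    have cp : 0 <= (2 * pi)^-1 * c by rewrite mulr_ge0 ?invr_ge0 ?(ltW P0).
    have -> : (2 * pi)^-1 * c = (((2 * pi)^-1 * c) `^ q^-1) `^ q.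
      by rewrite -powRrM mulVf ?gt_eqF// powRr1.
    by rewrite ge0_ler_powR ?nnegrE ?powR_ge0 ?(ltW q0)// mulr_ge0// ltW.
  rewrite ler_pdivrMl// powRM ?(ltW k0)// mulrA => H2; apply: le_trans H2.
  by rewrite ler_piMl.
have -> : X = (X `^ q) `^ q^-1 by rewrite -powRrM mulfV ?gt_eqF// powRr1.
rewrite -powRM ?powR_ge0 ?mulr_ge0 ?invr_ge0 ?(ltW P0) ?powR_ge0 ?(ltW k0)//.
rewrite ge0_ler_powR ?nnegrE ?invr_ge0 ?(ltW q0) ?mulr_ge0 ?invr_ge0 ?(ltW P0) ?powR_ge0 ?(ltW k0)//.
rewrite -mulrA ler_wpM2l ?invr_ge0 ?(ltW P0)//.
apply: (@le_trans _ _ (2 `^ q * (r `^ q * c))).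
  by rewrite mulrA ler_peMl.
by rewrite -mulrA ler_wpM2l ?powR_ge0.
Qed.

Lemma integral_mean_ge0 q r f : 0 <= integral_mean q r f.
Proof. exact: powR_ge0. Qed.

Lemma mean_lipschitzP q (al : R) g f : 0 < q -> disc_coef g ->
  (forall z, modulus z < 1 -> f z = psum g z) ->
  mean_lipschitz q al f <-> exists K r0 : R, [/\ 0 < K, 2^-1 <= r0 < 1 &
   forall r, r0 <= r < 1 -> (circ q (theta g) r <= (K * (1 - r) `^ ((al - 1) * q))%:E)%E].
Proof.
move=> q0 dg fg; split.
  move=> [_ /eqOP H].
  have {H} [k k0 /near_left1P [r0 r01 H]] : exists2 k : R, 0 < k & \forall r \near (1:R)^'-,
     `|integral_mean q r (derive1 f)| <= k * `|(1 - r) `^ (al - 1)|.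
    near (pinfty_nbhs R) => k; exists k; near: k => //.
    by exists 0; split => // k; rewrite real0.
  exists (2 * pi * k `^ q), (Num.max 2^-1 r0); split.
  - by rewrite !mulr_gt0 ?pi_gt0 ?powR_gt0.
  - by rewrite le_max lexx gt_max r01 andbT/= invf_lt1 ?ltr1n.
  move=> r /andP[]; rewrite ge_max => /andP[r2 r0r] r1.
  have r21 : 2^-1 <= r < 1 by rewrite r2.
  have [HH _] := mean_bound al q0 k0 dg fg r21.
  apply: HH; have := H r; rewrite r0r r1 => /(_ isT).
  by rewrite ger0_norm ?integral_mean_ge0// ger0_norm ?powR_ge0.
move=> [K [r0 [K0 /andP[r02 r01] H]]]; split; first exact: Hol_psum fg.
apply/eqOP; near=> k; apply/near_left1P; exists r0 => // r /andP[r0r r1].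
have r21 : 2^-1 <= r < 1 by rewrite r1 (le_trans r02).
have [_ HH] := mean_bound al q0 K0 dg fg r21.
have {HH} := HH (H r (introT andP (conj r0r r1))).
rewrite ger0_norm ?integral_mean_ge0// ger0_norm ?powR_ge0// => HH; apply: (le_trans HH).
by rewrite ler_wpM2r ?powR_ge0.
Unshelve. all: by end_near. Qed.

Lemma little_mean_lipschitzP q (al : R) g f : 0 < q -> disc_coef g ->
  (forall z, modulus z < 1 -> f z = psum g z) ->
  little_mean_lipschitz q al f <-> forall K : R, 0 < K -> exists2 r0 : R, 2^-1 <= r0 < 1 &
   forall r, r0 <= r < 1 -> (circ q (theta g) r <= (K * (1 - r) `^ ((al - 1) * q))%:E)%E.
Proof.
move=> q0 dg fg; have P0 : 0 < 2 * pi :> R by rewrite mulr_gt0 ?pi_gt0.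
split.
  move=> [_ /eqoP H] K K0; pose k := (K / (2 * pi)) `^ q^-1.
  have k0 : 0 < k by rewrite powR_gt0// divr_gt0.
  have [r0 r01 {}H] := (near_left1P _).1 (H k k0).
  exists (Num.max 2^-1 r0).
    by rewrite le_max lexx gt_max r01 andbT/= invf_lt1 ?ltr1n.
  move=> r /andP[]; rewrite ge_max => /andP[r2 r0r] r1.
  have r21 : 2^-1 <= r < 1 by rewrite r2.
  have [HH _] := mean_bound al q0 k0 dg fg r21.
  have KE : 2 * pi * k `^ q = K.
    by rewrite /k -powRrM mulVf ?gt_eqF// powRr1 ?divr_ge0 ?(ltW K0) ?(ltW P0)// mulrC divfK// gt_eqF.
  rewrite KE in HH; apply: HH; have := H r; rewrite r0r r1 => /(_ isT).
  by rewrite ger0_norm ?integral_mean_ge0// ger0_norm ?powR_ge0.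
move=> H; split; first exact: Hol_psum fg.
apply/eqoP => e e0; apply/near_left1P.
pose K := 2 * pi * e `^ q / 2 `^ q.
have K0 : 0 < K by rewrite divr_gt0 ?powR_gt0// mulr_gt0// powR_gt0.
have [r0 /andP[r02 r01] {}H] := H K K0; exists r0 => // r /andP[r0r r1].
have r21 : 2^-1 <= r < 1 by rewrite r1 (le_trans r02).
have [_ HH] := mean_bound al q0 K0 dg fg r21.
have {HH} := HH (H r (introT andP (conj r0r r1))).
rewrite ger0_norm ?integral_mean_ge0// ger0_norm ?powR_ge0// => HH; apply: (le_trans HH).
rewrite ler_wpM2r ?powR_ge0//.
have -> : (2 * pi)^-1 * (2 `^ q * K) = e `^ q.
  have cancel2 (x y c : R) : x != 0 -> y != 0 -> x^-1 * (y * (x * c / y)) = c.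
    by move=> x0 y0; field; rewrite x0 y0.
  by rewrite cancel2// gt_eqF// powR_gt0.
by rewrite -powRrM mulfV ?gt_eqF// powRr1// ltW.
Qed.

End Translation.

(** * Convergent subsequences *)

Section Subsequences.
Context {R : realType}.
Implicit Types (a b : nat -> R[i]) (z w : R[i]).

(** Compactness of a segment, for ultrafilters. *)
Lemma ultra_limit (G : set_system nat) (u : nat -> R) (M : R) : UltraFilter G ->
  (forall n, `|u n| <= M) -> exists x : R, u @ G --> x.
Proof.
move=> UG uM; have PG : ProperFilter G by exact: ultra_proper.
have uG : (u @ G) `[- M, M]%classic.
  by apply: (@filterE _ G _ (u @^-1` _)) => n; rewrite /= in_itv/= -ler_norml; exact: uM.
have [x [_ clx]] := segment_compact (a := - M) (b := M) (F := u @ G) _ uG.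
exists x => V Vx; have [//|GV] := in_ultra_setVsetC (u @^-1` V) UG.
by have [y [/=]] := clx (~` V) V GV Vx.
Qed.

(** Along an ultrafilter finer than the Frechet filter every coordinate converges; each
    finite set of approximations is realized by arbitrarily large indices, which are then
    chosen recursively. *)
Lemma diagonal (u : nat -> nat -> R) (M : nat -> R) : (forall m k, `|u m k| <= M k) ->
  exists (x : nat -> R) (s : nat -> nat), {homo s : m n / (m < n)%N} /\
   forall k, (fun n => u (s n) k) @ \oo --> x k.
Proof.
move=> uM; have [G [UG ooG]] := ultraFilterLemma (eventually_filter : ProperFilter \oo).
have PG : ProperFilter G by exact: ultra_proper.
have /choice[x Hx] : forall k, exists x : R, (fun m => u m k) @ G --> x.
  by move=> k; exact: (ultra_limit UG (uM^~ k)).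
pose P n m := forall k, (k <= n)%N -> `|x k - u m k| <= n.+1%:R^-1.
have GP n : G (P n).
  suff : forall N, G [set m | forall k, (k < N)%N -> `|x k - u m k| <= n.+1%:R^-1].
    by move=> /(_ n.+1); apply: filterS => m H k kn; exact: H.
  elim=> [|N IH]; first exact: filterE.
  have e0 : 0 < n.+1%:R^-1 :> R by rewrite invr_gt0.
  have /cvgrPdist_le/(_ _ e0) HN := Hx N.
  apply: filterS2 IH HN => m H1 H2 k; rewrite ltnS leq_eqVlt => /predU1P[->//|].
  exact: H1.
have /choice[F HF] : forall nN : nat * nat, exists m, (nN.2 < m)%N /\ P nN.1 m.
  move=> [n N]; have GN : G [set m | (N < m)%N] by apply: ooG; exists N.+1.
  have /filter_ex[m [? ?]] : G ([set m | (N < m)%N] `&` P n) by exact: filterI GN (GP n).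
  by exists m.
pose s := fix s n := if n is m.+1 then F (m.+1, s m) else F (0, 0)%N.
exists x, s; split.
  apply: homo_ltn; first by move=> ? ? ?; exact: ltn_trans.
  by move=> n; have [] := HF (n.+1, s n).
have sP n : P n (s n) by case: n => [|n]; [have [] := HF (0, 0)%N|have [] := HF (n.+1, s n)].
move=> k; apply/cvgrPdist_le => e e0.
exists (maxn k (Num.truncn e^-1)) => // n /=; rewrite geq_max => /andP[kn en].
apply: (le_trans (sP n k kn)).
rewrite -[leRHS]invrK lef_pV2 ?posrE ?invr_gt0//.
by rewrite (le_trans (ltW (truncnS_gt _)))// ler_nat.
Qed.

(** Real and imaginary parts are interleaved as even and odd coordinates. *)
Lemma diagonal_complex (A : nat -> nat -> R[i]) (M : nat -> R) :
  (forall m k, modulus (A m k) <= M k) ->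
  exists (X : nat -> R[i]) (s : nat -> nat), {homo s : m n / (m < n)%N} /\
   forall k, modulus (A (s n) k - X k) @[n --> \oo] --> (0 : R).
Proof.
move=> AM.
pose u m j := if odd j then complex.Im (A m j./2) else complex.Re (A m j./2).
have [m j|x [s [hs Hs]]] := @diagonal u (fun j => M j./2).
  rewrite /u; case: ifP => _; apply: le_trans (AM _ _); [exact: Im_le_modulus|exact: Re_le_modulus].
exists (fun k => (x k.*2 +i* x k.*2.+1)%C), s; split=> // k.
have H1 := Hs k.*2; have H2 := Hs k.*2.+1.
rewrite /u in H1 H2; rewrite odd_double doubleK/= in H1; rewrite oddS odd_double/= uphalf_double in H2.
have H3 : `|complex.Re (A (s n) k) - x k.*2| + `|complex.Im (A (s n) k) - x k.*2.+1| @[n --> \oo] --> (0 : R).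
  rewrite -(addr0 0) -[in X in _ --> X](normr0 R).
  have S0 (v : nat -> R) (l : R) : v @ \oo --> l -> (v n - l) @[n --> \oo] --> (0 : R).
    by move=> vl; rewrite -(subrr l); apply: cvgB => //; exact: cvg_cst.
  by apply: cvgD; apply: cvg_norm; exact: S0.
apply: (squeeze_cvgr _ (cvg_cst 0) H3); apply: nearW => n; rewrite modulus_ge0/=.
by apply: (le_trans (modulus_le_ReIm _)); case: (A (s n) k).
Qed.

(** Dominated convergence for series. *)
Lemma tannery (x : nat -> nat -> R) (b : nat -> R) : (forall n k, 0 <= x n k <= b k) ->
  cvgn (series b) -> (forall k, x n k @[n --> \oo] --> (0 : R)) ->
  forall e : R, 0 < e -> \forall n \near \oo, limn (series (x n)) <= e.
Proof.
move=> xb cb x0 e e0.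
have cx n : cvgn (series (x n)).
  by apply: (series_dominated_cvg _ cb) => k; have /andP[? ?] := xb n k; rewrite ger0_norm.
have e2 : 0 < e / 2 by rewrite divr_gt0.
have /cvgrPdist_le/(_ _ e2)[K _ HK] := tail_cvg0 cb.
have {}HK : tail b K <= e / 2.
  by have := HK K (leqnn K); rewrite /= sub0r normrN; exact: le_trans (ler_norm _).
have : (fun n => \sum_(k < K) x n k) @ \oo --> (0 : R).
  elim: (K) => [|N IH].
    rewrite (_ : (fun n => _) = cst 0); first exact: cvg_cst.
    by apply/funext => n; rewrite big_ord0.
  rewrite (_ : (fun n => _) = (fun n => \sum_(k < N) x n k + x n N)).
    suff : (fun n => \sum_(k < N) x n k + x n N) @ \oo --> (0 + 0 : R) by rewrite addr0.
    exact: cvgD IH (x0 N).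
  by apply/funext => n; rewrite big_ord_recr.
move=> /cvgrPdist_le/(_ _ e2); apply: filterS => n; rewrite sub0r normrN => Hn.
apply: limr_le; first exact: cx.
have b0 k : 0 <= b k by have /andP[] := xb n k; exact: le_trans.
apply: nearW => m; rewrite [e]splitr.
apply: (@le_trans _ _ (series (x n) (maxn m K))).
  by apply: series_mono; [move=> k; have /andP[] := xb n k|exact: leq_maxl].
have -> : series (x n) (maxn m K) = series (x n) K + (series (x n) (maxn m K) - series (x n) K).
  by rewrite addrC subrK.
apply: lerD; first by rewrite series_nat (le_trans (ler_norm _)).
apply: le_trans HK.
apply: (@le_trans _ _ (series b (maxn m K) - series b K)).
  rewrite !sub_series_geq ?leq_maxr//; apply: ler_sum => k _.
  by have /andP[] := xb n k.
by rewrite /tail lerD2r; apply: series_le_lim.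
Qed.

Lemma psum_null (c : nat -> nat -> R[i]) (b : nat -> R) (s : R) : 0 <= s ->
  (forall n k, modulus (c n k) * s ^+ k <= b k) -> cvgn (series b) ->
  (forall k, modulus (c n k) @[n --> \oo] --> (0 : R)) ->
  forall e : R, 0 < e -> \forall n \near \oo, forall z, modulus z <= s ->
    modulus (psum (c n) z) <= e.
Proof.
move=> s0 cb sb c0 e e0.
have x0 n k : 0 <= modulus (c n k) * s ^+ k <= b k.
  by rewrite cb mulr_ge0 ?modulus_ge0 ?exprn_ge0.
have x0' k : (fun n => modulus (c n k) * s ^+ k) @ \oo --> (0 : R).
  by rewrite -(mul0r (s ^+ k)); apply: cvgM; [exact: c0|exact: cvg_cst].
apply: filterS (tannery x0 sb x0' e0) => n H z zs.
apply: le_trans H; apply: psum_le => //.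
apply: (series_dominated_cvg _ sb) => k; have /andP[? ?] := x0 n k.
by rewrite ger0_norm.
Qed.

Lemma psumB a b z : disc_coef a -> disc_coef b -> modulus z < 1 ->
  psum (fun n => a n - b n) z = psum a z - psum b z.
Proof.
move=> da db z1; apply: psum_eq; rewrite /power_sum_at.
rewrite (_ : series _ = (fun n => series (fun n => a n * z ^+ n) n - series (fun n => b n * z ^+ n) n)).
  by apply: cvgB; exact: disc_psum_cvg.
apply/funext => n; rewrite !series_nat -sumrB; apply: eq_bigr => i _.
by rewrite mulrBl.
Qed.

Lemma disc_coefB a b : disc_coef a -> disc_coef b -> disc_coef (fun n => a n - b n).
Proof.
move=> da db s s01; have [M HM] := da s s01; have [N HN] := db s s01.
exists (M + N) => n; apply: le_trans (lerD (HM n) (HN n)).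
rewrite -mulrDl ler_wpM2r ?ler_modulusB// exprn_ge0//; case/andP: s01 => s0 _; exact: ltW.
Qed.

End Subsequences.

(** * Boundedness and compactness of the operator *)

Section SufficiencyTheorems.
Context {R : realType}.
Local Notation mu := (@lebesgue_measure R).
Implicit Types (a b g : nat -> R[i]) (z w : R[i]) (p q r s : R).

Lemma mdiscB_le a b z : disc_coef a -> disc_coef b ->
  mdisc (fun n => a n - b n)%R z <= mdisc a z + mdisc b z.
Proof.
move=> da db; have [z1|z1] := ltP (modulus z) 1; last by rewrite !mdisc_out// addr0.
by rewrite !mdisc_in// psumB// ler_modulusB.
Qed.

Lemma integral_le_sum (d : measure_display) (T : measurableType d)
    (m : {measure set T -> \bar R}) (F G H : T -> \bar R) (c B1 B2 : R) :
  measurable_fun setT F -> measurable_fun setT G -> measurable_fun setT H ->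
  (forall x, (0 <= F x)%E) -> (forall x, (0 <= G x)%E) -> (forall x, (0 <= H x)%E) ->
  0 <= c -> (forall x, (F x <= c%:E * (G x + H x))%E) ->
  (\int[m]_x G x <= B1%:E)%E -> (\int[m]_x H x <= B2%:E)%E ->
  (\int[m]_x F x <= (c * (B1 + B2))%:E)%E.
Proof.
move=> mF mG mH F0 G0 H0 c0 le HG HH.
apply: (@le_trans _ _ (\int[m]_v (c%:E * (G v + H v)))%E).
  apply: ge0_le_integral => //.
  by apply: emeasurable_funM => //; exact: emeasurable_funD.
rewrite ge0_integralZl//; last 2 first.
- exact: emeasurable_funD.
- by move=> v _; rewrite adde_ge0.
rewrite EFinM EFinD lee_wpmul2l ?lee_fin// ge0_integralD//.
exact: leeD.
Qed.

Lemma berg_sub p a b (B1 B2 : R) : 0 < p -> disc_coef a -> disc_coef b ->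
  (berg p a <= B1%:E)%E -> (berg p b <= B2%:E)%E ->
  (berg p (fun n => a n - b n)%R <= (2 `^ p * (B1 + B2))%:E)%E.
Proof.
move=> p0 da db Ha Hb; have dab := disc_coefB da db.
rewrite -berg_prod//; rewrite -berg_prod// in Ha; rewrite -berg_prod// in Hb.
have m c : disc_coef c -> measurable_fun setT (fun v : R * R => (mdisc c (v.1 +i* v.2)%C `^ p)%:E).
  move=> dc; apply/measurable_EFinP; apply: (measurableT_comp (measurable_powR p)).
  exact: measurable_mdisc.
have le v : ((mdisc (fun n => a n - b n)%R v `^ p)%:E <=
   (2 `^ p)%:E * ((mdisc a v `^ p)%:E + (mdisc b v `^ p)%:E))%E.
  rewrite -EFinD -EFinM lee_fin.
  apply: le_trans (powRD_le p0 (mdisc_ge0 _ _) (mdisc_ge0 _ _)).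
  by rewrite ge0_ler_powR ?nnegrE ?addr_ge0 ?mdisc_ge0 ?(ltW p0)// mdiscB_le.
have ma := m a da; have mb := m b db; have mab := m _ dab.
have pos c v : (0 <= (mdisc c v `^ p)%:E)%E by rewrite lee_fin powR_ge0.
apply: (@integral_le_sum _ _ (mu \x mu)%E _
  (fun v : R * R => (mdisc a (v.1 +i* v.2)%C `^ p)%:E)
  (fun v : R * R => (mdisc b (v.1 +i* v.2)%C `^ p)%:E) _ _ _ mab ma mb _ _ _ _ _ Ha Hb).
- by move=> v; exact: pos.
- by move=> v; exact: pos.
- by move=> v; exact: pos.
- exact: powR_ge0.
- by move=> v; exact: le.
Qed.

(** Fatou's lemma for a pointwise limit and a uniform bound of the integrals. *)
Lemma fatou_bound (d : measure_display) (T : measurableType d) (m : {measure set T -> \bar R})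
    (F : nat -> T -> \bar R) (f : T -> \bar R) (c : \bar R) :
  (forall n, measurable_fun setT (F n)) -> (forall n x, (0 <= F n x)%E) ->
  (forall x, F^~ x @ \oo --> f x) -> (forall n, (\int[m]_x F n x <= c)%E) ->
  (\int[m]_x f x <= c)%E.
Proof.
move=> mF F0 Ff Fc.
have -> : (\int[m]_x f x = \int[m]_x limn_einf (F^~ x))%E.
  by apply: eq_integral => x _; rewrite (cvg_limn_einf_sup (Ff x)).1.
apply: (le_trans (fatou _ _ _ _)) => //.
rewrite limn_einf_lim; apply: lime_le; first exact: is_cvg_einfs.
by apply: nearW => n; apply: (@le_trans _ _ (\int[m]_x F n x)%E) => //; apply: ereal_inf_lbound; exists n => /=.
Qed.

Lemma berg_fatou p (a : nat -> nat -> R[i]) b (B : R) : 0 < p ->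
  (forall n, disc_coef (a n)) -> disc_coef b ->
  (forall z, modulus z < 1 -> modulus (psum (a n) z - psum b z) @[n --> \oo] --> (0 : R)) ->
  (forall n, (berg p (a n) <= B%:E)%E) -> (berg p b <= B%:E)%E.
Proof.
move=> p0 da db ab aB.
rewrite -berg_prod//; apply: (@fatou_bound _ _ (mu \x mu)%E (fun n (v : R * R) => (mdisc (a n) (v.1 +i* v.2)%C `^ p)%:E)).
- move=> n; apply/measurable_EFinP; apply: (measurableT_comp (measurable_powR p)).
  exact: measurable_mdisc.
- by move=> n v; rewrite lee_fin powR_ge0.
- move=> v; set z := (v.1 +i* v.2)%C; apply: cvg_EFin; first exact: nearW.
  have Hm : mdisc (a n) z @[n --> \oo] --> mdisc b z.
    have [z1|z1] := ltP (modulus z) 1; last first.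
      by rewrite mdisc_out//; under eq_fun do rewrite mdisc_out//; exact: cvg_cst.
    rewrite mdisc_in//; under eq_fun do rewrite mdisc_in//.
    apply/cvgrPdist_le => e e0; have /cvgrPdist_le/(_ _ e0) := ab z z1.
    apply: filterS => n; rewrite sub0r normrN ger0_norm ?modulus_ge0// => H.
    by rewrite distrC (le_trans _ H)// modulus_dist_lip.
  have nc : continuous (fun u : R => `|u| `^ p).
    by apply: continuous_powR_comp => // u; exact: norm_continuous.
  have := cvg_comp _ _ Hm (nc (mdisc b z)).
  rewrite /= ger0_norm ?mdisc_ge0// => H; apply: cvg_trans H.
  by apply: near_eq_cvg; apply: nearW => n /=; rewrite ger0_norm ?mdisc_ge0.
- by move=> n; rewrite berg_prod.
Qed.

(** Bound the partial sums at the radius [rho] between [r0] and 1, and sum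
    against the coefficients of [g]. *)
Lemma psum_small_disc p g r0 : 1 < p -> disc_coef g -> 2^-1 <= r0 < 1 -> exists2 C : R, 0 < C &
  forall a (Phi : R), disc_coef a -> 0 < Phi -> (berg p a <= Phi%:E)%E ->
  forall z, modulus z <= r0 -> modulus (psum (rhaly_coef g a) z) <= C * Phi `^ p^-1.
Proof.
move=> p1 dg /andP[r02 r01].
have r00 : 0 < r0 by rewrite (lt_le_trans _ r02)// invr_gt0.
pose rho := (1 + r0) / 2.
have rho1 : rho < 1 by rewrite /rho; lra.
have r0rho : r0 < rho by rewrite /rho; lra.
have rho2 : 2^-1 <= rho by lra.
have rho0 : 0 < rho by lra.
have [C C0 HC] := partial_sum_bound p1 (introT andP (conj rho2 rho1)).
have sg : cvgn (series (fun n => modulus (g n) * (r0 / rho) ^+ n)).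
  apply: disc_summable => //; rewrite divr_ge0 ?(ltW r00) ?(ltW rho0)//=.
  by rewrite ltr_pdivrMr// mul1r.
have rr0 : 0 <= r0 / rho by rewrite divr_ge0 ?(ltW r00) ?(ltW rho0).
set G := limn (series (fun n => modulus (g n) * (r0 / rho) ^+ n)) in sg.
have G0 : 0 <= G.
  have := series_le_lim 0 _ sg; rewrite /series/= big_geq//; apply => k.
  by rewrite mulr_ge0 ?modulus_ge0 ?exprn_ge0.
exists (C * (G + 1)); first by rewrite mulr_gt0// ltr_wpDl.
move=> a Phi da Phi0 aPhi z zr.
have dm := disc_coef_rhaly dg da.
have r01' : 0 <= r0 < 1 by rewrite ltW.
apply: (le_trans (psum_le (disc_summable dm r01') zr)).
have CP : 0 < C * Phi `^ p^-1 by rewrite mulr_gt0 ?powR_gt0.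
have term k : modulus (rhaly_coef g a k) * r0 ^+ k <=
    C * Phi `^ p^-1 * (modulus (g k) * (r0 / rho) ^+ k).
  have := HC a Phi da Phi0 aPhi k; rewrite -ler_pdivlMr ?exprn_gt0// => H.
  rewrite /rhaly_coef modulusM -mulrA [leRHS]mulrCA ler_wpM2l ?modulus_ge0//.
  rewrite expr_div_n mulrA mulrAC ler_wpM2r// exprn_ge0// ltW//.
have sC := cvg_seriesZ (k := C * Phi `^ p^-1) sg.
apply: (@le_trans _ _ (limn (series (fun k => C * Phi `^ p^-1 * (modulus (g k) * (r0 / rho) ^+ k))))).
  apply: limr_le; first exact: disc_summable.
  apply: nearW => m; apply: (@le_trans _ _ (series (fun k => C * Phi `^ p^-1 * (modulus (g k) * (r0 / rho) ^+ k)) m)).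
    by rewrite !series_nat; apply: ler_sum => k _.
  apply: series_le_lim => // k.
  by rewrite mulr_ge0 ?(ltW CP)// mulr_ge0 ?modulus_ge0 ?exprn_ge0.
by rewrite limn_seriesZ// -/G [leRHS]mulrAC ler_wpM2l ?(ltW CP)// lerDl.
Qed.

(** The main estimate, in which [psum_small_disc] controls the supremum. *)
Lemma multiplier_bound p q g (K r0 : R) : 1 < p -> p < q -> 2 / p - q^-1 < 1 -> disc_coef g ->
  0 < K -> 2^-1 <= r0 < 1 ->
  (forall r, r0 <= r < 1 -> (circ q (theta g) r <= (K * (1 - r) `^ ((2 / p - q^-1 - 1) * q))%:E)%E) ->
  exists2 M : R, 0 < M & forall a (Phi : R), disc_coef a -> 0 < Phi -> (berg p a <= Phi%:E)%E ->
    (berg q (rhaly_coef g a) <= (M * Phi `^ (q / p))%:E)%E.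
Proof.
move=> p1 pq al1 dg K0 r01 HK.
have q0 : 0 < q by apply: lt_trans pq; exact: lt_trans p1.
have [C C0 HC] := main_estimate p1 pq al1.
have [D D0 HD] := psum_small_disc p1 dg r01.
exists (C * (D `^ q + K)); first by rewrite mulr_gt0// addr_gt0 ?powR_gt0.
move=> a Phi da Phi0 aPhi.
have S0 : 0 <= D * Phi `^ p^-1 by rewrite mulr_ge0 ?powR_ge0 ?(ltW D0).
apply: (le_trans (HC g a K Phi r0 _ dg da (ltW K0) Phi0 aPhi r01 S0 HK (HD a Phi da Phi0 aPhi))).
rewrite lee_fin powRM ?powR_ge0 ?(ltW D0)// -powRrM [p^-1 * q]mulrC.
by rewrite -mulrDl mulrA.
Qed.

End SufficiencyTheorems.

Section SufficientConditions.
Context {R : realType}.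
Local Notation mu := (@lebesgue_measure R).
Implicit Types (a b g eta : nat -> R[i]) (z w : R[i]) (p q r s : R).

(** When [B = 0] the bounds for all [Phi > 0] force [H = 0]. *)
Lemma root_of_scaling_bound p q (H B M : R) : 0 < p -> 0 < q -> 0 < M -> 0 <= H -> 0 <= B ->
  (forall Phi : R, 0 < Phi -> B <= Phi -> H <= M * Phi `^ (q / p)) ->
  H `^ q^-1 <= M `^ q^-1 * B `^ p^-1.
Proof.
move=> p0 q0 M0 H0 B0 HB; have qp : 0 < q / p by rewrite divr_gt0.
have {HB} : H <= M * B `^ (q / p).
  have [B00|Bn] := eqVneq B 0; last by apply: HB => //; rewrite lt_neqAle eq_sym Bn.
  rewrite B00 powR0 ?gt_eqF// mulr0; apply/ler_addgt0Pl => e e0; rewrite addr0.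
  have x0 : 0 < e / M by rewrite divr_gt0.
  have := HB ((e / M) `^ (q / p)^-1); rewrite B00 powR_ge0 powR_gt0// => /(_ isT isT).
  by rewrite -powRrM mulVf ?gt_eqF// powRr1 ?(ltW x0)// mulrC divfK// gt_eqF.
move=> HMB; apply: (@le_trans _ _ ((M * B `^ (q / p)) `^ q^-1)).
  by rewrite ge0_ler_powR ?nnegrE ?invr_ge0 ?(ltW q0) ?mulr_ge0 ?powR_ge0 ?(ltW M0).
rewrite powRM ?powR_ge0 ?(ltW M0)// -powRrM.
by rewrite (_ : q / p / q = p^-1)//; field; rewrite !gt_eqF.
Qed.

(** [multiplier_bound] is only available for [Phi > 0]; homogeneity in [Phi]
    gives the operator norm. *)
Lemma bounded_of_lipschitz p q eta (K r0 : R) : 1 < p -> p < q -> 2 / p - q^-1 < 1 -> disc_coef eta ->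
  0 < K -> 2^-1 <= r0 < 1 ->
  (forall r, r0 <= r < 1 -> (circ q (theta eta) r <= (K * (1 - r) `^ ((2 / p - q^-1 - 1) * q))%:E)%E) ->
  bounded_operator (bergman p) (bergman_norm p) (bergman q) (bergman_norm q) (rhaly eta).
Proof.
move=> p1 pq al1 de K0 r01 HK.
have p0 : 0 < p by exact: lt_trans p1.
have q0 : 0 < q by exact: lt_trans pq.
have [M M0 HM] := multiplier_bound p1 pq al1 de K0 r01 HK.
have finite a : disc_coef a -> berg p a \is a fin_num -> berg q (rhaly_coef eta a) \is a fin_num.
  move=> da af; rewrite ge0_fin_numE ?berg_ge0//.
  have B0 : 0 <= fine (berg p a) by apply: fine_ge0; exact: berg_ge0.
  apply: (le_lt_trans (HM a (fine (berg p a) + 1) da _ _)); rewrite ?ltry ?ltr_wpDl//.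
  by rewrite -[X in (X <= _)%E](fineK af) lee_fin lerDl.
split=> [f /(bergmanP p0)[a [da fa af _]]|].
  apply: (bergman_psum q0 (disc_coef_rhaly de da) (rhalyE de da fa)).
  by rewrite -ge0_fin_numE; [exact: finite|exact: berg_ge0].
exists (M `^ q^-1) => f /(bergmanP p0)[a [da fa af ->]].
rewrite (bergman_normE q0 (disc_coef_rhaly de da) (rhalyE de da fa)).
have hf := finite a da af.
apply: root_of_scaling_bound => //; [exact/fine_ge0/berg_ge0|exact/fine_ge0/berg_ge0|].
move=> Phi Phi0 BP; rewrite -lee_fin (fineK hf); apply: HM => //.
by rewrite -(fineK af) lee_fin.
Qed.

Lemma partial_sumB a b n : partial_sum (fun k => a k - b k) n = partial_sum a n - partial_sum b n.
Proof. by rewrite /partial_sum sumrB. Qed.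

(** Inverse of [partial_sum]. *)
Definition differences (X : nat -> R[i]) (n : nat) : R[i] :=
  X n - (if n is m.+1 then X m else 0).

Lemma partial_sum_differences X : partial_sum (differences X) = X.
Proof.
apply/funext; elim=> [|n IH]; rewrite /partial_sum big_ord_recr/=.
  by rewrite big_ord0 add0r /differences subr0.
by rewrite [X in X + _]IH /differences addrC subrK.
Qed.

Lemma disc_coef_differences X : disc_coef X -> disc_coef (differences X).
Proof.
move=> dX s /[dup] s01 /andP[s0 s1]; have [M HM] := dX s s01; exists (M + M) => n.
have M0 : 0 <= M by rewrite (le_trans _ (HM 0))// mulr_ge0 ?modulus_ge0 ?exprn_ge0 ?(ltW s0).
apply: (@le_trans _ _ ((modulus (X n) + modulus (if n is m.+1 then X m else 0)) * s ^+ n)).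
  by rewrite ler_wpM2r ?exprn_ge0 ?(ltW s0)// ler_modulusB.
rewrite mulrDl lerD//; case: n => [|n]; first by rewrite modulus0 mul0r.
rewrite (le_trans _ (HM n))// ler_wpM2l ?modulus_ge0// exprS ler_piMl ?exprn_ge0 ?(ltW s0) ?(ltW s1)//.
Qed.

Lemma disc_coef1 : disc_coef (fun=> 1 : R[i]).
Proof.
move=> s /andP[s0 s1]; exists 1 => n.
by rewrite modulus1 mul1r exprn_ile1 ?(ltW s0) ?(ltW s1).
Qed.

(** The subsequence is chosen for the partial sums, which are bounded coordinatewise
    by [partial_sum_bound]. The differences [u n] are bounded in [A^p] and their partial
    sums tend to 0, so that in [main_estimate] the supremum over [|z| <= r0] tends to 0
    for each [r0], while [kap] is chosen beforehand. *)
Lemma compact_of_little_lipschitz p q eta : 1 < p -> p < q -> 2 / p - q^-1 < 1 -> disc_coef eta ->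
  (forall K : R, 0 < K -> exists2 r0 : R, 2^-1 <= r0 < 1 & forall r, r0 <= r < 1 ->
     (circ q (theta eta) r <= (K * (1 - r) `^ ((2 / p - q^-1 - 1) * q))%:E)%E) ->
  compact_operator (bergman p) (bergman_norm p) (bergman q) (bergman_norm q) (rhaly eta).
Proof.
move=> p1 pq al1 de Hlit.
have p0 : 0 < p by exact: lt_trans p1.
have q0 : 0 < q by exact: lt_trans pq.
have [r1 r101 Hr1] := Hlit 1 ltr01.
have [XY _] := bounded_of_lipschitz p1 pq al1 de ltr01 r101 Hr1.
split=> // f Xf [M0 HM0].
have /choice[a Ha] := fun n => bergmanP p0 (Xf n).
have da n : disc_coef (a n) by have [] := Ha n.
pose B := (`|M0| + 1) `^ p.
have B0 : 0 < B by rewrite powR_gt0// ltr_wpDl.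
have aB n : (berg p (a n) <= B%:E)%E.
  have [_ _ af nf] := Ha n; rewrite -(fineK af) lee_fin.
  have b0 : 0 <= fine (berg p (a n)) by apply: fine_ge0; exact: berg_ge0.
  have := HM0 n; rewrite nf => H.
  have -> : fine (berg p (a n)) = (fine (berg p (a n)) `^ p^-1) `^ p.
    by rewrite -powRrM mulVf ?gt_eqF// powRr1.
  rewrite ge0_ler_powR ?nnegrE ?(ltW p0) ?powR_ge0 ?addr_ge0//.
  by rewrite (le_trans H)// (le_trans (ler_norm _))// lerDl.
pose A n := partial_sum (a n).
have bound (rho : R) : 2^-1 <= rho < 1 -> exists2 D : R, 0 < D & forall n k, modulus (A n k) * rho ^+ k <= D.
  move=> rho1; have [C C0 HC] := partial_sum_bound p1 rho1.
  exists (C * B `^ p^-1); first by rewrite mulr_gt0 ?powR_gt0.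
  by move=> n k; exact: HC.
have h2 : 2^-1 <= (2^-1 : R) < 1 by rewrite lexx invf_lt1 ?ltr1n.
have [D2 _ HD2] := bound 2^-1 h2.
have [n k|X [s [hs Hs]]] := @diagonal_complex R A (fun k => D2 * 2 ^+ k).
  have := HD2 n k; rewrite -ler_pdivlMr ?exprn_gt0 ?invr_gt0//.
  by rewrite exprVn invrK.
have boundX (rho D : R) : 0 < rho -> (forall n k, modulus (A n k) * rho ^+ k <= D) ->
    forall k, modulus (X k) * rho ^+ k <= D.
  move=> rho0 HD k; apply/ler_addgt0Pr => e e0.
  have rk : 0 < rho ^+ k by rewrite exprn_gt0.
  have /cvgrPdist_le/(_ (e / rho ^+ k) (divr_gt0 e0 rk))[N _ HN] := Hs k.
  have := HN N (leqnn N); rewrite /= sub0r normrN ger0_norm ?modulus_ge0// modulusBC => H.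
  apply: (@le_trans _ _ ((modulus (X k - A (s N) k) + modulus (A (s N) k)) * rho ^+ k)).
    by rewrite ler_wpM2r ?(ltW rk)// (le_trans _ (ler_modulusD _ _))// subrK.
  by rewrite mulrDl addrC lerD// -ler_pdivlMr.
have dX : disc_coef X.
  move=> r /andP[rp rr]; pose rho := Num.max 2^-1 r.
  have rho1 : 2^-1 <= rho < 1 by rewrite le_max lexx gt_max rr andbT/= invf_lt1 ?ltr1n.
  have rho0 : 0 < rho by case/andP: rho1 => /(lt_le_trans _) + _; apply; rewrite invr_gt0.
  have [D D0 HD] := bound rho rho1; exists D => k.
  apply: le_trans (boundX rho D rho0 HD k); rewrite ler_wpM2l ?modulus_ge0//.
  apply: lerXn2r; rewrite ?nnegrE ?(ltW rp) ?(ltW rho0)//; by rewrite le_max lexx orbT.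
pose b := differences X; have db : disc_coef b by exact: disc_coef_differences.
pose u n k := a (s n) k - b k.
have du n : disc_coef (u n) by exact: disc_coefB.
have Au n k : partial_sum (u n) k = A (s n) k - X k.
  by rewrite /u partial_sumB /b partial_sum_differences.
have null g (r : R) : disc_coef g -> 2^-1 <= r < 1 -> forall e : R, 0 < e -> \forall n \near \oo,
    forall z, modulus z <= r -> modulus (psum (rhaly_coef g (u n)) z) <= e.
  move=> dg /andP[r2 rr1]; pose rho := (1 + r) / 2.
  have rp : 0 < r by rewrite (lt_le_trans _ r2)// invr_gt0.
  have rho2 : 2^-1 <= rho by rewrite /rho; lra.
  have rho1 : rho < 1 by rewrite /rho; lra.
  have rrho : r < rho by rewrite /rho; lra.
  have rho0 : 0 < rho by exact: lt_trans rrho.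
  have [D D0 HD] := bound rho (introT andP (conj rho2 rho1)).
  have HX := boundX rho D rho0 HD.
  have q01 : 0 <= r / rho < 1.
    by rewrite divr_ge0 ?(ltW rp) ?(ltW rho0)//= ltr_pdivrMr// mul1r.
  have sb := cvg_seriesZ (k := D + D) (disc_summable dg q01).
  apply: (psum_null _ _ sb); first exact: ltW.
    move=> n k; rewrite /rhaly_coef Au modulusM -mulrA [leRHS]mulrCA ler_wpM2l ?modulus_ge0//.
    rewrite expr_div_n mulrA ler_pdivlMr ?exprn_gt0// mulrAC ler_wpM2r ?exprn_ge0 ?(ltW rp)//.
    apply: le_trans (lerD (HD (s n) k) (HX k)).
    by rewrite -mulrDl ler_wpM2r ?exprn_ge0 ?(ltW rho0)// ler_modulusB.
  move=> k; under eq_fun do rewrite /rhaly_coef Au modulusM.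
  by rewrite -(mulr0 (modulus (g k))); apply: cvgM; [exact: cvg_cst|exact: Hs].
have ptw z : modulus z < 1 -> modulus (psum (a (s n)) z - psum b z) @[n --> \oo] --> (0 : R).
  move=> z1; apply/cvgrPdist_le => e e0.
  pose r := Num.max 2^-1 (modulus z).
  have r01 : 2^-1 <= r < 1 by rewrite le_max lexx gt_max z1 andbT/= invf_lt1 ?ltr1n.
  have e2 : 0 < e / 2 by rewrite divr_gt0.
  apply: filterS (null _ r disc_coef1 r01 _ e2) => n H.
  rewrite sub0r normrN ger0_norm ?modulus_ge0// -psumB// -(psum_partial_sum (du n) z1).
  have -> : partial_sum (u n) = rhaly_coef (fun=> 1) (u n).
    by apply/funext => k; rewrite /rhaly_coef mul1r.
  rewrite modulusM [e]splitr -[e / 2 + e / 2]mulr2n -[_ *+ 2]mulr_natl.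
  apply: ler_pM; rewrite ?modulus_ge0//; last by apply: H; rewrite le_max lexx orbT.
  by rewrite (le_trans (ler_modulusB _ _))// modulus1; move: z1; lra.
have bB : (berg p b <= B%:E)%E.
  exact: (berg_fatou p0 (fun n => da (s n)) db ptw (fun n => aB (s n))).
pose Phi := 2 `^ p * (B + B).
have Phi0 : 0 < Phi by rewrite mulr_gt0 ?powR_gt0 ?addr_gt0.
have uPhi n : (berg p (u n) <= Phi%:E)%E.
  exact: (berg_sub p0 (da (s n)) db (aB (s n)) bB).
have [M MM0 HM] := multiplier_bound p1 pq al1 de ltr01 r101 Hr1.
pose h := psum (rhaly_coef eta b).
exists s, h; split=> //.
  apply: (bergman_psum q0 (disc_coef_rhaly de db)) => //.
  by apply: (le_lt_trans (HM b B db B0 bB)); rewrite ltry.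
have nE n : bergman_norm q (rhaly eta (f (s n)) \- h) = fine (berg q (rhaly_coef eta (u n))) `^ q^-1.
  apply: (bergman_normE q0 (disc_coef_rhaly de (du n))) => z z1 /=.
  have [das fas _ _] := Ha (s n).
  have E : rhaly_coef eta (u n) = fun k => rhaly_coef eta (a (s n)) k - rhaly_coef eta b k.
    by apply/funext => k; rewrite /rhaly_coef Au mulrBr /b partial_sum_differences.
  have d1 := disc_coef_rhaly de das; have d2 := disc_coef_rhaly de db.
  by rewrite E (psumB d1 d2 z1) (rhalyE de das fas z1).
have [C C0 HC] := main_estimate p1 pq al1.
apply/cvgrPdist_le => e e0.
(* both terms of the main estimate equal e^q / 2 for these values *)
pose S := (e `^ q / (2 * C)) `^ q^-1; pose kap := e `^ q / (2 * C * Phi `^ (q / p)).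
have S0 : 0 < S by rewrite powR_gt0// divr_gt0 ?powR_gt0// mulr_gt0.
have kap0 : 0 < kap by rewrite divr_gt0 ?powR_gt0// !mulr_gt0// powR_gt0.
have [r0 r001 Hr0] := Hlit kap kap0.
apply: filterS (null eta r0 de r001 S S0) => n Hn.
rewrite sub0r normrN nE ger0_norm ?powR_ge0//.
have := HC eta (u n) kap Phi r0 S de (du n) (ltW kap0) Phi0 (uPhi n) r001 (ltW S0) Hr0 Hn.
have -> : C * (S `^ q + kap * Phi `^ (q / p)) = e `^ q.
  have SE : S `^ q = e `^ q / (2 * C).
    by rewrite /S -powRrM mulVf ?gt_eqF// powRr1// divr_ge0 ?powR_ge0// mulr_ge0// ltW.
  rewrite SE /kap; have := powR_gt0 (q / p) Phi0; move: (Phi `^ _) (e `^ q) => x y x0.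
  by field; rewrite !gt_eqF.
have n0 := berg_ge0 q (rhaly_coef eta (u n)).
case: (berg q _) n0 => [x| |]//; rewrite ?lee_fin/= => x0 xe.
have -> : e = (e `^ q) `^ q^-1 by rewrite -powRrM mulfV ?gt_eqF// powRr1// ltW.
by rewrite ge0_ler_powR ?nnegrE ?invr_ge0 ?(ltW q0) ?powR_ge0.
Qed.

End SufficientConditions.

(** * Test functions *)

Section TestFunctions.
Context {R : realType}.
Local Notation mu := (@lebesgue_measure R).
Implicit Types (a c g eta : nat -> R[i]) (z w : R[i]) (p q r s be : R).

Definition geom be (n : nat) : R[i] := be%:C%C ^+ n.

(** The function [(1 - z) w (1 + w) / (1 - w)^3] with [w = be * z]: its partial sums of
    coefficients are [n^2 be^n]. *)
Definition test_coef be : nat -> R[i] := differences (theta (theta (geom be))).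

Lemma disc_coef_geom be : 0 <= be <= 1 -> disc_coef (geom be).
Proof.
move=> /andP[b0 b1] s /andP[s0 s1]; exists 1 => n.
rewrite /geom modulusX modulusR ger0_norm// -exprMn exprn_ile1 ?mulr_ge0 ?(ltW s0)//.
by rewrite mulr_ile1 ?(ltW s0) ?(ltW s1).
Qed.

Lemma disc_coef_test be : 0 <= be <= 1 -> disc_coef (test_coef be).
Proof.
by move=> b01; apply: disc_coef_differences; do 2 apply: disc_coef_theta; exact: disc_coef_geom.
Qed.

(** Three multiplications by [1 - w] leave only the coefficients of index 1 and 2
    of [sum n^2 w^n]. *)
Lemma psum_square_geom be z : 0 <= be <= 1 -> modulus z < 1 ->
  (1 - be%:C%C * z) ^+ 3 * psum (theta (theta (geom be))) z = be%:C%C * z + (be%:C%C * z) ^+ 2.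
Proof.
move=> b01 z1; set B : R[i] := be%:C%C.
have dA : disc_coef (theta (theta (geom be))).
  by do 2 apply: disc_coef_theta; exact: disc_coef_geom.
pose sh (a : nat -> R[i]) n := a n - (if n is m.+1 then B * a m else 0).
have dsh a : disc_coef a -> disc_coef (sh a).
  move=> da; have -> : sh a = (fun n => a n - (if n is m.+1 then B * a m else 0)) by [].
  apply: disc_coefB => // s /[dup] s01 /andP[s0 s1]; have [M HM] := da s s01; exists (Num.max 0 M) => n.
  case: n => [|n]; first by rewrite modulus0 mul0r le_max lexx.
  rewrite modulusM modulusR exprS mulrACA; rewrite le_max; apply/orP; right.
  rewrite (le_trans _ (HM n))// ler_piMl ?mulr_ge0 ?modulus_ge0 ?exprn_ge0 ?(ltW s0)//.
  by case/andP: b01 => b0 b1; rewrite ger0_norm// mulr_ile1 ?(ltW s0) ?(ltW s1).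
set A := theta (theta (geom be)) in dA *.
have T a : disc_coef a -> (1 - B * z) * psum a z = psum (sh a) z by move=> da; exact: psum_telescope.
rewrite -[3%N]/(2.+1) exprSr -mulrA (T A dA) exprSr -mulrA (T _ (dsh _ dA)) expr1 (T _ (dsh _ (dsh _ dA))).
have E n : sh (sh (sh A)) n = (if n == 1 then B else if n == 2 then B ^+ 2 else 0).
  rewrite /A /sh /theta /geom -/B; case: n => [|[|[|n]]] /=; rewrite ?expr0 ?expr1.
  - by ring.
  - by ring.
  - by ring.
  - have -> : n.+3%:R = n%:R + 3 :> R[i] by rewrite -natrD addn3.
    have -> : n.+2%:R = n%:R + 2 :> R[i] by rewrite -natrD addn2.
    have -> : n.+1%:R = n%:R + 1 :> R[i] by rewrite natr1.
    by rewrite !exprS; move: (n%:R) (B ^+ n) (B) => x y v; ring.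
apply: psum_eq; rewrite /power_sum_at; apply: cvg_near_cst; exists 3%N => // n /= n3.
rewrite series_nat -(subnKC n3) big_split_ord/= [X in _ + X]big1 ?addr0 => [|i _].
  by rewrite !big_ord_recl big_ord0/= !E/=; ring.
by rewrite E/= mul0r.
Qed.

(** One factor [1 - w] of the denominator is compensated by
    [|1 - z| <= 2 |1 - w|]. *)
Lemma test_coef_le be z : 0 <= be < 1 -> modulus z < 1 ->
  modulus (psum (test_coef be) z) <= 4 * modulus (1 - be%:C%C * z) `^ (- 2).
Proof.
move=> /andP[b0 b1] z1; have b01 : 0 <= be <= 1 by rewrite b0 ltW.
have H := psum_square_geom b01 z1.
have dA : disc_coef (theta (theta (geom be))).
  by do 2 apply: disc_coef_theta; exact: disc_coef_geom.
have := psum_partial_sum (disc_coef_test b01) z1; rewrite /test_coef partial_sum_differences => <-.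
set P := psum _ z in H *; set w := be%:C%C * z in H *.
have wle : modulus w <= be.
  by rewrite modulusM modulusR ger0_norm// ler_piMr// ltW.
have w1 : modulus w < 1 by exact: le_lt_trans b1.
set d := modulus (1 - w).
have d0 : 1 - be <= d.
  by rewrite /d; have := lerB_modulus 1 w; rewrite modulus1; lra.
have dp : 0 < d by move: d0 b1; lra.
have PE : d ^+ 3 * modulus P <= 2.
  rewrite /d -modulusX -modulusM H (le_trans (ler_modulusD _ _))//.
  rewrite modulusX; have := modulus_ge0 w; move: w1; nra.
have zE : modulus (1 - z) <= 2 * d.
  have := ler_modulus_dist 1 w z; rewrite -/d => /le_trans; apply.
  have -> : w - z = (be - 1)%:C%C * z by rewrite /w rmorphB/= mulrBl rmorph1 mul1r.
  rewrite modulusM modulusR ltr0_norm ?subr_lt0// opprB.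
  have := modulus_ge0 z; move: z1 d0 b1; nra.
rewrite modulusM powRN (_ : 2 = 2%:R :> R)// powR_mulrn ?(ltW dp)//.
rewrite ler_pdivlMr ?exprn_gt0//.
apply: (@le_trans _ _ (2 * d * modulus P * d ^+ 2)).
  by rewrite ler_wpM2r ?sqr_ge0// ler_wpM2r ?modulus_ge0.
move: PE; rewrite (_ : 2 * d * modulus P * d ^+ 2 = 2 * (d ^+ 3 * modulus P)); last by ring.
lra.
Qed.

(** The kernel estimate at the radius [be * r], then the integral of a power of
    [1 - be * r]. *)
Lemma test_berg p : 1 < p -> exists2 C : R, 0 < C & forall be, 2^-1 <= be < 1 ->
  (berg p (test_coef be) <= (C * (1 - be) `^ (2 - 2 * p))%:E)%E.
Proof.
move=> p1; have p0 : 0 < p by exact: lt_trans p1.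
have k1 : 1 < 2 * p by lra.
have [C C0 HC] := kernel_integral k1.
exists (4 `^ p * C * (p - 1)^-1); first by rewrite !mulr_gt0 ?powR_gt0// invr_gt0; lra.
move=> be /andP[b2 b1]; have b0 : 0 < be by rewrite (lt_le_trans _ b2)// invr_gt0.
have b01 : 0 <= be < 1 by rewrite ltW.
have b01' : 0 <= be <= 1 by rewrite !ltW.
have dt := disc_coef_test b01'.
have D0 : 0 <= 4 `^ p * C by rewrite mulr_ge0 ?powR_ge0// ltW.
have step r : 0 < r < 1 -> (circ p (test_coef be) r <= (4 `^ p * C * (1 - be * r) `^ (1 - 2 * p))%:E)%E.
  move=> /andP[r0 r1]; have r01 : 0 <= r < 1 by rewrite ltW.
  have br : 0 <= be * r < 1 by rewrite mulr_ge0 ?(ltW b0) ?(ltW r0)//= mulr_ilt1// ltW.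
  have mk : measurable_fun setT (fun t : R => (modulus (1 - pt (be * r) t) `^ (- (2 * p)))%:E).
    by apply/measurable_EFinP; exact: (measurableT_comp (measurable_1Bpt _) (pair1_measurable _)).
  rewrite -mulrA EFinM; apply: (@le_trans _ _ ((4 `^ p)%:E * \int[mu]_(t in `[0%R, (2 * pi)%R])
      (modulus (1 - pt (be * r) t) `^ (- (2 * p)))%:E)%E); last first.
    by apply: lee_wpmul2l; [rewrite lee_fin powR_ge0|exact: HC].
  have q4 : (0 <= (4 `^ p : R)%:E)%E by rewrite lee_fin powR_ge0.
  rewrite -ge0_integralZl//; last 2 first.
  - exact: measurable_funTS.
  - by move=> t _; rewrite lee_fin powR_ge0.
  apply: ge0_le_integral => //.
  - by move=> t _; rewrite lee_fin powR_ge0.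
  - by apply: measurable_funTS; exact: measurable_mdisc_ptrp.
  - by apply: measurable_funTS; exact: emeasurable_funM.
  - move=> t _; rewrite -EFinM lee_fin mdisc_pt//.
    have pt1 : modulus (pt r t) < 1 by rewrite modulus_pt ger0_norm// ltW.
    have -> : - (2 * p) = (- 2) * p by ring.
    rewrite powRrM -powRM ?powR_ge0//.
    rewrite ge0_ler_powR ?nnegrE ?modulus_ge0 ?mulr_ge0 ?powR_ge0 ?(ltW p0)//.
    have -> : pt (be * r) t = be%:C%C * pt r t by rewrite /pt rmorphM/= mulrA.
    exact: test_coef_le.
have mt := measurable_circ p dt.
have m1b : measurable_fun setT (fun r : R => ((1 + - be * r) `^ (1 - 2 * p))%:E).
  apply/measurable_EFinP; apply: (measurableT_comp (measurable_powR _)).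
  by apply: measurable_funD => //; exact: measurable_funM.
apply: (@le_trans _ _ (\int[mu]_(r in `]0%R, 1%R[) ((4 `^ p * C)%:E * ((1 + - be * r) `^ (1 - 2 * p))%:E))%E).
  apply: ge0_le_integral => //.
  - by move=> r; rewrite /= in_itv/= => /andP[r0 _]; rewrite mule_ge0 ?circ_ge0// lee_fin ltW.
  - by apply: measurable_funTS; exact: emeasurable_funM.
  - by apply: measurable_funTS; exact: emeasurable_funM.
  - move=> r; rewrite /= in_itv/= => r01; rewrite -EFinM mulNr.
    apply: le_trans (step r r01); rewrite -[leRHS]mul1e lee_wpmul2r ?circ_ge0// lee_fin.
    by case/andP: r01 => _ /ltW.
apply: (@le_trans _ _ (\int[mu]_(r in `[0%R, 1%R]) ((4 `^ p * C)%:E * ((1 + - be * r) `^ (1 - 2 * p))%:E))%E).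
  apply: subset_integral_le => //.
  - exact: emeasurable_funM.
  - by move=> r; rewrite -EFinM lee_fin mulr_ge0 ?powR_ge0.
  - by move=> r; rewrite /= !in_itv/= => /andP[? ?]; rewrite !ltW.
rewrite ge0_integralZl//; last 2 first.
- exact: measurable_funTS.
- by move=> r _; rewrite lee_fin powR_ge0.
have nb : - be != 0 by rewrite oppr_eq0 gt_eqF.
have k0 : 2 - 2 * p != 0 by rewrite lt_eqF//; lra.
have H := @integral_powR_affine R 1 (- be) (2 - 2 * p) 0 1 ler01 nb k0.
rewrite (_ : 2 - 2 * p - 1 = 1 - 2 * p) in H; last by ring.
rewrite H; last by move=> t /andP[t0 t1]; move: b0 b1 t0 t1; nra.
rewrite mulr1 mulr0 addr0 -EFinM lee_fin -mulrA ler_wpM2l//.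
rewrite (powR1) /cst/=.
have Y0 := powR_ge0 (1 - be) (2 - 2 * p); set Y := _ `^ _ in Y0 *.
have dn : 0 < be * (2 * p - 2) by rewrite mulr_gt0//; lra.
have -> : - be * (2 - 2 * p) = be * (2 * p - 2) by ring.
rewrite ler_pdivrMr//.
have -> : (p - 1)^-1 * Y * (be * (2 * p - 2)) = 2 * be * Y.
  by field; rewrite gt_eqF//; lra.
by move: Y0 b2; nra.
Qed.

End TestFunctions.

(** * From the test functions to the Lipschitz condition *)

Section Necessity.
Context {R : realType}.
Local Notation mu := (@lebesgue_measure R).
Implicit Types (a c g eta : nat -> R[i]) (z w : R[i]) (p q r s u v be : R).

(** The operator sends the test function to a dilation of a fixed function. *)
Lemma psum_rhaly_test eta be z : disc_coef eta -> 0 <= be <= 1 -> modulus z < 1 ->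
  psum (rhaly_coef eta (test_coef be)) z = psum (theta (theta eta)) (be%:C%C * z).
Proof.
move=> de /andP[b0 b1] z1; apply: psum_eq; rewrite /power_sum_at.
have z2 : modulus (be%:C%C * z) < 1.
  rewrite modulusM modulusR ger0_norm//; apply: le_lt_trans z1.
  by rewrite ler_piMl ?modulus_ge0.
have dd : disc_coef (theta (theta eta)) by do 2 apply: disc_coef_theta.
have E : (fun n => rhaly_coef eta (test_coef be) n * z ^+ n) =
    (fun n => theta (theta eta) n * (be%:C%C * z) ^+ n).
  apply/funext => n; rewrite /rhaly_coef /test_coef partial_sum_differences /theta /geom.
  by rewrite [(_ * z) ^+ n]exprMn; move: (n%:R) (eta n) (be%:C%C ^+ n) (z ^+ n) => ? ? ? ?; ring.
by rewrite E; exact: (disc_psum_cvg dd z2).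
Qed.

Lemma circ_rhaly_test q eta be r : disc_coef eta -> 0 < be < 1 -> 0 <= r < 1 ->
  circ q (rhaly_coef eta (test_coef be)) r = circ q (theta (theta eta)) (be * r).
Proof.
move=> de /andP[b0 b1] r01; have [r0 r1] := andP r01.
have br : 0 <= be * r < 1 by rewrite mulr_ge0 ?(ltW b0)//= mulr_ilt1// ltW.
have b01 : 0 <= be <= 1 by rewrite !ltW.
rewrite /circ; apply: eq_integral => t _; rewrite (@mdisc_pt R _ _ t r01) (@mdisc_pt R _ _ t br).
have pt1 : modulus (pt r t) < 1 by rewrite modulus_pt ger0_norm.
have -> : pt (be * r) t = be%:C%C * pt r t by rewrite /pt rmorphM/= mulrA.
by rewrite (psum_rhaly_test de b01 pt1).
Qed.

(** The substitution [v = be * r]. *)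
Lemma scaled_mass (c1 c2 : R -> \bar R) r0 be : measurable_fun setT c1 -> measurable_fun setT c2 ->
  (forall r, (0 <= c1 r)%E) -> (forall r, (0 <= c2 r)%E) ->
  (forall r, 0 <= r < 1 -> c1 r = c2 (be * r)) -> 2^-1 <= r0 -> r0 <= be -> be < 1 ->
  (\int[mu]_(v in `[r0, be]) c2 v <= 2%:E * \int[mu]_(r in `]0%R, 1%R[) (r%:E * c1 r))%E.
Proof.
move=> m1 m2 p1 p2 c12 r02 r0b b1.
have r00 : 0 < r0 by rewrite (lt_le_trans _ r02)// invr_gt0.
have b0 : 0 < be by exact: lt_le_trans r0b.
rewrite -integral_itv_bndo_bndc; last exact: measurable_funTS.
rewrite (@integral_scale _ _ _ be)//; last exact: measurable_funTS.
rewrite (_ : (fun x => be * x) @^-1` `[r0, be[ = `[r0 / be, 1[%classic); last first.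
  by apply/seteqP; split => x /=; rewrite !in_itv/= ler_pdivrMr// [be * x]mulrC gtr_pMl.
have rb : r0 <= r0 / be by rewrite ler_pdivlMr// ler_piMr ?(ltW r00)// ltW.
have -> : (\int[mu]_(x in `[(r0 / be)%R, 1%R[) c2 (be * x)%R = \int[mu]_(x in `[(r0 / be)%R, 1%R[) c1 x)%E.
  apply: eq_integral => r; rewrite inE/= in_itv/= => /andP[r0r r1]; rewrite c12//.
  by rewrite r1 andbT (le_trans (ltW r00))// (le_trans rb).
apply: (@le_trans _ _ (\int[mu]_(r in `[(r0 / be)%R, 1%R[) (2%:E * (r%:E * c1 r)))%E).
  apply: (@le_trans _ _ (\int[mu]_(r in `[(r0 / be)%R, 1%R[) c1 r)%E).
    rewrite -[leRHS]mul1e; apply: lee_wpmul2r; last by rewrite lee_fin ltW.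
    exact: integral_ge0.
  apply: ge0_le_integral => //.
  - exact: measurable_funTS.
  - by apply: measurable_funTS; apply: emeasurable_funM => //; apply: emeasurable_funM.
  - move=> r; rewrite /= in_itv/= => /andP[r1 _]; rewrite muleA -EFinM -[leLHS]mul1e.
    by apply: lee_wpmul2r => //; rewrite lee_fin; move: rb r02 r1; lra.
rewrite -ge0_integralZl//; last 2 first.
- by apply: measurable_funTS; apply: emeasurable_funM.
- by move=> r; rewrite /= in_itv/= => /andP[? _]; rewrite mule_ge0// lee_fin ltW.
apply: ge0_subset_integral => //.
- by apply: measurable_funTS; apply: emeasurable_funM => //; apply: emeasurable_funM.
- by move=> r; rewrite /= in_itv/= => /andP[? _]; rewrite mule_ge0// mule_ge0// lee_fin ltW.
- by move=> r; rewrite /= !in_itv/= => /andP[? ->]; rewrite andbT (lt_le_trans r00)// (le_trans rb).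
Qed.

Lemma test_lower q eta r0 be : disc_coef eta -> 2^-1 <= r0 -> r0 <= be -> be < 1 ->
  (\int[mu]_(v in `[r0, be]) circ q (theta (theta eta)) v <=
    2%:E * berg q (rhaly_coef eta (test_coef be)))%E.
Proof.
move=> de r02 r0b b1.
have b0 : 0 < be by rewrite (lt_le_trans _ r0b)// (lt_le_trans _ r02)// invr_gt0.
have dd : disc_coef (theta (theta eta)) by do 2 apply: disc_coef_theta.
have dm : disc_coef (rhaly_coef eta (test_coef be)).
  by apply: disc_coef_rhaly => //; apply: disc_coef_test; rewrite !ltW.
apply: (scaled_mass _ _ _ _ _ r02 r0b b1); [exact: measurable_circ|exact: measurable_circ|exact: circ_ge0|exact: circ_ge0|].
by move=> r r01; apply: circ_rhaly_test => //; rewrite b0.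
Qed.

(** The weight [(1 - u)^k] is at most a multiple of the integral of [(1 - v)^(k - 1)]
    over [u, (1 + r)/2]; exchanging the integrals makes the hypothesis appear for each
    [v], and the remaining power of [1 - v] is integrable up to [(1 + r)/2] with the
    stated size since [k < sg]. *)
Lemma swap_weight (N : R -> \bar R) (k sg Lam r0 r : R) : 0 < k -> k < sg -> 0 <= Lam ->
  r0 <= r < 1 -> measurable_fun setT N -> (forall u, (0 <= N u)%E) ->
  (forall v, r0 <= v < 1 -> (\int[mu]_(u in `[r0, v]) N u <= (Lam * (1 - v) `^ (- sg))%:E)%E) ->
  (\int[mu]_(u in `[r0, r]) (((1 - u) `^ k)%:E * N u) <=
    ((k / (1 - 2^-1 `^ k) * (2^-1 `^ (k - sg) / (sg - k))) * Lam * (1 - r) `^ (k - sg))%:E)%E.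
Proof.
move=> k0 ksg L0 /andP[r0r r1] mN N0 HN.
pose rho := (1 + r) / 2.
have rrho : r <= rho by rewrite /rho; lra.
have rho1 : rho < 1 by rewrite /rho; lra.
have r0rho : r0 <= rho by exact: le_trans rrho.
have h1 : 2^-1 `^ k < 1 :> R.
  have {2}-> : (1 : R) = 1 `^ k by rewrite powR1.
  by rewrite gt0_ltr_powR ?nnegrE ?invr_ge0// invf_lt1 ?ltr1n.
have h10 : 0 < 1 - 2^-1 `^ k :> R by rewrite subr_gt0.
have m1 := @measurable_1BpowR R.
have p1 e u : (0 <= ((1 - u) `^ e : R)%:E)%E by rewrite lee_fin powR_ge0.
pose K1 v : \bar R := ((1 - v) `^ (k - 1))%:E.
have mK1 : measurable_fun setT K1 by exact: m1.
have K10 v : (0 <= K1 v)%E by exact: p1.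
have N1 : (-1 : R) != 0 by rewrite oppr_eq0 oner_eq0.
pose W : set (R * R) := [set x | x.1 <= x.2].
have mW : measurable W.
  by apply: measurable_bool_set; exact: (measurable_fun_ler measurable_fst measurable_snd).
pose D := k / (1 - 2^-1 `^ k).
have D0 : 0 < D by rewrite divr_gt0.
pose I u := (\int[mu]_(v in `[r0, rho] `&` [set v | W (u, v)]) K1 v)%E.
have mI : measurable_fun setT I by apply: measurable_region_integral.
have I0 u : (0 <= I u)%E by exact: integral_ge0.
have low u : r0 <= u <= r -> (((1 - u) `^ k)%:E <= D%:E * I u)%E.
  rewrite /I => /andP[r0u ur].
  have u10 : 0 < 1 - u by rewrite subr_gt0 (le_lt_trans ur).
  have urho : u <= rho by exact: le_trans rrho.
  have -> : (\int[mu]_(v in `[r0, rho] `&` [set v | W (u, v)]) K1 v)%E = (\int[mu]_(v in `[u, rho]) K1 v)%E.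
    congr (integral _ _ _); apply/seteqP; split => v /=; rewrite !in_itv/= /W/=.
      by move=> [/andP[_ ->] ->].
    by move=> /andP[uv ->]; rewrite uv (le_trans r0u).
  have := @integral_powR_affine R 1 (-1) k u rho urho N1 (lt0r_neq0 k0).
  rewrite (_ : (\int[mu]_(t in _) _)%E = (\int[mu]_(v in `[u, rho]) K1 v)%E); last first.
    by apply: eq_integral => v _; rewrite /K1 mulN1r.
  move=> ->; last by move=> t /andP[_ tr]; rewrite mulN1r subr_gt0 (le_lt_trans tr).
  rewrite -EFinM lee_fin !mulN1r.
  have hr : (1 - rho) `^ k <= 2^-1 `^ k * (1 - u) `^ k.
    rewrite -powRM ?invr_ge0 ?(ltW u10)// ge0_ler_powR ?nnegrE ?(ltW k0) ?mulr_ge0 ?invr_ge0 ?(ltW u10)//.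
      by rewrite subr_ge0 ltW.
    by rewrite /rho; lra.
  have -> : D * (((1 - rho) `^ k - (1 - u) `^ k) / - k) = ((1 - u) `^ k - (1 - rho) `^ k) / (1 - 2^-1 `^ k).
    by rewrite /D; field; rewrite !gt_eqF.
  rewrite ler_pdivlMr//; move: hr; move: (_ `^ k) (_ `^ k) (_ `^ k) => x y t; lra.
apply: (@le_trans _ _ (D%:E * \int[mu]_(u in `[r0, r]) (N u * I u))%E).
  clearbody I.
  rewrite -ge0_integralZl//; last 3 first.
  - by apply: measurable_funTS; exact: emeasurable_funM.
  - by move=> u _; rewrite mule_ge0.
  - by rewrite lee_fin ltW.
  apply: ge0_le_integral => //.
  - by move=> u _; rewrite mule_ge0.
  - by apply: measurable_funTS; apply: emeasurable_funM => //; exact: m1.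
  - by apply: measurable_funTS; apply: emeasurable_funM => //; exact: emeasurable_funM.
  - move=> u; rewrite /= in_itv/= => ur; rewrite muleCA muleC; apply: lee_wpmul2l => //.
    exact: low.
rewrite /I tonelli_region// -/D.
have -> : D * (2^-1 `^ (k - sg) / (sg - k)) * Lam * (1 - r) `^ (k - sg) =
  D * (Lam * ((1 - rho) `^ (k - sg) / (sg - k))).
  have -> : (1 - rho) `^ (k - sg) = 2^-1 `^ (k - sg) * (1 - r) `^ (k - sg).
    rewrite -powRM ?invr_ge0 ?subr_ge0 ?(ltW r1)//; congr (_ `^ _); rewrite /rho; by field.
  by ring.
rewrite [leRHS]EFinM; apply: lee_wpmul2l; first by rewrite lee_fin ltW.
apply: (@le_trans _ _ (\int[mu]_(v in `[r0, rho]) (Lam%:E * ((1 - v) `^ (k - sg - 1))%:E))%E).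
  apply: ge0_le_integral => //.
  - by move=> v _; rewrite mule_ge0//; apply: integral_ge0.
  - apply: measurable_funTS; apply: emeasurable_funM => //.
    apply: (@measurable_region_integral R N `[r0, r]%classic [set x | W (x.2, x.1)]) => //.
    by apply: measurable_bool_set; exact: (measurable_fun_ler measurable_snd measurable_fst).
  - by apply: measurable_funTS; apply: emeasurable_funM => //; exact: m1.
  - move=> v; rewrite /= in_itv/= => /andP[r0v vrho].
    have v1 : v < 1 by exact: le_lt_trans rho1.
    have v10 : 0 < 1 - v by rewrite subr_gt0.
    apply: (@le_trans _ _ (K1 v * (Lam * (1 - v) `^ (- sg))%:E)%E).
      apply: lee_wpmul2l => //; apply: le_trans (HN v (introT andP (conj r0v v1))).
      apply: subset_integral_le => //.
      + apply: measurableI => //; rewrite (_ : [set u | _] = ysection W v); last exact/esym/ysectionE.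
        exact: measurable_ysection.
      + by move=> u [/=]; rewrite !in_itv/= => /andP[-> _].
    rewrite /K1 -!EFinM lee_fin mulrCA -powRD ?(gt_eqF v10) ?implybT//.
    by rewrite (_ : k - 1 + - sg = k - sg - 1)//; ring.
rewrite ge0_integralZl//; last by apply: measurable_funTS; exact: m1.
rewrite [leRHS]EFinM; apply: lee_wpmul2l; first by rewrite lee_fin.
have ksg0 : k - sg != 0 by rewrite lt_eqF// subr_lt0.
have := @integral_powR_affine R 1 (-1) (k - sg) r0 rho r0rho N1 ksg0.
rewrite (_ : (\int[mu]_(t in _) _)%E = (\int[mu]_(v in `[r0, rho]) ((1 - v) `^ (k - sg - 1))%:E)%E); last first.
  by apply: eq_integral => v _; rewrite mulN1r.
move=> ->; last by move=> t /andP[_ tr]; rewrite mulN1r subr_gt0 (le_lt_trans tr).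
rewrite lee_fin !mulN1r opprB ler_wpM2r ?invr_ge0 ?subr_ge0 ?(ltW ksg)//.
by rewrite gerBl powR_ge0.
Qed.

(** Hardy's inequality only needs integrals of [circ q (theta g)] from [r0] on, not
    its pointwise size; [k] is the midpoint of [q - 1] and [sg]. *)
Lemma hardy_converse q sg : 1 < q -> q - 1 < sg -> exists2 C : R, 0 < C & forall g r0 (Lam : R),
  disc_coef g -> 2^-1 <= r0 < 1 -> 0 <= Lam ->
  (forall v, r0 <= v < 1 ->
     (\int[mu]_(u in `[r0, v]) circ q (theta g) u <= (Lam * (1 - v) `^ (- sg))%:E)%E) ->
  forall r, r0 <= r < 1 ->
    (circ q g r <= C%:E * (circ q g r0 + (Lam * (1 - r) `^ (q - 1 - sg))%:E))%E.
Proof.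
move=> q1 qsg; pose k := (q - 1 + sg) / 2.
have kq : q - 1 < k by rewrite /k; lra.
have ksg : k < sg by rewrite /k; lra.
have k0 : 0 < k by lra.
have [C C0 HC] := hardy q1 kq.
pose E := k / (1 - 2^-1 `^ k) * (2^-1 `^ (k - sg) / (sg - k)).
have h1 : 2^-1 `^ k < 1 :> R.
  have {2}-> : (1 : R) = 1 `^ k by rewrite powR1.
  by rewrite gt0_ltr_powR ?nnegrE ?invr_ge0// invf_lt1 ?ltr1n.
have E0 : 0 < E by rewrite /E mulr_gt0// divr_gt0 ?subr_gt0// powR_gt0.
exists (C * (1 + E)); first by rewrite mulr_gt0// addr_gt0.
move=> g r0 Lam dg /andP[r02 r01] L0 H r r0r.
have [r0r' r1] := andP r0r.
have r10 : 0 < 1 - r by rewrite subr_gt0.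
have dt := disc_coef_theta dg.
apply: (le_trans (HC g r0 r dg r02 r0r)).
rewrite EFinM -muleA; apply: lee_wpmul2l; first by rewrite lee_fin ltW.
have X0 := circ_ge0 q g r0.
have S := swap_weight k0 ksg L0 r0r (measurable_circ q dt) (circ_ge0 q (theta g)) H.
have P0 := powR_ge0 (1 - r) (q - 1 - k).
have Y0 : 0 <= Lam * (1 - r) `^ (q - 1 - sg) by rewrite mulr_ge0 ?powR_ge0.
apply: (@le_trans _ _ (circ q g r0 + (E * (Lam * (1 - r) `^ (q - 1 - sg)))%:E)%E).
  apply: leeD => //; apply: (le_trans (lee_wpmul2l _ S)); first by rewrite lee_fin.
  rewrite -EFinM lee_fin -/E.
  have -> : (1 - r) `^ (q - 1 - sg) = (1 - r) `^ (q - 1 - k) * (1 - r) `^ (k - sg).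
    by rewrite -powRD ?(gt_eqF r10) ?implybT//; congr (_ `^ _); ring.
  by rewrite le_eqVlt; apply/orP; left; apply/eqP; ring.
rewrite ge0_muleDr//; apply: leeD.
  by rewrite -[leLHS]mul1e; apply: lee_wpmul2r => //; rewrite lee_fin lerDl ltW.
by rewrite -EFinM lee_fin ler_wpM2r// lerDr.
Qed.

End Necessity.

Section NecessaryConditions.
Context {R : realType}.
Local Notation mu := (@lebesgue_measure R).
Implicit Types (a b c g eta : nat -> R[i]) (z w : R[i]) (p q r s u v be : R).

Lemma psumZ (x : R[i]) a z : disc_coef a -> modulus z < 1 ->
  psum (fun n => x * a n) z = x * psum a z.
Proof.
move=> da z1; apply: psum_eq; rewrite /power_sum_at.
rewrite (_ : series _ = (fun n => x * series (fun n => a n * z ^+ n) n)).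
  by apply: cvgM; [exact: cvg_cst|exact: disc_psum_cvg].
apply/funext => n; rewrite !series_nat mulr_sumr; apply: eq_bigr => i _.
by rewrite mulrA.
Qed.

Lemma disc_coefZ (x : R[i]) a : disc_coef a -> disc_coef (fun n => x * a n).
Proof.
move=> da s s01; have [M HM] := da s s01; exists (modulus x * M) => n.
by rewrite modulusM -mulrA ler_wpM2l ?modulus_ge0.
Qed.

Lemma bergZ q (x : R) a : 0 <= x -> disc_coef a ->
  berg q (fun n => x%:C%C * a n)%R = ((x `^ q)%:E * berg q a)%E.
Proof.
move=> x0 da; have mc := measurable_circ q da.
have xq : (0 <= (x `^ q : R)%:E)%E by rewrite lee_fin powR_ge0.
rewrite /berg -ge0_integralZl//; last 2 first.
- by apply: measurable_funTS; exact: emeasurable_funM.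
- by move=> r; rewrite /= in_itv/= => /andP[? _]; rewrite mule_ge0 ?circ_ge0// lee_fin ltW.
apply: eq_integral => r; rewrite inE/= in_itv/= => /andP[r0 r1].
have r01 : 0 <= r < 1 by rewrite ltW.
rewrite muleCA; congr (_ * _)%E; rewrite /circ -ge0_integralZl//; last 2 first.
- by apply: measurable_funTS; exact: measurable_mdisc_ptrp.
- by move=> t _; rewrite lee_fin powR_ge0.
apply: eq_integral => t _; rewrite -EFinM (@mdisc_pt R _ _ t r01) (@mdisc_pt R _ _ t r01).
have pt1 : modulus (pt r t) < 1 by rewrite modulus_pt ger0_norm// ltW.
by rewrite (psumZ _ da pt1) modulusM modulusR (ger0_norm x0) powRM ?modulus_ge0.
Qed.

Lemma circ_of_test_bound p q : 1 < p -> p < q -> 2 / p - q^-1 < 1 -> exists2 C : R, 0 < C &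
  forall eta be0 (Lam : R), disc_coef eta -> 2^-1 <= be0 < 1 -> 0 <= Lam ->
  (forall be, be0 <= be < 1 ->
    (berg q (rhaly_coef eta (test_coef be)) <= (Lam * (1 - be) `^ (- ((2 - 2 / p) * q)))%:E)%E) ->
  forall r, be0 <= r < 1 -> (circ q (theta eta) r <=
    C%:E * (circ q (theta eta) be0 + (2 * Lam * (1 - r) `^ ((2 / p - q^-1 - 1) * q))%:E))%E.
Proof.
move=> p1 pq al1; have p0 : 0 < p by exact: lt_trans p1.
have q1 : 1 < q by exact: lt_trans pq.
have q0 : 0 < q by exact: lt_trans q1.
have E : q - 1 - (2 - 2 / p) * q = (2 / p - q^-1 - 1) * q by field; rewrite !gt_eqF.
have qsg : q - 1 < (2 - 2 / p) * q.
  have : (2 / p - q^-1 - 1) * q < 0 by rewrite nmulr_rlt0// subr_lt0.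
  by rewrite -E; lra.
have [C C0 HC] := hardy_converse q1 qsg.
exists C => // eta be0 Lam de be01 L0 H r rb; rewrite -E.
have [b2 _] := andP be01.
apply: HC => //; [exact: disc_coef_theta|by rewrite mulr_ge0|].
move=> v /[dup] v01 /andP[bv v1]; apply: (le_trans (test_lower q de b2 bv v1)).
by rewrite -mulrA EFinM; apply: lee_wpmul2l; [rewrite lee_fin|exact: H].
Qed.

(** The constant term of [circ_of_test_bound] is absorbed because the power of
    [1 - r] is at least 1. *)
Lemma lipschitz_of_bounded p q eta : 1 < p -> p < q -> 2 / p - q^-1 < 1 -> disc_coef eta ->
  bounded_operator (bergman p) (bergman_norm p) (bergman q) (bergman_norm q) (rhaly eta) ->
  exists K r0 : R, [/\ 0 < K, 2^-1 <= r0 < 1 & forall r, r0 <= r < 1 ->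
    (circ q (theta eta) r <= (K * (1 - r) `^ ((2 / p - q^-1 - 1) * q))%:E)%E].
Proof.
move=> p1 pq al1 de [XY [M HM]].
have p0 : 0 < p by exact: lt_trans p1.
have q0 : 0 < q by exact: lt_trans pq.
have [D D0 HD] := test_berg p1.
have [C C0 HC] := circ_of_test_bound p1 pq al1.
pose Lam := (`|M| + 1) `^ q * D `^ (q / p).
have L0 : 0 <= Lam by rewrite mulr_ge0 ?powR_ge0.
have h2 : 2^-1 <= (2^-1 : R) < 1 by rewrite lexx invf_lt1 ?ltr1n.
have test be : 2^-1 <= be < 1 ->
    (berg q (rhaly_coef eta (test_coef be)) <= (Lam * (1 - be) `^ (- ((2 - 2 / p) * q)))%:E)%E.
  move=> /[dup] be01 /andP[b2 b1].
  have b0 : 0 < be by rewrite (lt_le_trans _ b2)// invr_gt0.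
  have b10 : 0 < 1 - be by rewrite subr_gt0.
  have b01 : 0 <= be <= 1 by rewrite !ltW.
  have dt := disc_coef_test b01.
  have Xf : bergman p (psum (test_coef be)).
    by apply: (bergman_psum p0 dt) => //; apply: (le_lt_trans (HD be be01)); rewrite ltry.
  have dm := disc_coef_rhaly de dt.
  have rE := rhalyE de dt (fun z _ => erefl (psum (test_coef be) z)).
  have [_ Yfin] := XY _ Xf.
  have := HM _ Xf; rewrite (bergman_normE q0 dm rE) (bergman_normE p0 dt (fun z _ => erefl _)).
  rewrite /= (bergman_integralE q0 dm rE) in Yfin.
  have tB := HD be be01.
  have n1 := berg_ge0 q (rhaly_coef eta (test_coef be)); have n2 := berg_ge0 p (test_coef be).
  move: (berg q _) (berg p _) Yfin tB n1 n2 => [x| |]// [y| |]// _.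
  rewrite !lee_fin/= => yD x0 y0 H.
  have X0 := powR_ge0 (1 - be) (2 - 2 * p).
  have -> : x = (x `^ q^-1) `^ q by rewrite -powRrM mulVf ?gt_eqF// powRr1.
  have -> : Lam * (1 - be) `^ (- ((2 - 2 / p) * q)) =
     ((`|M| + 1) * (D * (1 - be) `^ (2 - 2 * p)) `^ p^-1) `^ q.
    rewrite [RHS]powRM ?powR_ge0 ?addr_ge0// -[in RHS]powRrM [in RHS]powRM ?(ltW D0)//.
    rewrite -[in RHS]powRrM /Lam -mulrA.
    congr (_ * _); congr (_ `^ _ * _ `^ _); field; by rewrite gt_eqF.
  rewrite ge0_ler_powR ?nnegrE ?(ltW q0) ?powR_ge0 ?mulr_ge0 ?addr_ge0 ?powR_ge0//.
  apply: (le_trans H); apply: (@le_trans _ _ ((`|M| + 1) * y `^ p^-1)).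
    by rewrite ler_wpM2r ?powR_ge0// (le_trans (ler_norm _))// lerDl.
  rewrite ler_wpM2l ?addr_ge0// ge0_ler_powR ?nnegrE ?invr_ge0 ?(ltW p0)//.
  exact: mulr_ge0 (ltW D0) X0.
have HC' := HC eta 2^-1 Lam de h2 L0 test.
have dte := disc_coef_theta de.
have cf : circ q (theta eta) 2^-1 \is a fin_num.
  by apply: circ_fin => //; [exact: ltW|case/andP: h2 => _ ->; rewrite invr_ge0 ler0n].
have c0 : 0 <= fine (circ q (theta eta) 2^-1) by apply/fine_ge0/circ_ge0.
rewrite -(fineK cf) in HC'; move: (fine _) c0 HC' => c c0 {}HC.
exists (C * (c + 2 * Lam) + 1), 2^-1; split=> //.
  by rewrite ltr_wpDl// mulr_ge0 ?(ltW C0)// addr_ge0// mulr_ge0.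
move=> r r01; apply: (le_trans (HC r r01)); rewrite -EFinD -EFinM lee_fin.
have [r2 r1] := andP r01.
have r0 : 0 < r by rewrite (lt_le_trans _ r2)// invr_gt0.
have e0 : (2 / p - q^-1 - 1) * q <= 0 by rewrite nmulr_rle0 ?subr_lt0// ltW.
have X1 : 1 <= (1 - r) `^ ((2 / p - q^-1 - 1) * q).
  have pow1 : 1 `^ ((2 / p - q^-1 - 1) * q) = 1 :> R by rewrite powR1.
  by rewrite -[leLHS]pow1 powR_neg_le ?subr_gt0// gerBl ltW.
move: (_ `^ _) X1 => X X1.
apply: (@le_trans _ _ (C * (c + 2 * Lam) * X)).
  rewrite -[leRHS]mulrA; apply: ler_wpM2l; first exact: ltW.
  by rewrite [leRHS]mulrDl lerD2r ler_peMr.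
by rewrite ler_wpM2r// ?lerDl// (le_trans ler01).
Qed.

(** If [t n] tends to 0 pointwise and to [c] in [A^q], then [c] vanishes by Fatou's
    lemma. *)
Lemma norm_limit_unique q (t : nat -> nat -> R[i]) c : 0 < q -> (forall n, disc_coef (t n)) ->
  disc_coef c -> (forall z, modulus z < 1 -> modulus (psum (t n) z) @[n --> \oo] --> (0 : R)) ->
  (forall e : R, 0 < e -> \forall n \near \oo, (berg q (fun k => t n k - c k)%R <= e%:E)%E) ->
  forall e : R, 0 < e -> \forall n \near \oo, (berg q (t n) <= e%:E)%E.
Proof.
move=> q0 dt dc t0 tc e e0.
pose d := e / (2 `^ q * 2); have q2 : 0 < 2 `^ q :> R by rewrite powR_gt0.
have d0 : 0 < d by rewrite divr_gt0// mulr_gt0.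
have [N _ HN] := tc d d0.
have dz : disc_coef (fun=> 0 : R[i]).
  by move=> s _; exists 0 => n; rewrite modulus0 mul0r.
have dzc := disc_coefB dz dc.
have pz z : psum (fun=> 0 : R[i]) z = 0.
  apply: psum_eq; rewrite /power_sum_at (_ : series _ = cst 0); first exact: cvg_cst.
  by apply/funext => n; rewrite series_nat big1// => i _; rewrite mul0r.
have c_small : (berg q (fun k => 0 - c k)%R <= d%:E)%E.
  apply: (@berg_fatou _ _ (fun n k => t (n + N)%N k - c k)) => //.
  - by move=> n; exact: disc_coefB.
  - move=> z z1.
    rewrite (_ : (fun n => _) = (fun n => modulus (psum (t (n + N)%N) z))).
      by rewrite (cvg_shiftn N (fun n => modulus (psum (t n) z))); exact: t0.
    apply/funext => n; rewrite (psumB (dt _) dc z1) (psumB dz dc z1) pz.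
    by congr modulus; rewrite sub0r opprK subrK.
  - by move=> n; apply: HN; rewrite /= leq_addl.
exists N => // n /= nN.
have -> : t n = (fun k => (t n k - c k) - (0 - c k)).
  by apply/funext => k; rewrite sub0r opprK subrK.
have := berg_sub q0 (disc_coefB (dt n) dc) dzc (HN n nN) c_small.
rewrite (_ : 2 `^ q * (d + d) = e)//.
by rewrite /d; field; rewrite gt_eqF.
Qed.

Lemma berg_sub_finite q a b : 0 < q -> disc_coef a -> disc_coef b ->
  (berg q a < +oo)%E -> (berg q b < +oo)%E -> (berg q (fun k => a k - b k)%R < +oo)%E.
Proof.
have finite c : (berg q c < +oo)%E -> berg q c \is a fin_num.
  by rewrite (ge0_fin_numE (berg_ge0 q c)).
move=> q0 da db /finite fa /finite fb.
have Ha : (berg q a <= (fine (berg q a))%:E)%E by rewrite (fineK fa).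
have Hb : (berg q b <= (fine (berg q b))%:E)%E by rewrite (fineK fb).
by apply: (le_lt_trans (berg_sub q0 da db Ha Hb)); rewrite ltry.
Qed.

(** Otherwise there are [be n] tending to 1 for which the images of the
    normalized test functions stay away from 0. A subsequence converges in [A^q] by
    compactness and pointwise to 0, which contradicts [norm_limit_unique]. *)
Lemma small_test_of_compact p q eta : 1 < p -> p < q -> 2 / p - q^-1 < 1 -> disc_coef eta ->
  compact_operator (bergman p) (bergman_norm p) (bergman q) (bergman_norm q) (rhaly eta) ->
  forall e : R, 0 < e -> exists2 be0 : R, 2^-1 <= be0 < 1 & forall be, be0 <= be < 1 ->
    (berg q (rhaly_coef eta (test_coef be)) <= (e * (1 - be) `^ (- ((2 - 2 / p) * q)))%:E)%E.
Proof.
move=> p1 pq al1 de [XY CO] e e0.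
have p0 : 0 < p by exact: lt_trans p1.
have q0 : 0 < q by exact: lt_trans pq.
have [D D0 HD] := test_berg p1.
apply: contrapT => Hno.
have /choice[be Hbe] : forall n : nat, exists be : R, [/\ 2^-1 <= be < 1, 1 - be <= n.+2%:R^-1 &
    ~ (berg q (rhaly_coef eta (test_coef be)) <= (e * (1 - be) `^ (- ((2 - 2 / p) * q)))%:E)%E].
  move=> n; apply: contrapT => Hn; apply: Hno; exists (1 - n.+2%:R^-1).
    have n2 : n.+2%:R^-1 <= (2^-1 : R) by rewrite lef_pV2 ?posrE// ler_nat.
    have n20 : 0 < n.+2%:R^-1 :> R by rewrite invr_gt0.
    by move: (n.+2%:R^-1) n2 n20 => y y2 y0; apply/andP; split; lra.
  move=> be /andP[nb b1]; apply: contrapT => Hb; apply: Hn; exists be; split=> //.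
    rewrite b1 andbT; apply: le_trans nb.
    have n2 : n.+2%:R^-1 <= (2^-1 : R) by rewrite lef_pV2 ?posrE// ler_nat.
    by move: (n.+2%:R^-1) n2 => y y2; lra.
  by rewrite lerBlDr -lerBlDl.
pose x n := (1 - be n) `^ (2 - 2 / p).
have b01 n : 0 <= be n <= 1.
  have [/andP[b2 b1] _ _] := Hbe n; rewrite (ltW b1) andbT.
  by rewrite (le_trans _ b2)// invr_ge0.
have b10 n : 0 < 1 - be n by have [/andP[_ b1] _ _] := Hbe n; rewrite subr_gt0.
have x0 n : 0 <= x n by exact: powR_ge0.
have dtest n := disc_coef_test (b01 n).
pose c n k := (x n)%:C%C * test_coef (be n) k.
have dc n : disc_coef (c n) by exact: disc_coefZ.
have cD n : (berg p (c n) <= D%:E)%E.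
  have [b2 _ _] := Hbe n.
  rewrite (bergZ _ (x0 n) (dtest n)).
  apply: (@le_trans _ _ ((x n `^ p)%:E * (D * (1 - be n) `^ (2 - 2 * p))%:E)%E).
    by apply: lee_wpmul2l; [rewrite lee_fin powR_ge0|exact: HD].
  rewrite -EFinM lee_fin mulrCA /x -powRrM -powRD ?(gt_eqF (b10 n)) ?implybT//.
  rewrite (_ : (2 - 2 / p) * p + (2 - 2 * p) = 0) ?powRr0 ?mulr1//.
  by field; rewrite gt_eqF.
have Xc n : bergman p (psum (c n)).
  by apply: (bergman_psum p0 (dc n)) => //; apply: (le_lt_trans (cD n)); rewrite ltry.
have [|s [h [hs Yh Hh]]] := CO (fun n => psum (c n)) Xc.
  exists (D `^ p^-1) => n; rewrite (bergman_normE p0 (dc n) (fun z _ => erefl _)).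
  have := cD n; have := berg_ge0 p (c n); case: (berg p (c n)) => [y| |]//.
  rewrite !lee_fin/= => y0 yD.
  by rewrite ge0_ler_powR ?nnegrE ?invr_ge0 ?(ltW p0) ?(ltW D0).
have [l [dl hl _ _]] := bergmanP q0 Yh.
pose t n := rhaly_coef eta (c (s n)).
have dt n : disc_coef (t n) by exact: disc_coef_rhaly.
have tE n k : t n k = (x (s n))%:C%C * rhaly_coef eta (test_coef (be (s n))) k.
  by rewrite /t /rhaly_coef /partial_sum /c -mulr_sumr mulrCA.
have dmt n : disc_coef (rhaly_coef eta (test_coef (be n))) by exact: disc_coef_rhaly.
have nE n : bergman_norm q (rhaly eta (psum (c (s n))) \- h) =
    fine (berg q (fun k => t n k - l k)) `^ q^-1.
  apply: (bergman_normE q0 (disc_coefB (dt n) dl)) => z z1 /=.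
  by rewrite (rhalyE de (dc (s n)) (fun z _ => erefl _) z1) (hl z z1) (psumB (dt n) dl z1).
have tfin n : (berg q (fun k => t n k - l k)%R < +oo)%E.
  have [_] := XY _ (Xc (s n)).
  rewrite /= (bergman_integralE q0 (dt n) (rhalyE de (dc (s n)) (fun z _ => erefl _))) => f1.
  have [_] := Yh; rewrite /= (bergman_integralE q0 dl hl) => f2.
  exact: berg_sub_finite f1 f2.
have be_cvg : (fun n => 1 - be (s n)) @ \oo --> (0 : R).
  apply/cvgrPdist_le => d d0; exists (Num.truncn d^-1) => // n /= dn.
  rewrite sub0r normrN ger0_norm ?(ltW (b10 _))//.
  have [_ bn _] := Hbe (s n); apply: (le_trans bn).
  have sn : (n <= s n)%N.
    elim: (n) => // m IH; apply: leq_ltn_trans IH _; exact: hs.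
  rewrite -[leRHS]invrK lef_pV2 ?posrE ?invr_gt0//.
  apply: (le_trans (ltW (truncnS_gt _))); rewrite ler_nat ltnS.
  by rewrite (leq_trans dn)// (leq_trans sn).
have e2 : 0 < 2 - 2 / p.
  by rewrite subr_gt0 ltr_pdivrMr// ltr_pMr.
have x_cvg : (fun n => x (s n)) @ \oo --> (0 : R).
  apply/cvgrPdist_le => d d0; have d1 : 0 < d `^ (2 - 2 / p)^-1 by rewrite powR_gt0.
  have /cvgrPdist_le/(_ _ d1) := be_cvg; apply: filterS => n.
  rewrite !sub0r !normrN !ger0_norm ?(ltW (b10 _))// => H.
  have -> : d = (d `^ (2 - 2 / p)^-1) `^ (2 - 2 / p).
    by rewrite -powRrM mulVf ?gt_eqF// powRr1// ltW.
  by rewrite /x ge0_ler_powR ?nnegrE ?(ltW e2) ?(ltW (b10 _)) ?powR_ge0.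
have dd : disc_coef (theta (theta eta)) by do 2 apply: disc_coef_theta.
have t0 z : modulus z < 1 -> modulus (psum (t n) z) @[n --> \oo] --> (0 : R).
  move=> z1; pose G := limn (series (fun n => modulus (theta (theta eta) n) * modulus z ^+ n)).
  have z01 : 0 <= modulus z < 1 by rewrite modulus_ge0.
  have H : (fun n => x (s n) * G) @ \oo --> (0 : R).
    by rewrite -(mul0r G); apply: cvgM => //; exact: cvg_cst.
  apply: (squeeze_cvgr _ (cvg_cst 0) H); apply: nearW => n; rewrite modulus_ge0/=.
  have -> : t n = (fun k => (x (s n))%:C%C * rhaly_coef eta (test_coef (be (s n))) k).
    by apply/funext => k; exact: tE.
  rewrite (psumZ _ (dmt _) z1) modulusM modulusR ger0_norm// ler_wpM2l//.
  rewrite (psum_rhaly_test de (b01 _) z1); apply: (psum_le (disc_summable dd z01)).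
  rewrite modulusM modulusR; have /andP[bb0 bb1] := b01 (s n).
  by rewrite ger0_norm// ler_piMl ?modulus_ge0.
have tl d : 0 < d -> \forall n \near \oo, (berg q (fun k => t n k - l k)%R <= d%:E)%E.
  move=> d0; have d1 : 0 < d `^ q^-1 by rewrite powR_gt0.
  have /cvgrPdist_le/(_ _ d1) := Hh; apply: filterS => n.
  rewrite sub0r normrN nE ger0_norm ?powR_ge0// => H.
  have := tfin n; have := berg_ge0 q (fun k => t n k - l k).
  move: H; case: (berg q _) => [y| |]//= H; rewrite !lee_fin => y0 _.
  have := powR_le_inv _ y0 (ltW d0) H; apply; by rewrite invr_gt0.
have [N _ HN] := norm_limit_unique q0 dt dl t0 tl e0.
have := HN N (leqnn N).
have -> : t N = (fun k => (x (s N))%:C%C * rhaly_coef eta (test_coef (be (s N))) k).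
  by apply/funext => k; exact: tE.
rewrite (bergZ _ (x0 _) (dmt _)) => H.
have [_ _] := Hbe (s N); apply.
have xq0 : 0 < x (s N) `^ q by rewrite powR_gt0// powR_gt0.
have -> : (1 - be (s N)) `^ (- ((2 - 2 / p) * q)) = (x (s N) `^ q)^-1.
  by rewrite powRN /x -powRrM.
have n1 := berg_ge0 q (rhaly_coef eta (test_coef (be (s N)))).
move: H n1; case: (berg q _) => [y| |]//.
  by rewrite -EFinM !lee_fin => H y0; rewrite ler_pdivlMr// mulrC.
by rewrite gt0_muley ?lte_fin.
Qed.

Lemma little_lipschitz_of_compact p q eta : 1 < p -> p < q -> 2 / p - q^-1 < 1 -> disc_coef eta ->
  compact_operator (bergman p) (bergman_norm p) (bergman q) (bergman_norm q) (rhaly eta) ->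
  forall K : R, 0 < K -> exists2 r0 : R, 2^-1 <= r0 < 1 & forall r, r0 <= r < 1 ->
    (circ q (theta eta) r <= (K * (1 - r) `^ ((2 / p - q^-1 - 1) * q))%:E)%E.
Proof.
move=> p1 pq al1 de CO K K0.
have q0 : 0 < q by apply: lt_trans pq; exact: lt_trans p1.
have [C C0 HC] := circ_of_test_bound p1 pq al1.
pose Lam := K / (4 * C).
have L0 : 0 < Lam by rewrite divr_gt0// mulr_gt0.
have [be0 be01 Hbe] := small_test_of_compact p1 pq al1 de CO L0.
have HC' := HC eta be0 Lam de be01 (ltW L0) Hbe.
have [be2 be1] := andP be01.
have dte := disc_coef_theta de.
have cf : circ q (theta eta) be0 \is a fin_num.
  by apply: circ_fin => //; [exact: ltW|rewrite be1 andbT (le_trans _ be2)// invr_ge0].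
have c0 : 0 <= fine (circ q (theta eta) be0) by apply/fine_ge0/circ_ge0.
rewrite -(fineK cf) in HC'; move: (fine _) c0 HC' => c c0 {}HC.
set m := (2 / p - q^-1 - 1) * q in HC *.
have m0 : m < 0 by rewrite /m nmulr_rlt0 ?subr_lt0.
(* beyond r0 the constant term is absorbed by the growing power of 1 - r *)
pose del := (2 * (C * c + 1) / K) `^ m^-1.
have x0 : 0 < 2 * (C * c + 1) / K.
  by rewrite divr_gt0// mulr_gt0// ltr_wpDl// mulr_ge0// ltW.
have del0 : 0 < del by rewrite powR_gt0.
exists (Num.max be0 (1 - del)).
  by rewrite le_max be2 gt_max be1/= gtrBl.
move=> r /andP[]; rewrite ge_max => /andP[br dr] r1.
have r10 : 0 < 1 - r by rewrite subr_gt0.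
apply: (le_trans (HC r (introT andP (conj br r1)))); rewrite -EFinD -EFinM lee_fin.
have HX : 2 * (C * c + 1) / K <= (1 - r) `^ m.
  have -> : 2 * (C * c + 1) / K = del `^ m.
    by rewrite /del -powRrM mulVf ?lt_eqF// powRr1// ltW.
  by apply: powR_neg_le => //; [exact: ltW|move: dr; lra].
move: (_ `^ m) HX => X; rewrite ler_pdivrMr// => HX.
have -> : C * (c + 2 * Lam * X) = C * c + K / 2 * X by rewrite /Lam; field; rewrite gt_eqF.
by move: HX; lra.
Qed.

End NecessaryConditions.

Theorem theorem3 (R : realType) (eta : nat -> R[i]) (g : R[i] -> R[i])
    (g_hol : Hol g)
    (g_eta : forall z : R[i], unit_disc z -> power_sum_at eta z (g z))
    (p q : R) (p_gt1 : 1 < p) (p_lt_q : p < q) (hpq : 2 / p - 1 / q < 1) :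
  (bounded_operator (bergman p) (bergman_norm p)
       (bergman q) (bergman_norm q) (rhaly eta)
     <-> mean_lipschitz q (2 / p - 1 / q) g)
  /\
  (compact_operator (bergman p) (bergman_norm p)
       (bergman q) (bergman_norm q) (rhaly eta)
     <-> little_mean_lipschitz q (2 / p - 1 / q) g).
Proof.
have q0 : 0 < q by apply: lt_trans p_lt_q; exact: lt_trans p_gt1.
have [de ge] := power_sum_disc_coef g_eta.
rewrite [1 / q]mul1r in hpq *.
rewrite (mean_lipschitzP _ q0 de ge) (little_mean_lipschitzP _ q0 de ge).
split; split.
- exact: lipschitz_of_bounded.
- by move=> [K [r0 [K0 r01 H]]]; exact: bounded_of_lipschitz H.
- exact: little_lipschitz_of_compact.
- exact: compact_of_little_lipschitz.
Qed.
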